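(* Let $\Omega\subset\mathbb{R}^n$, $n\ge 3$, be a smoothly bounded domain with $0\in\Omega$, let $p>2^*=\frac{2n}{n-2}$ and $\alpha=\frac{2}{p-2}$. Let $0\le w_0\in C_c^\infty(B_1(0))$ with $E_{B_1(0)}(w_0)<0$, and set $$M=M_{w_0}=\sup_{|y|\le 1}\big(|y|^\alpha w_0(y)\big).$$ Then for every initial datum $0\le u_0\in C^0(\Omega\setminus\{0\})$ satisfying $$\liminf_{x\to 0}\big(u_0(x)-M|x|^{-\alpha}\big)>0$$ the minimal solution $u$ of $u_t-\Delta u=|u|^{p-2}u$ in $\Omega\times]0,\infty[$, $u=0$ on $\partial\Omega\times]0,\infty[$, $u|_{t=0}=u_0$, blows up completely instantaneously, i.e. $u\equiv\infty$ on $\Omega\times]0,\infty[$.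
   Context: For a bounded domain $D$, $E_D(u)=\int_D\big(\frac12|\nabla u|^2-\frac1p|u|^p\big)dx$. Minimal solution: for a measurable $u_0\ge 0$ and each $k\in\mathbb{N}$, let $u_k$ be the unique global solution of $\partial_t u_k-\Delta u_k=\min\{u_k^{p-1},k^{p-1}\}$ on $\Omega\times]0,\infty[$, $u_k=0$ on $\partial\Omega\times]0,\infty[$, $u_k(x,0)=\min\{u_0(x),k\}$. By the maximum principle $u_k\ge 0$ is nondecreasing in $k$, and the minimal solution is the pointwise limit $u(x,t)=\lim_{k\to\infty}u_k(x,t)\in[0,\infty]$. *)

(* Defs.v *)
From HB Require Import structures.
From mathcomp Require Import all_boot all_order all_algebra.
From mathcomp Require Import all_classical all_reals all_analysis.
Set Implicit Arguments. Unset Strict Implicit. Unset Printing Implicit Defensive.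
Import Order.TTheory GRing.Theory Num.Theory.
Import numFieldNormedType.Exports.
Local Open Scope classical_set_scope.
Local Open Scope ring_scope.

Section Defs.
Variable R : realType.

Definition coord {n} (x : 'rV[R]_n) (i : 'I_n) : R := x ord0 i.

Definition enorm {n} (x : 'rV[R]_n) : R := Num.sqrt (\sum_i coord x i ^+ 2).

Definition ebasis {n} (i : 'I_n) : 'rV[R]_n := \row_(j < n) (i == j)%:R.

Definition partial {n} (i : 'I_n) (f : 'rV[R]_n -> R) : 'rV[R]_n -> R :=
  fun x => 'D_(ebasis i) f x.

Fixpoint iter_partial {n} (l : seq 'I_n) (f : 'rV[R]_n -> R) : 'rV[R]_n -> R :=
  if l is i :: l' then partial i (iter_partial l' f) else f.

Definition smooth {n} (f : 'rV[R]_n -> R) : Prop :=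
  forall l : seq 'I_n,
    continuous (iter_partial l f) /\
    forall i x, derivable (iter_partial l f) x (ebasis i).

Definition grad_sq {n} (f : 'rV[R]_n -> R) (x : 'rV[R]_n) : R :=
  \sum_i (partial i f x) ^+ 2.

(* Lebesgue integral over R^n, as an iterated integral over the coordinates
   (agrees with the n-dimensional Lebesgue integral for continuous compactly
   supported integrands, by Fubini) *)
Fixpoint iter_integral (n : nat) : ('rV[R]_n -> R) -> R :=
  match n with
  | 0 => fun g => g 0
  | m.+1 => fun g =>
      Rintegral lebesgue_measure setT
        (fun t : R => iter_integral (fun y : 'rV[R]_m =>
                        g (row_mx (t%:M : 'rV[R]_1) y)))
  end.

Definition eball0 {n} (r : R) : set 'rV[R]_n := [set x | enorm x < r].

Definition energy {n} (p : R) (D : set 'rV[R]_n) (u : 'rV[R]_n -> R) : R :=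
  iter_integral (fun x => (\1_D x) *
     (2^-1 * grad_sq u x - p^-1 * (`|u x| `^ p))).

Definition smooth_bounded_domain {n} (Om : set 'rV[R]_n) : Prop :=
  open Om /\ connected Om /\ (exists C : R, forall x, Om x -> enorm x <= C) /\
  exists rho : 'rV[R]_n -> R, smooth rho /\
    Om = [set x | rho x < 0] /\
    (forall x, rho x = 0 -> exists i, partial i rho x != 0).

Definition bdry {n} (Om : set 'rV[R]_n) : set 'rV[R]_n := closure Om `\` Om.

Definition dx {n} (i : 'I_n) (u : 'rV[R]_n -> R -> R) : 'rV[R]_n -> R -> R :=
  fun x t => partial i (fun y => u y t) x.
Definition lap {n} (u : 'rV[R]_n -> R -> R) (x : 'rV[R]_n) (t : R) : R :=
  \sum_i dx i (dx i u) x t.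
Definition dt {n} (u : 'rV[R]_n -> R -> R) (x : 'rV[R]_n) (t : R) : R :=
  'D_1 (fun s : R => u x s) t.

Definition uncurry_fun {n} (u : 'rV[R]_n -> R -> R) : 'rV[R]_n * R -> R :=
  fun z => u z.1 z.2.

Definition trunc_nl (p : R) (k : nat) (s : R) : R :=
  Num.min (Num.max s 0 `^ (p - 1)) (k%:R `^ (p - 1)).

(* u is the (classical, bounded) global solution of
     u_t - Delta u = min{u^(p-1), k^(p-1)}  in Om x ]0,oo[,
     u = 0 on bdry Om x ]0,oo[,  u(.,0) = min{u0, k}  (on Om \ {0},
   the set where u0 is given). *)
Definition approx_solution {n} (Om : set 'rV[R]_n) (p : R) (k : nat)
    (u0 : 'rV[R]_n -> R) (u : 'rV[R]_n -> R -> R) : Prop :=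
  let Q := [set z : 'rV[R]_n * R | Om z.1 /\ 0 < z.2] in
  (forall x t, Om x -> 0 < t ->
     derivable (fun s : R => u x s) t 1 /\
     forall i j,
       derivable (fun y => u y t) x (ebasis i) /\
       derivable (fun y => dx j u y t) x (ebasis i)) /\
  {in Q, continuous (uncurry_fun u)} /\
  {in Q, continuous (uncurry_fun (@dt n u))} /\
  (forall i, {in Q, continuous (uncurry_fun (dx i u))}) /\
  (forall i j, {in Q, continuous (uncurry_fun (dx i (dx j u)))}) /\
  (forall x t, Om x -> 0 < t -> dt u x t - lap u x t = trunc_nl p k (u x t)) /\
  (forall x t, bdry Om x -> 0 < t ->
     u x t = 0 /\
     uncurry_fun u @ within [set z | closure Om z.1 /\ 0 < z.2] (nbhs (x, t))
       --> 0) /\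
  (forall x, Om x -> x != 0 ->
     uncurry_fun u @ within Q (nbhs (x, 0)) --> Num.min (u0 x) k%:R) /\
  (forall T, 0 < T -> exists C : R,
     forall x t, Om x -> 0 < t -> t < T -> `|u x t| <= C).

End Defs.

(* Main.v *)
Require Import Defs.
From HB Require Import structures.
From mathcomp Require Import all_boot all_order all_algebra.
From mathcomp Require Import all_classical all_reals all_analysis.
From mathcomp Require Import ring lra.
Import Order.TTheory GRing.Theory Num.Theory.
Import numFieldNormedType.Exports.
Local Open Scope classical_set_scope.
Local Open Scope ring_scope.

(** The proof replaces the unknown local solution starting from [w0] by an
    explicit Euler finite-difference scheme for the same equation. The discrete
    energy decreases along the scheme and is negative at the start, which forces
    the scheme, started from [w0], to exceed any level before a time T depending
    only on p and the energy. Rescaled to size lambda it starts below u0, since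
    lambda^(-alpha) w0(x/lambda) <= M |x|^(-alpha), and it reaches every level
    before time lambda^2 T. As long as it stays below k it is dominated by u_k;
    hence u_k reaches k/2 near the origin, before time lambda^2 T. Thanks to the
    gap between u0 and M |x|^(-alpha) the comparison holds for all translates of
    u_k by vectors of length at most r0, with r0 independent of k: thus u_k is at
    least k/2 on a whole ball of radius r0. Expansion of positivity for the heat
    equation carries this bound, up to a factor independent of k, to a later time
    and then to all of Omega. Every comparison with u_k is a minimum principle
    with explicit barriers. *)

Set Implicit Arguments. Unset Strict Implicit. Unset Printing Implicit Defensive.

(** * Calculus along lines *)

Section Calculus.
Variable R : realType.

(** Blow-up from negative energy is usually shown on a solution issued from [w0], whose existence,
    regularity and energy identity must come first. The scheme exists for free and its energy
    inequality is finite algebra: with time step h^2/(2n) the diffusion part of an Euler step is the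
    plain average over neighbours, so a step preserves order, and it is a gradient step for the
    discrete energy. The order of quantifiers makes the passage to [u_k] possible: T is fixed before
    the level, while the mesh may depend on k. The rescaling works because alpha = 2/(p-2) is the
    exponent for which a = lambda^alpha satisfies a lambda^2 = a^(p-1). Another obstacle is that
    [approx_solution] prescribes nothing where the boundary meets time 0, nor at the origin at time
    0: only boundedness is known there. A Gaussian-type barrier built on the defining function [rho]
    treats the former, the supersolution -ln(|x|^2 + 2t) the latter. *)

Lemma is_derive_continuous (f : R -> R) (x df : R) :
  is_derive x 1 f df -> {for x, continuous f}.
Proof. by move=> [fx _]; exact/differentiable_continuous/derivable1_diffP. Qed.

Lemma MVT_derive (f df : R -> R) (a b : R) : a < b ->
  (forall x : R, a <= x <= b -> is_derive x 1 f (df x)) ->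
  exists2 c, a < c < b & f b - f a = df c * (b - a).
Proof.
move=> ab fdf.
have [x||c] := @MVT R f df a b ab.
- by rewrite in_itv/= => /andP[ax xb]; apply: fdf; rewrite !ltW.
- apply: continuous_in_subspaceT => x; rewrite inE/= in_itv/= => xab.
  exact: is_derive_continuous (fdf _ xab).
- by rewrite in_itv/= => cab E; exists c.
Qed.

Lemma second_difference (f f1 f2 : R -> R) (s : R) : 0 < s ->
  (forall z : R, `|z| <= s -> is_derive z 1 f (f1 z)) ->
  (forall z : R, `|z| <= s -> is_derive z 1 f1 (f2 z)) ->
  exists2 z, `|z| <= s & f s + f (- s) - 2 * f 0 = s ^+ 2 * f2 z.
Proof.
move=> s0 H1 H2.
(* [A] makes [G] vanish at 0 and at [s]; the mean value theorem for [G], then for [f1] on [-c, c],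
   identifies it as a value of [f2]. *)
pose A := (f s + f (- s) - 2 * f 0) / s ^+ 2.
pose G (z : R) := f z + f (- z) - 2 * f 0 - A * z ^+ 2.
have dG (z : R) : 0 <= z <= s -> is_derive z 1 G (f1 z - f1 (- z) - A * (2 * z)).
  move=> /andP[z0 zs].
  have d1 := H1 z; rewrite ger0_norm// in d1; have {}d1 := d1 zs.
  have d2 := H1 (- z); rewrite normrN ger0_norm// in d2; have {}d2 := d2 zs.
  have dn : is_derive z 1 (fun z : R => - z) (- 1) by exact: is_deriveNid.
  have d3 := @is_derive1_comp R f (fun z : R => - z) z _ _ d2 dn.
  rewrite /G; apply: is_derive_eq.
  by rewrite /GRing.scale/=; ring.
have [c /andP[c0 cs] Ec] := MVT_derive s0 dG.
have G0 : G 0 = 0 by rewrite /G oppr0; ring.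
have Gs : G s = 0.
  by rewrite /G /A; field; rewrite gt_eqF.
have Ac : f1 c - f1 (- c) = A * (2 * c).
  move: Ec; rewrite G0 Gs !subr0 => /esym/eqP.
  rewrite mulf_eq0 (gt_eqF s0) orbF subr_eq0 => /eqP ->//.
have cNc : - c < c by lra.
have [x|d /andP[d1 d2] Ed] := @MVT_derive f1 f2 (- c) c cNc.
  by move=> xc; apply: H2; rewrite (le_trans _ (ltW cs))// ler_norml.
exists d; first by rewrite (le_trans _ (ltW cs))// ler_norml (ltW d1) ltW.
have : A = f2 d.
  apply: (@mulIf _ (2 * c)); first by rewrite gt_eqF//; lra.
  by rewrite -Ac Ed; congr (_ * _); ring.
by move=> <-; rewrite /A; field; rewrite gt_eqF.
Qed.

Variable n : nat.
Implicit Types (x v : 'rV[R]_n) (g : 'rV[R]_n -> R).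

Lemma is_derive_line g x v (z : R) : derivable g (x + z *: v) v ->
  is_derive z 1 (fun s : R => g (x + s *: v)) ('D_v g (x + z *: v)).
Proof.
move=> dg.
have E : (fun h : R => h^-1 *: (g (x + (h *: 1 + z) *: v) - g (x + z *: v)))
       = (fun h : R => h^-1 *: (g (h *: v + (x + z *: v)) - g (x + z *: v))).
  apply/funext => h; congr (_ *: (g _ - _)).
  by rewrite scalerDl /GRing.scale/= mulr1 addrCA.
by split; rewrite /derivable /derive /shift/= /shift/= E.
Qed.

Lemma MVT_partial g x v (s : R) : 0 < s ->
  (forall z, 0 <= z <= s -> derivable g (x + z *: v) v) ->
  exists2 z, 0 < z < s & g (x + s *: v) - g x = 'D_v g (x + z *: v) * s.
Proof.
move=> s0 dg.
have [z zs|z zs] := @MVT_derive (fun s => g (x + s *: v))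
  (fun z => 'D_v g (x + z *: v)) 0 s s0.
  exact/is_derive_line/dg.
by rewrite scale0r addr0 subr0 => E; exists z.
Qed.

Lemma second_difference_partial g x v (s : R) : 0 < s ->
  (forall z, `|z| <= s -> derivable g (x + z *: v) v) ->
  (forall z, `|z| <= s -> derivable (fun y => 'D_v g y) (x + z *: v) v) ->
  exists2 z, `|z| <= s &
    g (x + s *: v) + g (x - s *: v) - 2 * g x
    = s ^+ 2 * 'D_v (fun y => 'D_v g y) (x + z *: v).
Proof.
move=> s0 d1 d2.
have := @second_difference (fun s => g (x + s *: v))
  (fun s => 'D_v g (x + s *: v)) (fun s => 'D_v (fun y => 'D_v g y) (x + s *: v)) s s0.
move=> [z zs|z zs|z zs]; [exact/is_derive_line/d1|exact/is_derive_line/d2|].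
by rewrite scale0r addr0 scaleNr => E; exists z.
Qed.

End Calculus.

(** * The minimum principle *)

Section Norm.
Variables (R : realType) (n : nat).
Implicit Types x : 'rV[R]_n.

Lemma rV_norm_le x (c : R) : 0 <= c -> (`|x| <= c) = [forall i, `|x ord0 i| <= c].
Proof.
move=> c0; apply/idP/forallP => [xc i|xc].
  apply: le_trans xc; rewrite [leRHS]/Num.norm/= mx_normrE.
  by apply/bigmax_geP; right; exists (ord0, i).
rewrite /Num.norm/= mx_normrE; apply/bigmax_leP; split => // -[j i] _ /=.
by rewrite ord1.
Qed.

Lemma coord_le_norm x i : `|x ord0 i| <= `|x|.
Proof.
by have := rV_norm_le x (normr_ge0 x); rewrite lexx => /esym/forallP.
Qed.

Lemma ebasisE i j : (ebasis R i : 'rV[R]_n) ord0 j = (i == j)%:R.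
Proof. by rewrite mxE. Qed.

Lemma norm_ebasis_le (i : 'I_n) (s : R) : `|s *: (ebasis R i : 'rV[R]_n)| <= `|s|.
Proof.
rewrite rV_norm_le//; apply/forallP => j; rewrite mxE ebasisE normrM.
by case: eqP => _; rewrite ?normr1 ?mulr1// normr0 mulr0.
Qed.

Lemma open_ballP (O : set 'rV[R]_n) x : open O -> O x ->
  exists2 r, 0 < r & forall y, `|y - x| < r -> O y.
Proof.
move=> oO Ox; have /nbhs_ballP[r r0 rO] : nbhs x O by exact: open_nbhs_nbhs.
by exists r => // y yx; apply: rO; rewrite -ball_normE/= distrC.
Qed.

End Norm.

Section HeatOperator.
Variables (R : realType) (n : nat).
Implicit Types (z u : 'rV[R]_n -> R -> R) (x : 'rV[R]_n) (t : R).

(* The heat operator as a limit of difference quotients: only the left time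
   derivative and the symmetric second differences are involved, which is what
   a minimum principle sees, and the notion is additive without side conditions. *)
Definition heat_val z x t (H : R) := exists (B : R) (A : 'I_n -> R),
  [/\ (fun s : R => s^-1 * (z x t - z x (t - s))) @ 0^'+ --> B,
      forall i, (fun s : R => (s ^+ 2)^-1 *
        (z (x + s *: ebasis R i) t + z (x - s *: ebasis R i) t - 2 * z x t))
        @ 0^'+ --> A i
    & H = B - \sum_i A i].

Lemma cvg_ext (T : Type) (F : set_system T) (f g : T -> R) (l : R) :
  f =1 g -> f @ F --> l -> g @ F --> l.
Proof. by move=> /funext ->. Qed.

Lemma heat_valD z1 z2 x t H1 H2 : heat_val z1 x t H1 -> heat_val z2 x t H2 ->
  heat_val (fun y s => z1 y s + z2 y s) x t (H1 + H2).
Proof.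
move=> [B1 [A1 [b1 a1 ->]]] [B2 [A2 [b2 a2 ->]]].
exists (B1 + B2), (fun i => A1 i + A2 i); split; last first.
- by rewrite big_split/= opprD addrACA.
- by move=> i; apply: cvg_ext (cvgD (a1 i) (a2 i)) => s; rewrite /= ?fctE; ring.
- by apply: cvg_ext (cvgD b1 b2) => s; rewrite /= ?fctE; ring.
Qed.

Lemma heat_valZ c z x t H : heat_val z x t H ->
  heat_val (fun y s => c * z y s) x t (c * H).
Proof.
move=> [B [A [b a ->]]].
exists (c * B), (fun i => c * A i); split; last first.
- by rewrite mulrBr mulr_sumr.
- by move=> i; apply: cvg_ext (cvgMl_tmp (a := c) (a i)) => s; rewrite /= ?fctE; ring.
- by apply: cvg_ext (cvgMl_tmp (a := c) b) => s; rewrite /= ?fctE; ring.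
Qed.

Lemma heat_val_min z x t H : heat_val z x t H ->
  (\forall s \near 0^'+, z x t <= z x (t - s)) ->
  (forall i, \forall s \near 0^'+, z x t <= z (x + s *: ebasis R i) t /\
     z x t <= z (x - s *: ebasis R i) t) -> H <= 0.
Proof.
move=> [B [A [b a ->]]] ht hx; rewrite subr_le0 (@le_trans _ _ 0)//.
  apply: (cvgr_to_le b).
  near=> s; rewrite mulr_ge0_le0 ?invr_ge0// subr_le0; near: s.
  exact: ht.
apply: sumr_ge0 => i _; apply: (cvgr_to_ge (a i)).
near=> s; rewrite mulr_ge0 ?invr_ge0 ?exprn_ge0//.
have [] : z x t <= z (x + s *: ebasis R i) t /\ z x t <= z (x - s *: ebasis R i) t.
  by near: s; exact: hx.
by move=> ? ?; lra.
Unshelve. all: by end_near. Qed.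

Lemma closure_nbhs_within (T : topologicalType) (A : set T) (P : set T) (p : T) :
  closure A p -> (\forall enorm_sq \near within A (nbhs p), P enorm_sq) -> exists2 enorm_sq, A enorm_sq & P enorm_sq.
Proof.
by move=> cA /cA[enorm_sq [Aq /(_ Aq)]]; exists enorm_sq.
Qed.

(** The boundary hypothesis is a lower limit taken along the interior, so [z] need not extend
    continuously to the parabolic boundary. It forces the closure of a negative sublevel set into
    the interior; a minimum is then attained, and there the heat operator is nonpositive. The
    operator is tested only where [z < 0], so [z] may fail to be smooth elsewhere. *)
Lemma min_principle (D : set 'rV[R]_n) (a T : R) z :
  open D -> compact (closure D) ->
  (forall x t, D x -> a < t <= T -> {for (x, t), continuous (uncurry_fun z)}) ->
  (forall x t, D x -> a < t <= T -> z x t < 0 ->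
     exists2 H, 0 < H & heat_val z x t H) ->
  (forall x t, closure D x -> a <= t <= T -> ~ (D x /\ a < t) ->
     forall e, 0 < e ->
       \forall p \near within [set p | D p.1 /\ a < p.2 <= T] (nbhs (x, t)),
         - e < uncurry_fun z p) ->
  forall x t, D x -> a < t <= T -> 0 <= z x t.
Proof.
move=> oD cD cz hz bz x0 t0 Dx0 t0T; rewrite leNgt; apply/negP => z0.
pose Q := [set p : 'rV[R]_n * R | D p.1 /\ a < p.2 <= T].
pose S := Q `&` [set p | uncurry_fun z p <= z x0 t0].
have cSQ : closure S `<=` Q.
  move=> [x t] cS.
  have cQ : closure Q (x, t) by apply: closure_subset cS => p [].
  have Dx : closure D x.
    move=> V nV; have [|[y s] [[/= Dy _] [/= Vy _]]] := cQ (V `*` setT).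
      by exists (V, setT) => //=; split => //; exact: filterT.
    by exists y.
  have tT : a <= t <= T.
    have : closure [set s : R | s \in `[a, T]] t.
      move=> V nV; have [|[y s] [[/= Dy /andP[s1 s2]] [/= _ Vs]]] := cQ (setT `*` V).
        by exists (setT, V) => //=; split => //; exact: filterT.
      by exists s; split => //=; rewrite in_itv/= ltW.
    rewrite (_ : [set s | s \in `[a, T]] = `[a, T]%classic)//.
    by rewrite -(iffLR (closure_id _)) ?inE/= ?in_itv//; exact: interval_closed.
  apply: contrapT => nQ.
  have [|p [_ /= Sp]] := closure_nbhs_within cS (P := [set p | z x0 t0 < uncurry_fun z p]).
    have : \forall p \near within Q (nbhs (x, t)), - (- z x0 t0) < uncurry_fun z p.
      apply: bz => //; last by rewrite oppr_gt0.
      move=> [Dx' at']; apply: nQ; split => //=.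
      by rewrite at'; case/andP: tT.
    rewrite opprK => h; have {}h : nbhs (x, t) [set p | Q p -> z x0 t0 < uncurry_fun z p] := h.
    by apply: filterS h => p h [/h].
  by rewrite /= ltNge Sp.
have S0 : closure S (x0, t0).
  by apply: subset_closure; split; [split|rewrite /= /uncurry_fun/= lexx].
have compS : compact (closure S).
  apply: (@subclosed_compact _ _ (closure D `*` `[a, T]%classic)).
  - exact: closed_closure.
  - by apply: compact_setX => //; apply: segment_compact.
  - move=> p /cSQ[Dp pT]; split; first exact: subset_closure.
    by rewrite /= in_itv/= ; case/andP: pT => /ltW -> ->.
have [||[x t] /set_mem cxt hmin] := @compact_EVT_min _ R (uncurry_fun z) (closure S) _ compS.
- by exists (x0, t0).
- by apply: continuous_in_subspaceT => -[x t] /set_mem /cSQ[Dx tT]; exact: cz.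
have {}hmin y s : D y -> a < s <= T -> z x t <= z y s.
  move=> Dy sT; have [zs|zs] := leP (z y s) (z x0 t0).
    by apply: (hmin (y, s)); apply/mem_set/subset_closure; split.
  apply: (le_trans _ (ltW zs)); apply: (hmin (x0, t0)).
  exact/mem_set.
have [/= Dx /andP[at' tT]] := cSQ _ cxt.
have zxt : z x t < 0 by apply: le_lt_trans z0; exact: hmin.
have [H H0 /heat_val_min HH] := hz _ _ Dx (introT andP (conj at' tT)) zxt.
move: H0; rewrite ltNge => /negP; apply; apply: HH.
  near=> s; apply: hmin => //; apply/andP; split.
    by rewrite ltrBrDl -ltrBrDr; near: s; apply: nbhs_right_lt; rewrite subr_gt0.
  by rewrite lerBlDr (le_trans tT)// lerDl.
have [r r0 rD] := open_ballP oD Dx.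
move=> i; near=> s.
have sr : s < r by near: s; exact: nbhs_right_lt.
have s0 : 0 < s by [].
split; apply: hmin => //; rewrite ?at' ?tT//; apply: rD;
  rewrite addrC addKr ?normrN; apply: le_lt_trans (norm_ebasis_le _ _) _;
  by rewrite gtr0_norm.
Unshelve. all: by end_near. Qed.

End HeatOperator.

(** * Calculus rules for the heat operator *)

Section Jets.
Variables (R : realType) (n : nat).
Implicit Types (y z u : 'rV[R]_n -> R -> R) (x : 'rV[R]_n) (t : R).

Lemma near0_norm_le (P : R -> Prop) : (\forall s \near (0 : R), P s) ->
  \forall r \near 0^'+, forall s : R, `|s| <= r -> P s.
Proof.
move=> /nbhs_ballP[e /= e0 eP]; near=> r; move=> s sr; apply: eP => /=.
rewrite -ball_normE/= sub0r normrN. apply: (le_lt_trans sr).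
by near: r; exact: nbhs_right_lt.
Unshelve. all: by end_near. Qed.

Definition line y x t (i : 'I_n) (s : R) : R := y (x + s *: ebasis R i) t.

(* [B] is the time derivative, [G] the gradient and [A] the diagonal of the
   Hessian; only what is needed to compute [B - \sum_i A i] is recorded. *)
Definition heat_jet y x t (B : R) (G A : 'I_n -> R) :=
  is_derive t 1 (y x) B /\
  forall i, exists f1 f2 : R -> R,
    [/\ \forall s \near (0 : R), is_derive s (1 : R) (line y x t i) (f1 s),
        \forall s \near (0 : R), is_derive s (1 : R) f1 (f2 s),
        {for 0, continuous f2},
        f1 0 = G i & f2 0 = A i].

(** A second difference quotient is a value of [f2] at an intermediate point, so it converges by
    continuity of [f2] at 0. *)
Lemma heat_jet_val y x t B G A : heat_jet y x t B G A ->
  heat_val y x t (B - \sum_i A i).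
Proof.
move=> [dB HA]; exists B, A; split => //.
  case: dB => /cvg_ex[l Hl] <-; rewrite /derive (cvg_lim _ Hl)//.
  apply/cvgrPdist_le => e e0; move/cvgrPdist_le : Hl => /(_ _ e0).
  move=> /near0_norm_le Hl; near=> s.
  have s0 : 0 < s by [].
  have /(_ (- s)) : forall h : R, `|h| <= s -> h != 0 ->
    `|l - h^-1 *: (y x (h *: 1 + t) - y x t)| <= e by near: s.
  rewrite normrN gtr0_norm// lexx oppr_eq0 gt_eqF//= => /(_ isT isT).
  rewrite /GRing.scale/= mulr1 (addrC (- s)) invrN mulNr -mulrN opprB.
  exact.
move=> i; have [f1 [f2 [d1 d2 c2 E1 E2]]] := HA i.
apply/cvgrPdist_le => e e0.
have c2' : \forall s \near (0 : R), `|f2 0 - f2 s| <= e.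
  by move/cvgrPdist_le : c2; apply.
near=> s.
have s0 : 0 < s by [].
have [z zs|z zs|z zs] := @second_difference R (line y x t i) f1 f2 s s0.
- by move: z zs; near: s; exact: near0_norm_le.
- by move: z zs; near: s; exact: near0_norm_le.
rewrite /line scale0r addr0 scaleNr => ->.
rewrite mulrA mulVf ?mul1r ?gt_eqF ?exprn_gt0// -E2.
by move: z zs; near: s; exact: near0_norm_le.
Unshelve. all: by end_near. Qed.

Lemma heat_jet_continuous_line y x t B G A i : heat_jet y x t B G A ->
  {for 0, continuous (line y x t i)} /\ line y x t i 0 = y x t.
Proof.
move=> [_ /(_ i)[f1 [f2 [d1 _ _ _ _]]]]; split; last by rewrite /line scale0r addr0.
by have /is_derive_continuous := nbhs_singleton d1.
Qed.

Lemma heat_jetM y z x t B G A B' G' A' :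
  heat_jet y x t B G A -> heat_jet z x t B' G' A' ->
  heat_jet (fun x t => y x t * z x t) x t (B * z x t + y x t * B')
   (fun i => G i * z x t + y x t * G' i)
   (fun i => A i * z x t + 2 * (G i * G' i) + y x t * A' i).
Proof.
move=> Hy Hz; have [dB HA] := Hy; have [dB' HA'] := Hz; split.
  by apply: is_derive_eq; rewrite /GRing.scale/=; ring.
move=> i; have [f1 [f2 [d1 d2 c2 <- <-]]] := HA i.
have [g1 [g2 [e1 e2 b2 <- <-]]] := HA' i.
have [cy <-] := heat_jet_continuous_line i Hy.
have [cz <-] := heat_jet_continuous_line i Hz.
have cf1 := is_derive_continuous (nbhs_singleton d2).
have cg1 := is_derive_continuous (nbhs_singleton e2).
exists (fun s => f1 s * line z x t i s + line y x t i s * g1 s).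
exists (fun s => f2 s * line z x t i s + 2 * (f1 s * g1 s) + line y x t i s * g2 s).
split => //.
- near=> s.
  have D1 : is_derive s (1 : R) (line y x t i) (f1 s) by near: s.
  have D2 : is_derive s (1 : R) (line z x t i) (g1 s) by near: s.
  by rewrite /line in D1 D2 *; apply: is_derive_eq; rewrite /GRing.scale/=; ring.
- near=> s.
  have D1 : is_derive s (1 : R) (line y x t i) (f1 s) by near: s.
  have D2 : is_derive s (1 : R) (line z x t i) (g1 s) by near: s.
  have D3 : is_derive s (1 : R) f1 (f2 s) by near: s.
  have D4 : is_derive s (1 : R) g1 (g2 s) by near: s.
  by apply: is_derive_eq; rewrite /GRing.scale/=; ring.
- apply: cvgD; first apply: cvgD.
  + exact: cvgM.
  + by apply: cvgM; [exact: cvg_cst|exact: cvgM].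
  + exact: cvgM.
Unshelve. all: by end_near. Qed.

Lemma heat_jet_comp (f f1 f2 : R -> R) y x t B G A :
  (\forall s \near y x t, is_derive s (1 : R) f (f1 s)) ->
  (\forall s \near y x t, is_derive s (1 : R) f1 (f2 s)) ->
  {for y x t, continuous f2} ->
  heat_jet y x t B G A ->
  heat_jet (fun x t => f (y x t)) x t (f1 (y x t) * B)
   (fun i => f1 (y x t) * G i)
   (fun i => f2 (y x t) * G i ^+ 2 + f1 (y x t) * A i).
Proof.
move=> df1 df2 cf2 Hy; have [dB HA] := Hy; split.
  have d := nbhs_singleton df1.
  by have := @is_derive1_comp R f (y x) t _ _ d dB.
move=> i; have [g1 [g2 [e1 e2 b2 <- <-]]] := HA i.
have [cy Ey] := heat_jet_continuous_line i Hy.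
have cg1 := is_derive_continuous (nbhs_singleton e2).
have cf1 := is_derive_continuous (nbhs_singleton df2).
have near_comp (P : R -> Prop) : (\forall s \near y x t, P s) ->
    \forall s \near (0 : R), P (line y x t i s).
  by rewrite -Ey => /cy.
exists (fun s => f1 (line y x t i s) * g1 s).
exists (fun s => f2 (line y x t i s) * g1 s ^+ 2 + f1 (line y x t i s) * g2 s).
split => //.
- have h := near_comp _ df1; near=> s.
  have D1 : is_derive s (1 : R) (line y x t i) (g1 s) by near: s.
  have D2 : is_derive (line y x t i s) (1 : R) f (f1 (line y x t i s)) by near: s.
  exact: (@is_derive1_comp R f (line y x t i) s _ _ D2 D1).
- have h := near_comp _ df2; near=> s.
  have D1 : is_derive s (1 : R) (line y x t i) (g1 s) by near: s.
  have D2 : is_derive (line y x t i s) (1 : R) f1 (f2 (line y x t i s)) by near: s.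
  have D3 := @is_derive1_comp R f1 (line y x t i) s _ _ D2 D1.
  have D4 : is_derive s (1 : R) g1 (g2 s) by near: s.
  have := @is_deriveM _ _ (f1 \o line y x t i) g1 s 1 _ _ D3 D4.
  move=> D5; apply: (is_derive_eq D5).
  by rewrite /GRing.scale/=; ring.
- have cc (h : R -> R) : {for y x t, continuous h} ->
     h (line y x t i s) @[s --> 0] --> h (line y x t i 0).
    by rewrite -Ey => ch; apply: (cvg_comp _ _ cy).
  apply: cvgD; apply: cvgM => //; try exact: cc.
  by apply: cvgM.
- by rewrite Ey.
- by rewrite Ey.
Unshelve. all: by end_near. Qed.

Lemma heat_jetD y z x t B G A B' G' A' :
  heat_jet y x t B G A -> heat_jet z x t B' G' A' ->
  heat_jet (fun x t => y x t + z x t) x t (B + B')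
   (fun i => G i + G' i) (fun i => A i + A' i).
Proof.
move=> [dB HA] [dB' HA']; split.
  by apply: is_derive_eq.
move=> i; have [f1 [f2 [d1 d2 c2 <- <-]]] := HA i.
have [g1 [g2 [e1 e2 b2 <- <-]]] := HA' i.
exists (fun s => f1 s + g1 s), (fun s => f2 s + g2 s).
split => //.
- near=> s.
  have D1 : is_derive s (1 : R) (line y x t i) (f1 s) by near: s.
  have D2 : is_derive s (1 : R) (line z x t i) (g1 s) by near: s.
  by rewrite /line in D1 D2 *; apply: is_derive_eq.
- near=> s.
  have D3 : is_derive s (1 : R) f1 (f2 s) by near: s.
  have D4 : is_derive s (1 : R) g1 (g2 s) by near: s.
  by apply: is_derive_eq.
- exact: cvgD.
Unshelve. all: by end_near. Qed.

Lemma heat_jet_time (f : R -> R) x t B : is_derive t 1 f B ->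
  heat_jet (fun _ => f) x t B (fun=> 0) (fun=> 0).
Proof.
move=> dB; split => // i; exists (fun=> 0), (fun=> 0); split => //.
- by near=> s; rewrite /line; exact: is_derive_cst.
- by near=> s; exact: is_derive_cst.
- exact: cvg_cst.
Unshelve. all: by end_near. Qed.

Definition enorm_sq x : R := \sum_i x ord0 i ^+ 2.

Lemma enorm_sq_line x i s : enorm_sq (x + s *: ebasis R i) = enorm_sq x + 2 * x ord0 i * s + s ^+ 2.
Proof.
rewrite /enorm_sq (bigD1 i)//= [in RHS](bigD1 i)//= !mxE eqxx mulr1.
rewrite (eq_bigr (fun j => x ord0 j ^+ 2)); first by ring.
by move=> j ji; rewrite !mxE eq_sym (negbTE ji) mulr0 addr0.
Qed.

Lemma heat_jet_enorm_sq x t : heat_jet (fun x _ => enorm_sq x) x t 0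
  (fun i => 2 * x ord0 i) (fun=> 2).
Proof.
split; first exact: is_derive_cst.
move=> i; exists (fun s => 2 * x ord0 i + 2 * s), (fun=> 2); split => //.
- near=> s.
  have -> : line (fun x _ => enorm_sq x) x t i = fun s => enorm_sq x + 2 * x ord0 i * s + s ^+ 2.
    by apply/funext => r; rewrite /line enorm_sq_line.
  by apply: is_derive_eq; rewrite /GRing.scale/=; ring.
- by near=> s; apply: is_derive_eq; rewrite /GRing.scale/=; ring.
- exact: cvg_cst.
- by rewrite mulr0 addr0.
Unshelve. all: by end_near. Qed.

End Jets.

(** * Supersolutions and the logarithmic barrier *)

Section Supersolutions.
Variables (R : realType) (n : nat).
Implicit Types (u z : 'rV[R]_n -> R -> R) (x : 'rV[R]_n) (t : R) (Om : set 'rV[R]_n).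

Definition supersolution Om u :=
  (forall x t, Om x -> 0 < t -> {for (x, t), continuous (uncurry_fun u)}) /\
  (forall x t, Om x -> 0 < t -> exists2 H, 0 <= H & heat_val u x t H).

Lemma cvg_pair_point (T : Type) (U V : topologicalType) (F : set_system T) {FF : Filter F}
  (f : T -> U) (g : T -> V) (a : U) (b : V) :
  f @ F --> a -> g @ F --> b -> (fun w => (f w, g w)) @ F --> (a, b).
Proof. exact: (@cvg_pair _ _ _ F (nbhs a) (nbhs b)). Qed.

Lemma continuous_slice u x t : {for (x, t), continuous (uncurry_fun u)} ->
  {for x, continuous (fun y => u y t)}.
Proof.
move=> cu; have : (fun y : 'rV[R]_n => (y, t)) y @[y --> x] --> (x, t).
  by apply: (@cvg_pair_point _ _ _ _ (nbhs_filter x) id (fun=> t)); [by move=> A|exact: cvg_cst].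
by move=> h; have := cvg_comp _ _ h cu.
Qed.

Lemma continuous_along (f : 'rV[R]_n -> R) x i : {for x, continuous f} ->
  {for 0, continuous (fun s : R => f (x + s *: ebasis R i))}.
Proof.
move=> cf.
have h : (fun s : R => x + s *: ebasis R i) s @[s --> 0] --> x + 0 *: ebasis R i.
  by apply: cvgD; [exact: cvg_cst|exact: scalel_continuous].
rewrite /continuous_at; apply: (cvg_comp _ _ h); rewrite scale0r addr0; exact: cf.
Qed.

Lemma near_along Om x i : open Om -> Om x ->
  \forall s \near (0 : R), Om (x + s *: ebasis R i).
Proof.
move=> oO Ox; have [r r0 rO] := open_ballP oO Ox.
apply/nbhs_ballP; exists r => // s; rewrite -ball_normE/= sub0r normrN => sr.
by apply: rO; rewrite addrC addKr (le_lt_trans (norm_ebasis_le _ _)).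
Qed.

Lemma heat_val_classical Om u x t : open Om -> Om x ->
  (forall x, Om x -> derivable (fun s : R => u x s) t 1 /\
     forall i, derivable (fun y => u y t) x (ebasis R i) /\
               derivable (fun y => dx i u y t) x (ebasis R i)) ->
  (forall i, {for (x, t), continuous (uncurry_fun (dx i (dx i u)))}) ->
  heat_val u x t (dt u x t - lap u x t).
Proof.
move=> oO Ox du cu.
apply: (@heat_jet_val _ _ _ _ _ _ (fun i => dx i u x t)); split.
  by apply: derivableP; have [] := du _ Ox.
move=> i; exists (fun s => dx i u (x + s *: ebasis R i) t).
exists (fun s => dx i (dx i u) (x + s *: ebasis R i) t).
have O_near := near_along i oO Ox.
split; rewrite ?scale0r ?addr0//.
- near=> s.
  have Os : Om (x + s *: ebasis R i) by near: s.
  exact: is_derive_line (proj1 (proj2 (du _ Os) i)).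
- near=> s.
  have Os : Om (x + s *: ebasis R i) by near: s.
  exact: is_derive_line (proj2 (proj2 (du _ Os) i)).
- exact: (continuous_along (f := fun y => dx i (dx i u) y t)) (continuous_slice (cu i)).
Unshelve. all: by end_near. Qed.

Lemma trunc_nl_ge0 (p : R) k s : 0 <= trunc_nl p k s.
Proof. by rewrite /trunc_nl le_min !powR_ge0. Qed.

Lemma approx_supersolution Om p k (u0 : 'rV[R]_n -> R) u : open Om ->
  approx_solution Om p k u0 u -> supersolution Om u.
Proof.
move=> oO [d [cu [_ [_ [c2 [eq _]]]]]].
have Qm x t : Om x -> 0 < t ->
  (x, t) \in [set z : 'rV[R]_n * R | Om z.1 /\ 0 < z.2] by move=> *; apply/mem_set.
split=> x t Ox t0; first exact/cu/Qm.
exists (dt u x t - lap u x t); first by rewrite eq// trunc_nl_ge0.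
apply: (heat_val_classical oO) => //.
  by move=> y Oy; have [h1 h2] := d _ _ Oy t0; split => // i; exact: h2.
by move=> i; apply/c2/Qm.
Qed.

Lemma enorm_sq_ge0 x : 0 <= enorm_sq x.
Proof. by apply: sumr_ge0 => i _; exact: sqr_ge0. Qed.

Lemma cvg_sumr (T I : Type) (F : set_system T) {FF : Filter F} (r : seq I)
  (f : I -> T -> R) (l : I -> R) :
  (forall i, f i @ F --> l i) ->
  (fun w => \sum_(i <- r) f i w) @ F --> \sum_(i <- r) l i.
Proof.
move=> fl; elim: r => [|i r IH].
  by under eq_fun do rewrite big_nil; rewrite big_nil; exact: cvg_cst.
by under eq_fun do rewrite big_cons; rewrite big_cons; exact: cvgD.
Qed.

Lemma enorm_sq_continuous : continuous (@enorm_sq R n).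
Proof.
move=> x; apply: (@cvg_sumr _ _ (nbhs x) _ _ (fun i (x : 'rV[R]_n) => x ord0 i ^+ 2)) => i.
by apply: (@cvg_comp _ _ _ (fun x : 'rV[R]_n => x ord0 i) (fun y => y ^+ 2));
  [exact: coord_continuous|exact: exprn_continuous].
Qed.

Lemma enormE x : enorm x = Num.sqrt (enorm_sq x). Proof. by []. Qed.

Lemma coord_le_enorm x i : `|x ord0 i| <= enorm x.
Proof.
rewrite enormE -sqrtr_sqr ler_sqrt ?enorm_sq_ge0// /enorm_sq (bigD1 i)//= lerDl.
by apply: sumr_ge0 => j _; exact: sqr_ge0.
Qed.

Lemma norm_le_enorm x : `|x| <= enorm x.
Proof. by rewrite rV_norm_le ?sqrtr_ge0//; apply/forallP => i; exact: coord_le_enorm. Qed.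

Lemma compact_norm_le (c : R) : compact [set x : 'rV[R]_n | `|x| <= c].
Proof.
apply: bounded_closed_compact.
  by exists c; split; [exact: num_real|move=> y cy x /= /le_trans; apply; exact: ltW].
apply: (@closed_comp _ _ (fun x : 'rV[R]_n => `|x|) [set y | y <= c]).
  by move=> x _; exact: norm_continuous.
exact: closed_le.
Qed.

Lemma compact_closure Om (c : R) : (forall x, Om x -> `|x| <= c) -> compact (closure Om).
Proof.
move=> Oc; apply: subclosed_compact (@compact_norm_le c) _; first exact: closed_closure.
rewrite [X in _ `<=` X](_ : _ = closure [set x | `|x| <= c]).
  by apply: closure_subset => x /Oc.
exact/closure_id/(compact_closed (@norm_hausdorff _ _))/compact_norm_le.
Qed.

Lemma near_gt (a b : R) : a < b -> \forall s \near b, a < s.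
Proof. by move=> ab; apply: open_nbhs_nbhs; split; [exact: open_gt|]. Qed.

(** With Y = |x|^2 + 2t the heat operator gives ((2n - 2) Y - 4 |x|^2) / Y^2, and 2n - 2 >= 4 while
    |x|^2 <= Y. Small multiples of this function are infinite at (0, 0) and negligible at any fixed
    point of positive time. *)
Lemma point_barrier x t : (3 <= n)%N -> 0 < t ->
  exists2 H, 0 <= H & heat_val (fun x t => - ln (enorm_sq x + 2 * t)) x t H.
Proof.
move=> n3 t0.
have y0 : 0 < enorm_sq x + 2 * t by rewrite ltr_wpDl ?enorm_sq_ge0// mulr_gt0.
have Hq := heat_jet_enorm_sq x t.
have Ht : heat_jet (fun _ (t : R) => 2 * t) x t 2 (fun=> 0) (fun=> 0).
  apply: heat_jet_time; apply: is_derive_eq; rewrite /GRing.scale/=; ring.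
have H := heat_jet_comp (f := fun y => - ln y) (f1 := fun y => - y^-1)
  (f2 := fun y => y ^- 2) _ _ _ (heat_jetD Hq Ht).
eexists; last first.
  apply: heat_jet_val; apply: H.
  - near=> s.
    have s0 : 0 < s by near: s; exact: near_gt.
    have ? := is_derive1_ln s0; exact: is_deriveN.
  - near=> s.
    have s0 : 0 < s by near: s; exact: near_gt.
    have s0' : s != 0 by rewrite gt_eqF.
    have := @is_deriveV R id s 1 1 s0' _ => h.
    apply: is_derive_eq; rewrite /GRing.scale/=; field.
    by rewrite gt_eqF.
  - have y0' : (enorm_sq x + 2 * t) ^+ 2 != 0 by rewrite gt_eqF// exprn_gt0.
    apply: (@cvgV _ _ _ _ _ _ y0').
    by under eq_fun do rewrite expr2; rewrite expr2; apply: cvgM; exact: cvg_id.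
set Y := enorm_sq x + 2 * t in y0 *.
rewrite [X in _ - X](_ : _ = 4 * enorm_sq x / Y ^+ 2 - n%:R * (2 / Y)); last first.
  rewrite big_split/= (eq_bigr (fun i => 4 / Y ^+ 2 * x ord0 i ^+ 2)); last first.
    by move=> i _; rewrite addr0; field; rewrite gt_eqF.
  rewrite -mulr_sumr sumr_const card_ord -mulr_natl -/(enorm_sq x).
  by field; rewrite gt_eqF.
have qY : enorm_sq x <= Y by rewrite lerDl mulr_ge0// ltW.
have n3' : 3 <= n%:R :> R by rewrite ler_nat.
have -> : - Y^-1 * (0 + 2) - (4 * enorm_sq x / Y ^+ 2 - n%:R * (2 / Y)) =
   ((2 * n%:R - 2) * Y - 4 * enorm_sq x) / Y ^+ 2 by field; rewrite gt_eqF.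
rewrite divr_ge0 ?exprn_ge0 ?(ltW y0)//.
by have := enorm_sq_ge0 x; nra.
Unshelve. all: by end_near. Qed.

End Supersolutions.

(** * Barriers and positivity *)

Section CornerBarrier.
Variables (R : realType) (n : nat).

Lemma compact_upper_bound (T : topologicalType) (C : set T) (f : T -> R) :
  compact C -> continuous f -> exists2 M, 0 < M & forall x, C x -> f x <= M.
Proof.
move=> /compact_near_coveringP cC cf.
have [|N _ /(_ _ (leqnn N)) CN] := cC nat \oo (fun N x => f x <= N%:R) _.
  move=> x Cx; near=> y N => /=; apply: (@le_trans _ _ (f x + 1)).
    by near: y; apply: (cvgr_le _ (cf x)); rewrite ltrDl.
  near: N; exact: nbhs_infty_ger.
exists (N%:R + 1); first by rewrite ltr_wpDl.
by move=> x /CN /le_trans; apply; rewrite lerDl.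
Unshelve. all: by end_near. Qed.

(** Here [g] is |grad rho|^2, [l] the Laplacian of rho and [s] is t + eta; the expression is phi_t -
    Delta phi - |grad phi|^2 for phi = [corner_exponent]. Near the boundary the term 2 b g / s is
    positive because rho has no critical zero; away from it rho^2 / s^2 wins for small s and the
    constant K for the others. *)
Lemma corner_constants (T : topologicalType) (C : set T) (rho g l : T -> R) :
  compact C -> continuous rho -> continuous g -> continuous l ->
  (forall x, 0 <= g x) -> (forall x, C x -> rho x = 0 -> 0 < g x) ->
  exists b th K, [/\ 0 < b, 0 < th, 0 <= K & forall x s, C x -> 0 < s ->
    0 <= K - th / s + b * rho x ^+ 2 / s ^+ 2
         - 4 * b ^+ 2 * rho x ^+ 2 * g x / s ^+ 2
         + 2 * b / s * (g x + rho x * l x)].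
Proof.
move=> cC crho cg cl g0 gpos.
have [G G0 hG] := compact_upper_bound cC cg.
have crho2 : continuous (fun x => rho x ^+ 2).
  by move=> x; apply: (@cvg_comp _ _ _ rho (fun y => y ^+ 2)); [exact: crho|exact: exprn_continuous].
have [P P0 hP] := compact_upper_bound cC crho2.
have cA : continuous (fun x => g x + rho x * l x).
  by move=> x; apply: cvgD; [exact: cg|apply: cvgM; [exact: crho|exact: cl]].
(* Where rho vanishes [g] is positive, elsewhere a multiple of rho^2 compensates. By compactness a
   single integer gives the multiple and, through its inverse, the lower bound. *)
have [N CN] : exists N : nat, forall x, C x ->
    N.+1%:R^-1 <= g x + rho x * l x + N%:R * rho x ^+ 2.
  have /compact_near_coveringP cC' := cC.
  have [|N _ /(_ _ (leqnn N)) CN] := cC' nat \oo (fun N x =>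
    N.+1%:R^-1 <= g x + rho x * l x + N%:R * rho x ^+ 2) _; last by exists N.
  move=> x Cx.
  have [N0 hN0] : exists N0 : nat, 0 < g x + rho x * l x + N0%:R * rho x ^+ 2.
    have [r0|r0] := eqVneq (rho x) 0.
      by exists 0%N; rewrite r0 !mul0r !addr0; exact: gpos.
    have r2 : 0 < rho x ^+ 2 by rewrite exprn_even_gt0.
    exists (Num.bound `|(- (g x + rho x * l x)) / rho x ^+ 2|).
    rewrite -ltrBlDl sub0r -ltr_pdivrMr//.
    by rewrite (le_lt_trans (ler_norm _))// archi_boundP.
  have cB : {for x, continuous (fun x => g x + rho x * l x + N0%:R * rho x ^+ 2)}.
    by apply: cvgD; [exact: cA|apply: cvgMl_tmp; exact: crho2].
  set m := g x + rho x * l x + N0%:R * rho x ^+ 2 in hN0.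
  have m20 : 0 < m / 2 by rewrite divr_gt0.
  near=> y M => /=; apply: (@le_trans _ _ (m / 2)).
    apply: ltW; near: M; exact: (near_infty_natSinv_lt (PosNum m20)).
  have MN : (N0 <= M)%N by near: M; exact: nbhs_infty_ge.
  apply: (@le_trans _ _ (g y + rho y * l y + N0%:R * rho y ^+ 2)); last first.
    by rewrite lerD2l ler_wpM2r ?sqr_ge0// ler_nat.
  by near: y; apply: (cvgr_ge _ cB); rewrite -/m; lra.
(* [b] keeps the gradient term below half of b rho^2 / s^2, [th] spends half of the gain 2 b m / s,
   and [K] completes a square: v^2/2 - 2Lv + 2L^2 = (v - 2L)^2 / 2 with v = 1/s. *)
pose b := (8 * G)^-1; pose m : R := N.+1%:R^-1; pose L : R := N%:R.
have b0 : 0 < b by rewrite invr_gt0 mulr_gt0.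
have m0 : 0 < m by rewrite invr_gt0.
exists b, (b * m), (2 * b * L ^+ 2 * P).
split; rewrite ?mulr_gt0 ?mulr_ge0 ?sqr_ge0 ?(ltW b0) ?(ltW P0)//.
move=> x s Cx s0.
have := hG _ Cx; have := hP _ Cx; have := CN _ Cx; have := g0 x.
rewrite -/m -/L; set A := g x + _; set r := rho x ^+ 2; set gx := g x.
have r0 : 0 <= r by exact: sqr_ge0.
move=> gx0 hA hr hg.
pose v := s^-1.
have v0 : 0 < v by rewrite invr_gt0.
have -> : b * r / s ^+ 2 = b * r * v ^+ 2 by rewrite exprVn.
have -> : 4 * b ^+ 2 * r * gx / s ^+ 2 = (b * r * v ^+ 2) * (4 * (b * gx)).
  by rewrite /v; field; rewrite gt_eqF.
rewrite -/v.
have bg : 4 * (b * gx) <= 2^-1.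
  have : b * gx <= b * G by rewrite ler_pM2l.
  have -> : b * G = 8^-1 by rewrite /b; field; rewrite gt_eqF.
  lra.
have h1 : (b * r * v ^+ 2) * (4 * (b * gx)) <= (b * r * v ^+ 2) * 2^-1.
  by rewrite ler_wpM2l// mulr_ge0 ?sqr_ge0// mulr_ge0// ltW.
have h2 : 2 * b * v * (m - L * r) <= 2 * b * v * A.
  by rewrite ler_wpM2l ?lerBlDr// !mulr_ge0// ltW.
have h3 : 0 <= b * r * (v / 2 - 2 * L) ^+ 2.
  by rewrite mulr_ge0 ?sqr_ge0// mulr_ge0// ltW.
have h4 : 2 * b * L ^+ 2 * r <= 2 * b * L ^+ 2 * P.
  by rewrite ler_wpM2l// !mulr_ge0 ?sqr_ge0// ltW.
have h5 : 0 <= b * m * v by rewrite !mulr_ge0// ltW.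
have : 0 <= b * r * (v - 2 * L) ^+ 2 by rewrite mulr_ge0 ?sqr_ge0// mulr_ge0// ltW.
nra.
Unshelve. all: by end_near. Qed.

End CornerBarrier.

Section CornerFunction.
Variables (R : realType) (n : nat).
Implicit Types (u z : 'rV[R]_n -> R -> R) (x : 'rV[R]_n) (t : R) (Om : set 'rV[R]_n).

Lemma continuous_fst_comp (f : 'rV[R]_n -> R) x t : {for x, continuous f} ->
  {for (x, t), continuous (fun p : 'rV[R]_n * R => f p.1)}.
Proof.
by move=> cf; apply: (@cvg_comp _ _ _ (fun p : 'rV[R]_n * R => p.1) f); [exact: cvg_fst|exact: cf].
Qed.

Lemma continuous_snd_comp (f : R -> R) x t : {for t, continuous f} ->
  {for (x, t), continuous (fun p : 'rV[R]_n * R => f p.2)}.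
Proof.
by move=> cf; apply: (@cvg_comp _ _ _ (fun p : 'rV[R]_n * R => p.2) f); [exact: cvg_snd|exact: cf].
Qed.

Lemma smooth_jet (rho : 'rV[R]_n -> R) x t : smooth rho ->
  heat_jet (fun x _ => rho x) x t 0 (fun i => partial i rho x)
    (fun i => partial i (partial i rho) x).
Proof.
move=> srho; split; first exact: is_derive_cst.
move=> i; have [c0 d0] := srho [::]; have [c1 d1] := srho [:: i].
have [c2 d2] := srho [:: i; i].
exists (fun s => partial i rho (x + s *: ebasis R i)).
exists (fun s => partial i (partial i rho) (x + s *: ebasis R i)).
split; rewrite ?scale0r ?addr0//.
- by near=> s; exact/is_derive_line/d0.
- by near=> s; exact/is_derive_line/d1.
- exact/continuous_along/c2.
Unshelve. all: by end_near. Qed.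

(* On [rho = 0] the function [expR corner_exponent] is 1 at time 0, and for
   fixed positive time it tends to 0 with [eta]: it makes up for the absence
   of any information on a solution at the corner (boundary) x {0}. *)
Definition corner_exponent (b th K eta : R) (rho : 'rV[R]_n -> R) x t : R :=
  (K * t - th * (ln (t + eta) - ln eta)) + rho x * rho x * (- b / (t + eta)).

(** The heat operator applied to exp(phi) is exp(phi) times phi_t - Delta phi - |grad phi|^2, and
    this factor is the quantity assumed nonnegative. *)
Lemma corner_barrier (b th K eta : R) (rho : 'rV[R]_n -> R) x t :
  smooth rho -> 0 < eta -> 0 < t ->
  0 <= K - th / (t + eta) + b * rho x ^+ 2 / (t + eta) ^+ 2
         - 4 * b ^+ 2 * rho x ^+ 2 * grad_sq rho x / (t + eta) ^+ 2
         + 2 * b / (t + eta) * (grad_sq rho x + rho x * \sum_i partial i (partial i rho) x) ->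
  exists2 H, 0 <= H &
    heat_val (fun x t => expR (corner_exponent b th K eta rho x t)) x t H.
Proof.
move=> srho eta0 t0 ineq.
have s0 : 0 < t + eta by exact: addr_gt0.
have J1 : heat_jet (fun _ t => K * t - th * (ln (t + eta) - ln eta)) x t
    (K - th / (t + eta)) (fun=> 0) (fun=> 0).
  apply: heat_jet_time.
  have dln := is_derive1_ln s0.
  have dsh : is_derive t (1 : R) (fun s => s + eta) 1.
    by apply: is_derive_eq; rewrite addr0.
  have dlns := @is_derive1_comp R (@ln R) (fun s => s + eta) t _ _ dln dsh.
  rewrite mulr1 in dlns.
  have e : (fun s => ln (s + eta)) = (@ln R \o (fun s => s + eta)) by [].
  have dlns' : is_derive t (1 : R) (fun s => ln (s + eta)) (t + eta)^-1 by rewrite e.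
  by apply: is_derive_eq; rewrite /GRing.scale/=; ring.
have J2 : heat_jet (fun _ t => - b / (t + eta)) x t
    (b / (t + eta) ^+ 2) (fun=> 0) (fun=> 0).
  apply: heat_jet_time.
  have dsh : is_derive t (1 : R) (fun s => s + eta) 1.
    by apply: is_derive_eq; rewrite addr0.
  have s1 : t + eta != 0 by rewrite gt_eqF.
  have dV := @is_deriveV R (fun s => s + eta) t 1 1 s1 dsh.
  by apply: is_derive_eq; rewrite /GRing.scale/=; field.
have Jr := smooth_jet x t srho.
have J := heat_jetD J1 (heat_jetM (heat_jetM Jr Jr) J2).
have JE := heat_jet_comp (f := expR) (f1 := expR) (f2 := expR) _ _ _ J.
eexists; last first.
  apply: heat_jet_val; apply: JE.
  - by near=> s; exact: is_derive_expR.
  - by near=> s; exact: is_derive_expR.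
  - exact: continuous_expR.
rewrite -/(corner_exponent b th K eta rho x t).
set E := expR _; have E0 : 0 <= E by exact: expR_ge0.
set s := t + eta in s0 ineq *.
rewrite [X in _ - X](_ : _ = E * (4 * b ^+ 2 * rho x ^+ 2 / s ^+ 2 * grad_sq rho x
   - 2 * b / s * (grad_sq rho x + rho x * \sum_i partial i (partial i rho) x))); last first.
  rewrite /grad_sq mulr_sumr [X in _ - _ * (_ + X)]mulr_sumr -big_split/= mulr_sumr -sumrB mulr_sumr.
  by apply: eq_bigr => i _; field; rewrite gt_eqF.
rewrite -mulrBr mulr_ge0//.
apply: le_trans ineq _; rewrite le_eqVlt; apply/orP; left; apply/eqP.
by field; rewrite gt_eqF.
Unshelve. all: by end_near. Qed.

Lemma corner_exponent_continuous (b th K eta : R) (rho : 'rV[R]_n -> R) x t :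
  continuous rho -> 0 < t + eta ->
  {for (x, t), continuous (uncurry_fun (fun x t => expR (corner_exponent b th K eta rho x t)))}.
Proof.
move=> crho s0.
apply: (@cvg_comp _ _ _ (fun p : 'rV[R]_n * R => corner_exponent b th K eta rho p.1 p.2) (@expR R));
  last exact: continuous_expR.
have cadd : {for t, continuous (fun s => s + eta)}.
  by apply: cvgD; [exact: cvg_id|exact: cvg_cst].
apply: cvgD; last first.
  have cr := @continuous_fst_comp rho x t (crho x).
  apply: cvgM; first exact: (cvgM cr cr).
  apply: (@continuous_snd_comp (fun s => - b / (s + eta))).
  apply: cvgMl_tmp; apply: cvgV; first by rewrite gt_eqF.
  exact: cadd.
apply: (@continuous_snd_comp (fun t => K * t - th * (ln (t + eta) - ln eta))).
apply: cvgB; first by apply: cvgMl_tmp; exact: cvg_id.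
apply: cvgMl_tmp; apply: cvgB; last exact: cvg_cst.
apply: (@cvg_comp _ _ _ (fun s => s + eta) (@ln R)); first exact: cadd.
exact: continuous_ln.
Qed.

Lemma point_barrier_continuous x t : 0 < enorm_sq x + 2 * t ->
  {for (x, t), continuous (uncurry_fun (fun x t => - ln (enorm_sq x + 2 * t)))}.
Proof.
move=> y0; apply: cvgN.
apply: (@cvg_comp _ _ _ (fun p : 'rV[R]_n * R => enorm_sq p.1 + 2 * p.2) (@ln R)).
  apply: cvgD; first exact: continuous_fst_comp (@enorm_sq_continuous _ _ _).
  apply: (@continuous_snd_comp (fun s => 2 * s)).
  by apply: cvgMl_tmp; exact: cvg_id.
exact: continuous_ln.
Qed.

End CornerFunction.

(** * Nonnegativity of the truncated solutions *)

Section Positivity.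
Variables (R : realType) (n : nat).
Implicit Types (u z : 'rV[R]_n -> R -> R) (x : 'rV[R]_n) (t : R) (Om : set 'rV[R]_n).

Lemma smooth_continuous (rho : 'rV[R]_n -> R) : smooth rho -> continuous rho.
Proof. by move=> /(_ [::])[]. Qed.

Lemma smooth_partial_continuous (rho : 'rV[R]_n -> R) i : smooth rho -> continuous (partial i rho).
Proof. by move=> /(_ [:: i])[]. Qed.

Lemma grad_sq_continuous (rho : 'rV[R]_n -> R) : smooth rho -> continuous (grad_sq rho).
Proof.
move=> srho x; apply: (@cvg_sumr _ _ _ (nbhs x) _ _ (fun i x => partial i rho x ^+ 2)) => i.
by apply: (@cvg_comp _ _ _ (partial i rho) (fun y => y ^+ 2));
  [exact: smooth_partial_continuous|exact: exprn_continuous].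
Qed.

Lemma lap_continuous (rho : 'rV[R]_n -> R) : smooth rho ->
  continuous (fun x => \sum_i partial i (partial i rho) x).
Proof.
move=> srho x; apply: (@cvg_sumr _ _ _ (nbhs x) _ _ (fun i x => partial i (partial i rho) x)) => i.
by have [c _] := srho [:: i; i]; exact: c.
Qed.

Lemma closure_boundary (rho : 'rV[R]_n -> R) x : continuous rho ->
  closure [set x | rho x < 0] x -> ~ rho x < 0 -> rho x = 0.
Proof.
move=> crho cx /negP; rewrite -leNgt => r0; apply/eqP; rewrite eq_le r0 andbT leNgt.
apply/negP => r1.
have h : nbhs x [set y | 0 < rho y] by apply: (cvgr_gt _ (crho x)).
by have [y [/= h1 h2]] := cx _ h; have := lt_trans h1 h2; rewrite ltxx.
Qed.

Lemma ge0_of_eps (a c : R) : (forall e, 0 < e -> 0 <= a + e * c) -> 0 <= a.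
Proof.
move=> h; rewrite leNgt; apply/negP => a0.
have c0 : 0 < `|c| + 1 by rewrite ltr_wpDl.
pose e := - a / (2 * (`|c| + 1)).
have e0 : 0 < e by rewrite divr_gt0 ?oppr_gt0 ?mulr_gt0.
have ew : e * (`|c| + 1) = - a / 2 by rewrite /e; field; rewrite gt_eqF.
have : e * c <= e * (`|c| + 1).
  by rewrite ler_pM2l// (le_trans (ler_norm _))// lerDl.
by have := h _ e0; lra.
Qed.

Lemma within_sub (T : Type) (F : set_system T) {FF : Filter F} (A B P Q : set T) :
  B `<=` A -> within A F P -> (forall w, B w -> P w -> Q w) -> within B F Q.
Proof.
move=> BA h PQ; apply: (@filterS _ F _ [set w | A w -> P w]) h => w h Bw.
exact/PQ/h/BA.
Qed.

(** The minimum principle cannot be applied to [u] itself, whose lower limits at the corner and at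
    (0, 0) are only known to be finite. Barriers raise them above 0, and are removed afterwards at
    the fixed point (x1, t1) by letting [eta] and [eps] tend to 0. *)
Lemma approx_ge0 Om p k (u0 : 'rV[R]_n -> R) u : (3 <= n)%N -> smooth_bounded_domain Om ->
  (forall x, Om x -> x != 0 -> 0 <= u0 x) -> approx_solution Om p k u0 u ->
  forall x t, Om x -> 0 < t -> 0 <= u x t.
Proof.
move=> n3 [oO [_ [[C0 OC0] [rho [srho [Orho rho_reg]]]]]] u0ge asol x1 t1 Ox1 t10.
have [su hu] := approx_supersolution oO asol.
have [_ [_ [_ [_ [_ [_ [lat [ini bd]]]]]]]] := asol.
have crho := smooth_continuous srho.
have cO : compact (closure Om).
  by apply: (@compact_closure _ _ _ C0) => x /OC0; apply: le_trans; exact: norm_le_enorm.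
have gsq0 x : 0 <= grad_sq rho x by apply: sumr_ge0 => i _; exact: sqr_ge0.
have [|b [th [K [b0 th0 K0 hbK]]]] := corner_constants cO crho
  (grad_sq_continuous srho) (lap_continuous srho) gsq0.
  move=> x _ r0; rewrite lt0r gsq0 andbT; have [i ri] := rho_reg _ r0.
  apply: contra_neq ri => /eqP; rewrite psumr_eq0; last by move=> j _; exact: sqr_ge0.
  by move=> /allP/(_ i (mem_index_enum _)); rewrite sqrf_eq0 => /eqP.
pose T := t1 + 1.
have T0 : 0 < T by rewrite addr_gt0.
have [C1 hC1] := bd _ T0.
pose C := `|C1| + 1.
have CC : 0 < C by rewrite ltr_wpDl.
have hC x t : Om x -> 0 < t -> t < T -> - C <= u x t.
  move=> Ox t0 tT; have := hC1 _ _ Ox t0 tT; rewrite ler_norml => /andP[+ _].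
  by have := ler_norm C1; rewrite /C; lra.
(* Near a corner point [W] exceeds 1/2, so [A * W] outweighs the lower bound -C of [u]. *)
pose A := 2 * C.
pose W eta x t := expR (corner_exponent b th K eta rho x t).
pose Y : R := C0 ^+ 2 + 2 * T + 1.
have Y1 : 1 <= Y by rewrite lerDr addr_ge0 ?sqr_ge0// mulr_ge0// ltW.
have qY x t : Om x -> 0 < t <= T -> 0 < enorm_sq x + 2 * t <= Y.
  move=> Ox /andP[t0 tT]; rewrite ltr_wpDl ?enorm_sq_ge0 ?mulr_gt0//=.
  have : enorm_sq x <= C0 ^+ 2.
    have := OC0 _ Ox; rewrite enormE => h.
    have c0 : 0 <= C0 by apply: le_trans h; exact: sqrtr_ge0.
    by rewrite -[enorm_sq x]sqr_sqrtr ?enorm_sq_ge0// ler_sqr ?nnegrE ?sqrtr_ge0.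
  by rewrite /Y; lra.
have P_ge0 x t : Om x -> 0 < t <= T -> 0 <= ln Y - ln (enorm_sq x + 2 * t).
  by move=> Ox tT; have /andP[h1 h2] := qY _ _ Ox tT; rewrite subr_ge0 ler_ln ?posrE// (lt_le_trans h1).
(* Three nonnegative corrections: [W] for the corner, the logarithm (normalised by its bound [ln Y])
   for the origin, and [eps * t], which makes the supersolution strict. *)
pose z eta eps x t := ((u x t + A * W eta x t) + eps * (- ln (enorm_sq x + 2 * t)))
  + (eps * ln Y + eps * t).
have W_ge0 eta x t : 0 <= W eta x t by exact: expR_ge0.
have A0 : 0 < A by rewrite mulr_gt0.
have zE eta eps x t : z eta eps x t = u x t + A * W eta x t
   + eps * (ln Y - ln (enorm_sq x + 2 * t)) + eps * t by rewrite /z; ring.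
have z_ge eta eps x t : 0 < eps -> Om x -> 0 < t <= T -> u x t <= z eta eps x t.
  move=> e0 Ox tT; rewrite zE.
  have h1 := mulr_ge0 (ltW A0) (W_ge0 eta x t).
  have h2 := mulr_ge0 (ltW e0) (P_ge0 _ _ Ox tT).
  have h3 : 0 <= eps * t by case/andP: tT => t0 _; rewrite mulr_ge0// ltW.
  lra.
have main eta eps : 0 < eta -> 0 < eps -> 0 <= z eta eps x1 t1.
  move=> eta0 eps0.
  have t11 : 0 < t1 <= t1 by rewrite t10 lexx.
  apply: (@min_principle _ _ Om 0 t1 (z eta eps) oO cO _ _ _ x1 t1 Ox1 t11).
  - move=> x t Ox /andP[t0 tT].
    have tT' : 0 < t <= T by rewrite t0 (le_trans tT)// lerDl.
    apply: cvgD; first (apply: cvgD; first apply: cvgD).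
    + exact: su.
    + apply: cvgMl_tmp; apply: corner_exponent_continuous => //.
      by rewrite addr_gt0.
    + apply: cvgMl_tmp; apply: point_barrier_continuous.
      by have /andP[] := qY _ _ Ox tT'.
    + apply: (@continuous_snd_comp _ _ (fun t => eps * ln Y + eps * t)).
      by apply: cvgD; [exact: cvg_cst|apply: cvgMl_tmp; exact: cvg_id].
  - move=> x t Ox /andP[t0 tT] _.
    have [H1 H10 h1] := hu _ _ Ox t0.
    have [|H2 H20 h2] := @corner_barrier _ _ b th K eta rho x t srho eta0 t0.
      by apply: hbK; [exact: subset_closure|rewrite addr_gt0].
    have [H3 H30 h3] := point_barrier x n3 t0.
    have h4 : heat_val (fun (_ : 'rV[R]_n) t => eps * ln Y + eps * t) x t (eps - \sum_(i < n) 0).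
      apply: heat_jet_val (fun=> 0) _ _; apply: heat_jet_time.
      by apply: is_derive_eq; rewrite /GRing.scale/=; ring.
    exists (H1 + A * H2 + eps * H3 + (eps - \sum_(i < n) 0)).
      rewrite big1// subr0 ltr_wpDl// !addr_ge0// mulr_ge0// ltW//.
    exact: heat_valD (heat_valD (heat_valD h1 (heat_valZ A h2)) (heat_valZ eps h3)) h4.
  - move=> x t cx /andP[t0 tT] ntx e e0.
    have sub : [set p : 'rV[R]_n * R | Om p.1 /\ 0 < p.2 <= t1] `<=` [set p | Om p.1 /\ 0 < p.2].
      by move=> w [Ow /andP[w0 _]]; split.
    have pT s : 0 < s <= t1 -> 0 < s <= T.
      by move=> /andP[-> h]; rewrite (le_trans h)// lerDl.
    have [t_gt0|t_le0] := ltP 0 t.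
      have bx : bdry Om x by split => // Ox; apply: ntx.
      have [_ /cvgrPdist_lt /(_ _ e0) h] := lat _ _ bx t_gt0.
      apply: (within_sub _ h) => [w [Ow /andP[w0 _]]|w [Ow w0t] hw].
        by split => //; exact: subset_closure.
      apply: lt_le_trans (z_ge _ _ _ _ eps0 Ow (pT _ w0t)).
      by move: hw; rewrite sub0r normrN ltr_norml => /andP[].
    have {t_le0}t_0 : t = 0 by apply/eqP; rewrite eq_le t0 t_le0.
    subst t.
    have [Ox|nOx] := pselect (Om x); last first.
      have rx : rho x = 0 by apply: closure_boundary => //; [rewrite -Orho|move: nOx; rewrite Orho].
      have eta0' : 0 < 0 + eta by rewrite add0r.
      have cW := @corner_exponent_continuous _ _ b th K eta rho x 0 crho eta0'.
      have h : nbhs (x, 0) [set w | 2^-1 < uncurry_fun (W eta) w].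
        apply: (cvgr_gt _ cW).
        rewrite /uncurry_fun /corner_exponent/= rx !(mul0r, mulr0, add0r, addr0) subrr mulr0 oppr0 expR0.
        by lra.
      apply: filterS h => w hw [Ow w0t]; have /andP[w0 wt] := w0t.
      have h1 := hC _ _ Ow w0 (le_lt_trans wt (ltr_pwDr ltr01 (lexx t1))).
      have h2 := mulr_ge0 (ltW eps0) (P_ge0 _ _ Ow (pT _ w0t)).
      have h3 := mulr_ge0 (ltW eps0) (ltW w0).
      move: hw; rewrite /= /uncurry_fun zE /A => hw.
      by nra.
    have [x0|x0] := eqVneq x 0; last first.
      have h := ini _ Ox x0.
      have {}h : within [set z : 'rV[R]_n * R | Om z.1 /\ 0 < z.2] (nbhs (x, 0))
          [set w | - e < uncurry_fun u w].
        apply: (cvgr_gt _ h); rewrite (lt_le_trans (y := 0)) ?oppr_lt0//.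
        by rewrite le_min u0ge//=.
      apply: (within_sub _ h) => // w [Ow w0t] hw.
      exact: lt_le_trans hw (z_ge _ _ _ _ eps0 Ow (pT _ w0t)).
    (* Where |x|^2 + 2t < r the logarithmic term alone is at least C. *)
    pose r := expR (ln Y - C / eps).
    have h : nbhs (x, 0) [set w : 'rV[R]_n * R | enorm_sq w.1 + 2 * w.2 < r].
      have c1 : {for (x, 0), continuous (fun w : 'rV[R]_n * R => enorm_sq w.1 + 2 * w.2)}.
        apply: cvgD; first exact: continuous_fst_comp (@enorm_sq_continuous _ _ _).
        apply: (@continuous_snd_comp _ _ (fun s => 2 * s)).
        by apply: cvgMl_tmp; exact: cvg_id.
      apply: (cvgr_lt _ c1); rewrite x0 /enorm_sq big1 ?mulr0 ?addr0 ?expR_gt0//.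
      by move=> i _; rewrite mxE expr0n.
    apply: filterS h => w /= hw [Ow w0t]; have /andP[w0 wt] := w0t.
    have h1 := hC _ _ Ow w0 (le_lt_trans wt (ltr_pwDr ltr01 (lexx t1))).
    have /andP[h2 _] := qY _ _ Ow (pT _ w0t).
    have h3 : ln (enorm_sq w.1 + 2 * w.2) < ln Y - C / eps.
      by rewrite -[ltRHS]expRK ltr_ln ?posrE// expR_gt0.
    have h4 := mulr_ge0 (ltW A0) (W_ge0 eta w.1 w.2).
    have h5 := mulr_ge0 (ltW eps0) (ltW w0).
    have h6 : C <= eps * (ln Y - ln (enorm_sq w.1 + 2 * w.2)).
      by rewrite -ler_pdivrMl// mulrC; lra.
    by rewrite /uncurry_fun zE; lra.
apply: (@ge0_of_eps _ A) => d d0.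
(* [W] at (x1, t1) is at most exp(K t1 - th ln t1 + th ln eta); this [eta] makes the bound equal to
   [d]. *)
pose eta := expR (- ((K * t1 - th * ln t1 - ln d) / th)).
have eta0 : 0 < eta by exact: expR_gt0.
have Wd : W eta x1 t1 <= d.
  rewrite -[leRHS]lnK ?posrE// ler_expR /corner_exponent.
  have : rho x1 * rho x1 * (- b / (t1 + eta)) <= 0.
    rewrite mulr_ge0_le0// -?expr2 ?sqr_ge0// mulNr oppr_le0 divr_ge0 ?(ltW b0)//.
    by rewrite addr_ge0 ?ltW.
  have : th * ln t1 <= th * ln (t1 + eta).
    by rewrite ler_pM2l// ler_ln ?posrE ?addr_gt0// lerDl ltW.
  have -> : ln eta = - ((K * t1 - th * ln t1 - ln d) / th) by rewrite /eta expRK.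
  have : th * ((K * t1 - th * ln t1 - ln d) / th) = K * t1 - th * ln t1 - ln d.
    by field; rewrite gt_eqF.
  by lra.
apply: (@ge0_of_eps _ (ln Y - ln (enorm_sq x1 + 2 * t1) + t1)) => eps eps0.
have := main _ _ eta0 eps0; rewrite zE.
have : A * W eta x1 t1 <= A * d by rewrite ler_pM2l.
by lra.
Qed.

End Positivity.

(** * Expansion of positivity *)

Section Expansion.
Variables (R : realType) (n : nat).
Implicit Types (u z : 'rV[R]_n -> R -> R) (x : 'rV[R]_n) (t : R) (Om : set 'rV[R]_n).

Lemma heat_jet_shift z (x0 : 'rV[R]_n) x t B G A : heat_jet z (x - x0) t B G A ->
  heat_jet (fun x t => z (x - x0) t) x t B G A.
Proof.
move=> [dB h]; split => // i.
rewrite (_ : line _ x t i = line z (x - x0) t i)//.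
by apply/funext => s; rewrite /line addrAC.
Qed.

(** The heat operator sees only the germ, which allows a truncated bump to be replaced by its smooth
    formula wherever it is positive. *)
Lemma heat_val_near z1 z2 x t H :
  (\forall p \near (x, t), uncurry_fun z1 p = uncurry_fun z2 p) ->
  heat_val z1 x t H -> heat_val z2 x t H.
Proof.
move=> z12 [B [A [b a ->]]]; exists B, A.
have FF : Filter (0^'+ : set_system R) by exact: filter_filter.
have E : z1 x t = z2 x t := nbhs_singleton z12.
split => //.
  apply: cvg_trans b; apply: near_eq_cvg.
  have h : (fun s : R => (x, t - s)) s @[s --> 0^'+] --> (x, t).
    apply: (@cvg_pair_point _ _ _ _ FF (fun=> x) (fun s => t - s)); first exact: cvg_cst.
    apply: cvg_at_right_filter.
    have c0 : t - s @[s --> 0] --> t - 0.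
      by apply: cvgB; [exact: cvg_cst|exact: cvg_id].
    by rewrite subr0 in c0.
  have h12 : \forall s \near 0^'+, z1 x (t - s) = z2 x (t - s) := h _ z12.
  by near=> s; congr (_ * (_ - _)) => //; near: s.
move=> i; apply: cvg_trans (a i); apply: near_eq_cvg.
have h c : (fun s : R => (x + (c * s) *: ebasis R i, t)) s @[s --> 0^'+] --> (x, t).
  apply: (@cvg_pair_point _ _ _ _ FF (fun s => x + (c * s) *: ebasis R i) (fun=> t)); last exact: cvg_cst.
  apply: cvg_at_right_filter.
  have c0 : x + (c * s) *: ebasis R i @[s --> 0] --> x + (c * 0) *: ebasis R i.
    apply: cvgD; first exact: cvg_cst.
    apply: (@cvg_comp _ _ _ (fun s => c * s) (fun s => s *: ebasis R i)); last exact: scalel_continuous.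
    by apply: cvgMl_tmp; exact: cvg_id.
  by rewrite mulr0 scale0r addr0 in c0.
have h1 : \forall s \near 0^'+, z1 (x + (1 * s) *: ebasis R i) t = z2 (x + (1 * s) *: ebasis R i) t := h 1 _ z12.
have h2 : \forall s \near 0^'+, z1 (x + (-1 * s) *: ebasis R i) t = z2 (x + (-1 * s) *: ebasis R i) t := h (-1) _ z12.
near=> s; rewrite E -scaleNr -mulN1r; congr (_ * (_ + _ - _)); last by near: s.
by rewrite -[s]mul1r; near: s.
Unshelve. all: by end_near. Qed.

Lemma enorm_sqB_continuous (x0 : 'rV[R]_n) : continuous (fun x => enorm_sq (x - x0)).
Proof.
move=> x; apply: (@cvg_comp _ _ _ (fun x => x - x0) (@enorm_sq R n) _ (nbhs (x - x0))); last exact: enorm_sq_continuous.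
exact: (@cvgB _ _ _ (nbhs x) (nbhs_filter x) id (fun=> x0) x x0 cvg_id (cvg_cst _)).
Qed.

Lemma open_eball (x0 : 'rV[R]_n) (P : R) : open [set x | enorm_sq (x - x0) < P].
Proof.
apply: (@open_comp _ _ (fun x => enorm_sq (x - x0)) [set y | y < P]); last exact: open_lt.
by move=> x _; exact: enorm_sqB_continuous.
Qed.

Lemma closure_eball (x0 : 'rV[R]_n) (P : R) :
  closure [set x | enorm_sq (x - x0) < P] `<=` [set x | enorm_sq (x - x0) <= P].
Proof.
rewrite [X in _ `<=` X](_ : _ = closure [set x | enorm_sq (x - x0) <= P]).
  by apply: closure_subset => x /ltW.
apply/closure_id; apply: (@closed_comp _ _ (fun x => enorm_sq (x - x0)) [set y | y <= P]); last exact: closed_le.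
by move=> x _; exact: enorm_sqB_continuous.
Qed.

Lemma compact_eball (x0 : 'rV[R]_n) (P : R) : compact (closure [set x | enorm_sq (x - x0) < P]).
Proof.
apply: (@compact_closure _ _ _ (Num.sqrt P + `|x0|)) => x /= xP.
rewrite -[x](subrK x0) (le_trans (ler_normD _ _))// lerD2r.
by rewrite (le_trans (norm_le_enorm _))// enormE ler_wsqrtr// ltW.
Qed.

(* The subsolution is the bump
   exp(-gam (tau - s)) * max(Q + a (tau - s) - |x - x0|^2, 0)^2, whose support
   is a ball growing from radius sqrt Q to radius sqrt P. *)
Lemma expansion (Q P d1 d2 : R) : 0 < Q -> Q < P -> 0 < d1 -> exists2 c, 0 < c &
  forall Om u (x0 : 'rV[R]_n) s t m, supersolution Om u ->
    (forall x t, Om x -> 0 < t -> 0 <= u x t) ->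
    (forall x, enorm_sq (x - x0) <= P -> Om x) ->
    0 < s -> d1 <= t - s <= d2 -> 0 <= m ->
    (forall x, enorm_sq (x - x0) < Q -> m <= u x s) ->
    forall x, enorm_sq (x - x0) <= P / 4 -> c * m <= u x t.
Proof.
move=> Q0 QP d10.
(* For the bump th G^2 the heat operator is th times -gam G^2 + (2a + 4n) G - 8 |x - x0|^2. Since |x
   - x0|^2 = Q + a (tau - s) - G, it is negative once gam G^2 - kap G + 8Q > 0, where [kap] bounds
   2a + 4n + 8. [gam] makes the discriminant kap^2 - 32 gam Q equal to -1. *)
pose kap : R := 2 * ((P - Q) / d1) + 4 * n%:R + 8.
pose gam := (kap ^+ 2 + 1) / (32 * Q).
have gam0 : 0 < gam by rewrite divr_gt0 ?mulr_gt0// ltr_wpDl ?sqr_ge0.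
have P0 : 0 < P by exact: lt_trans QP.
(* The normalised bump at time t on |x - x0|^2 <= P/4: there G >= 3P/4 and at most d2 has elapsed,
   while division by Q^2 keeps the bump below [m] at time s. *)
exists (expR (- gam * d2) * (3 / 4 * P) ^+ 2 / Q ^+ 2).
  by rewrite !mulr_gt0 ?expR_gt0 ?invr_gt0 ?exprn_gt0 ?mulr_gt0.
move=> Om u x0 s t m [cu hu] u0 PO s0 /andP[ts1 ts2] m0 um x xP4.
have [->|mn0] := eqVneq m 0.
  rewrite mulr0 u0//; last lra.
  by apply: PO; rewrite (le_trans xP4)// ler_pdivrMr// ler_pMr// ler1n.
have {mn0}m0 : 0 < m by rewrite lt0r mn0.
have ts0 : 0 < t - s by lra.
pose a := (P - Q) / (t - s).
have a0 : 0 < a by rewrite divr_gt0// subr_gt0.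
pose G x tau := Q + a * (tau - s) - enorm_sq (x - x0).
pose th tau := expR (- gam * (tau - s)).
pose z x tau := u x tau - m / Q ^+ 2 * (th tau * (Num.max (G x tau) 0 ^+ 2)).
have cG x' tau : {for (x', tau), continuous (uncurry_fun G)}.
  apply: cvgB; last exact: (@continuous_fst_comp _ _ (fun x => enorm_sq (x - x0))) (@enorm_sqB_continuous x0 _).
  apply: (@continuous_snd_comp _ _ (fun tau => Q + a * (tau - s))).
  apply: cvgD; first exact: cvg_cst.
  by apply: cvgMl_tmp; apply: cvgB; [exact: cvg_id|exact: cvg_cst].
have cz x' tau : Om x' -> 0 < tau -> {for (x', tau), continuous (uncurry_fun z)}.
  move=> Ox tau0; apply: cvgB; first exact: cu.
  apply: cvgMl_tmp; apply: cvgM.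
    apply: (@continuous_snd_comp _ _ th).
    apply: (@cvg_comp _ _ _ (fun tau => - gam * (tau - s)) (@expR R)); last exact: continuous_expR.
    by apply: cvgMl_tmp; apply: cvgB; [exact: cvg_id|exact: cvg_cst].
  apply: (@cvg_comp _ _ _ (fun p => Num.max (uncurry_fun G p) 0) (fun y => y ^+ 2));
    last exact: exprn_continuous.
  exact: (@continuous_max R _ (uncurry_fun G) (fun=> 0) _ (cG x' tau) (cvg_cst _)).
have sub x' : closure [set x | enorm_sq (x - x0) < P] x' -> Om x'.
  by move=> /closure_eball; exact: PO.
have key : 0 <= z x t.
  have xD : [set x | enorm_sq (x - x0) < P] x by rewrite /= (le_lt_trans xP4)// ltr_pdivrMr// ltr_pMr// ltr1n.
  have tst : s < t <= t by rewrite lexx andbT -subr_gt0.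
  apply: (@min_principle _ _ [set x | enorm_sq (x - x0) < P] s t z (@open_eball x0 P)
    (@compact_eball x0 P) _ _ _ x t xD tst).
  - move=> y tau Dy /andP[stau _]; apply: cz; last exact: lt_trans stau.
    exact/sub/subset_closure.
  - move=> y tau Dy /andP[stau taut] zneg.
    have Oy : Om y by exact/sub/subset_closure.
    have tau0 : 0 < tau by exact: lt_trans stau.
    (* As [u] is nonnegative, [z < 0] forces the bump to be positive, so the maximum is inactive
       there. *)
    have Gpos : 0 < G y tau.
      rewrite ltNge; apply/negP => Gle0; move: zneg.
      by rewrite /z max_r// expr0n/= !mulr0 subr0 ltNge u0.
    have [H1 H10 h1] := hu _ _ Oy tau0.
    have J1 : heat_jet (fun _ tau => Q + a * (tau - s)) y tau a (fun=> 0) (fun=> 0).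
      by apply: heat_jet_time; apply: is_derive_eq; rewrite /GRing.scale/=; ring.
    have J2 : heat_jet (fun _ _ => -1) y tau 0 (fun=> 0) (fun=> 0).
      by apply: heat_jet_time; exact: is_derive_cst.
    have J3 := heat_jetD J1 (heat_jetM J2 (heat_jet_shift (heat_jet_enorm_sq (y - x0) tau))).
    have J4 : heat_jet (fun _ tau => th tau) y tau (- gam * th tau) (fun=> 0) (fun=> 0).
      apply: heat_jet_time.
      have d1' : is_derive tau (1 : R) (fun tau => - gam * (tau - s)) (- gam).
        by apply: is_derive_eq; rewrite /GRing.scale/=; ring.
      have := @is_derive1_comp R (@expR R) _ tau _ _ (is_derive_expR _) d1'.
      by rewrite mulrC.
    have h2 := heat_valZ (- (m / Q ^+ 2)) (heat_jet_val (heat_jetM J4 (heat_jetM J3 J3))).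
    have h3 := heat_valD h1 h2.
    eexists; last first.
      apply: heat_val_near h3.
      have h : nbhs (y, tau) [set p | 0 < uncurry_fun G p] by apply: (cvgr_gt _ (cG y tau)).
      apply: filterS h => p; rewrite /uncurry_fun /z /= => Gp.
      by rewrite max_l ?ltW// /G; ring.
    rewrite ltr_wpDl// mulNr oppr_gt0 pmulr_rlt0 ?divr_gt0 ?exprn_gt0//.
    set Gv := (_ + -1 * enorm_sq (y - x0)); have EG : Gv = G y tau by rewrite /Gv /G; ring.
    rewrite EG.
    have th0 : 0 < th tau by exact: expR_gt0.
    rewrite [X in _ - X](_ : _ = th tau * (8 * enorm_sq (y - x0) - 4 * n%:R * G y tau)); last first.
      rewrite (eq_bigr (fun i => th tau * (8 * (y - x0) ord0 i ^+ 2) - th tau * (4 * G y tau))).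
        by rewrite sumrB -!mulr_sumr sumr_const card_ord -mulr_natl /enorm_sq; ring.
      by move=> i _; rewrite ?EG /G; ring.
    rewrite (_ : _ - _ = th tau * (- gam * G y tau ^+ 2 + (2 * a + 4 * n%:R) * G y tau - 8 * enorm_sq (y - x0))); last by ring.
    rewrite pmulr_rlt0//.
    have -> : enorm_sq (y - x0) = Q + a * (tau - s) - G y tau by rewrite /G; ring.
    have ak : 2 * a + 4 * n%:R + 8 <= kap.
      rewrite /kap !lerD2r ler_pM2l// /a ler_pM2l ?subr_gt0//.
      by rewrite lef_pV2 ?posrE.
    have : gam * (32 * Q) = kap ^+ 2 + 1 by rewrite /gam; field; rewrite gt_eqF.
    have : (2 * a + 4 * n%:R + 8) * G y tau <= kap * G y tau by rewrite ler_pM2r.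
    have : 0 <= a * (tau - s) by rewrite mulr_ge0// ?ltW// subr_gt0.
    set g := G y tau in Gpos *; set k := kap.
    move=> e1 e2 e3.
    have e4 : 0 < gam * g ^+ 2 - k * g + 8 * Q.
      have : 0 < 32 * Q * (gam * g ^+ 2 - k * g + 8 * Q).
        have -> : 32 * Q * (gam * g ^+ 2 - k * g + 8 * Q) =
          (gam * (32 * Q)) * g ^+ 2 - 32 * Q * k * g + 256 * Q ^+ 2 by ring.
        rewrite e3.
        have : 0 < g ^+ 2 by rewrite exprn_gt0.
        have := sqr_ge0 (k * g - 16 * Q).
        nra.
      by rewrite pmulr_rgt0// mulr_gt0.
    lra.
  - move=> y tau cy /andP[stau taut] nD e e0.
    have Oy := sub _ cy.
    have tau0 : 0 < tau by exact: lt_le_trans stau.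
    suff : 0 <= z y tau.
      move=> zy; have h : nbhs (y, tau) [set p | - e < uncurry_fun z p].
        by apply: (cvgr_gt _ (cz _ _ Oy tau0)); rewrite (lt_le_trans _ zy)// oppr_lt0.
      by apply: filterS h => p hp _.
    have [Gy|Gy] := leP (G y tau) 0.
      by rewrite /z max_r// expr0n/= !mulr0 subr0 u0.
    (* On the lateral boundary |x - x0|^2 = P the bump vanishes, because Q + a (t - s) = P; so a
       boundary point with G > 0 lies at the initial time. *)
    have {stau} stau : tau = s.
      apply/eqP; rewrite eq_le stau andbT leNgt; apply/negP => h; apply: nD; split => //=.
      move: Gy; rewrite /G subr_gt0 => /lt_le_trans; apply.
      rewrite -lerBrDl (_ : P - Q = a * (t - s)); last by rewrite /a; field; rewrite gt_eqF.
      by rewrite ler_pM2l// lerD2r.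
    rewrite /z stau /th subrr mulr0 expR0 mul1r subr_ge0 max_l; last by rewrite -stau ltW.
    move: Gy; rewrite /G stau subrr mulr0 addr0 subr_gt0 => Gy.
    apply: le_trans (um _ Gy); rewrite -mulrA ler_piMr ?(ltW m0)//.
    rewrite mulrC ler_pdivrMr ?exprn_gt0// mul1r.
    have qy0 := enorm_sq_ge0 (y - x0).
    by apply: lerXn2r; rewrite ?nnegrE; lra.
move: key; rewrite /z subr_ge0; apply: le_trans.
have GP : 3 / 4 * P <= G x t.
  have -> : G x t = P - enorm_sq (x - x0) by rewrite /G /a; field; rewrite gt_eqF.
  by lra.
rewrite max_l; last by rewrite (le_trans _ GP)// mulr_ge0// ltW.
have -> : expR (- gam * d2) * (3 / 4 * P) ^+ 2 / Q ^+ 2 * m =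
   m / Q ^+ 2 * (expR (- gam * d2) * (3 / 4 * P) ^+ 2) by field; rewrite gt_eqF.
rewrite ler_pM2l ?divr_gt0 ?exprn_gt0//.
apply: ler_pM; rewrite ?expR_ge0 ?sqr_ge0//.
  by rewrite ler_expR !mulNr lerN2 ler_pM2l.
by rewrite ler_sqr ?nnegrE// ?mulr_ge0 ?(ltW P0)// (le_trans _ GP)// mulr_ge0// ltW.
Unshelve. all: by end_near. Qed.

End Expansion.

(** * Lower bounds near the origin at time 0 *)

Section InitialOrigin.
Variables (R : realType) (n : nat).
Implicit Types (u z : 'rV[R]_n -> R -> R) (x : 'rV[R]_n) (t : R) (Om : set 'rV[R]_n).

Lemma enorm_sq0 : enorm_sq (0 : 'rV[R]_n) = 0.
Proof. by rewrite /enorm_sq big1// => i _; rewrite mxE expr0n. Qed.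

(* The point (0, 0) is removable for lower bounds on the initial trace, since
   -ln(|x|^2 + 2t) is a supersolution which is infinite there. *)
Lemma initial_origin Om u (P m : R) : (3 <= n)%N -> supersolution Om u ->
  (forall x t, Om x -> 0 < t -> 0 <= u x t) -> 0 < P ->
  (forall x, enorm_sq x <= P -> Om x) -> 0 <= m ->
  (forall x (e : R), enorm_sq x <= P -> x != 0 -> 0 < e ->
    \forall p \near within [set p | Om p.1 /\ 0 < p.2] (nbhs (x, (0 : R))),
      m - e < uncurry_fun u p) ->
  forall e : R, 0 < e ->
    \forall p \near within [set p | Om p.1 /\ 0 < p.2] (nbhs ((0 : 'rV[R]_n), (0 : R))),
      m - e < uncurry_fun u p.
Proof.
move=> n3 [cu hu] u0 P0 PO m0 ini.
pose A := m / P.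
have A0 : 0 <= A by rewrite divr_ge0// ltW.
have AP : A * P = m by rewrite /A; field; rewrite gt_eqF.
pose L := ln (P + 3).
(* [f] solves the heat equation, is at least -m, equals -m at (0, 0), and is nonnegative on |x|^2 =
   P, where nothing but [u >= 0] is known. So [u + f] can be shown nonnegative, which is the claim
   near (0, 0). *)
pose f x t := - m + A * enorm_sq x + 2 * n%:R * A * t.
pose z eps x t := ((u x t + f x t) + eps * (- ln (enorm_sq x + 2 * t))) + (eps * L + eps * t).
have D0 x : (enorm_sq (x - 0) < P) = (enorm_sq x < P) by rewrite subr0.
have subD x : closure [set x | enorm_sq (x - 0) < P] x -> enorm_sq x <= P.
  by move=> /closure_eball/=; rewrite subr0.
have cf x t : {for (x, t), continuous (uncurry_fun f)}.
  apply: cvgD; first apply: cvgD.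
  - exact: cvg_cst.
  - by apply: cvgMl_tmp; exact: (@continuous_fst_comp _ _ (@enorm_sq R n)) (@enorm_sq_continuous _ _ _).
  - apply: (@continuous_snd_comp _ _ (fun t => 2 * n%:R * A * t)).
    by apply: cvgMl_tmp; exact: cvg_id.
have cq x t : {for (x, t), continuous (fun w : 'rV[R]_n * R => enorm_sq w.1 + 2 * w.2)}.
  apply: cvgD; first exact: continuous_fst_comp (@enorm_sq_continuous _ _ _).
  apply: (@continuous_snd_comp _ _ (fun s => 2 * s)).
  by apply: cvgMl_tmp; exact: cvg_id.
have qt x t : 0 < t -> 0 < enorm_sq x + 2 * t by move=> t0; rewrite ltr_wpDl ?enorm_sq_ge0 ?mulr_gt0.
have lnL x t : enorm_sq x < P -> 0 < t <= 1 -> 0 <= L - ln (enorm_sq x + 2 * t).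
  move=> xP /andP[t1 t2]; rewrite subr_ge0 ler_ln ?posrE ?qt//; last first.
    by rewrite addr_gt0.
  lra.
have z_ge eps x t : 0 < eps -> enorm_sq x < P -> 0 < t <= 1 -> u x t + f x t <= z eps x t.
  move=> e0 xP t01; have h2 := mulr_ge0 (ltW e0) (lnL _ _ xP t01).
  have h3 : 0 <= eps * t by case/andP: t01 => t00 _; rewrite mulr_ge0// ltW.
  rewrite /z; lra.
have nAt (t : R) : 0 <= t -> 0 <= 2 * n%:R * A * t.
  by move=> t0; apply: mulr_ge0 => //; apply: mulr_ge0 => //; apply: mulr_ge0.
have f_ge x t : 0 <= t -> - m <= f x t.
  move=> t0; have := mulr_ge0 A0 (enorm_sq_ge0 x).
  have := nAt _ t0.
  rewrite /f; lra.
have zpos eps x t : 0 < eps -> enorm_sq x < P -> 0 < t <= 1 -> 0 <= z eps x t.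
  move=> eps0 xP t01.
  have DD : [set x | enorm_sq (x - 0) < P] x by rewrite /= subr0.
  apply: (@min_principle _ _ [set x | enorm_sq (x - 0) < P] 0 1 (z eps) (@open_eball _ _ 0 P)
    (@compact_eball _ _ 0 P) _ _ _ x t DD t01) => {x t xP t01 DD}.
  - move=> x t; rewrite /= subr0 => xP /andP[t0 _].
    have Ox : Om x by apply: PO; exact: ltW.
    apply: cvgD; first (apply: cvgD; first apply: cvgD).
    + exact: cu.
    + exact: cf.
    + by apply: cvgMl_tmp; apply: point_barrier_continuous; exact: qt.
    + apply: (@continuous_snd_comp _ _ (fun t => eps * L + eps * t)).
      by apply: cvgD; [exact: cvg_cst|apply: cvgMl_tmp; exact: cvg_id].
  - move=> x t; rewrite /= subr0 => xP /andP[t0 _] _.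
    have Ox : Om x by apply: PO; exact: ltW.
    have [H1 H10 h1] := hu _ _ Ox t0.
    have [H3 H30 h3] := point_barrier x n3 t0.
    have J1 : heat_jet (fun (_ : 'rV[R]_n) (t : R) => - m + 2 * n%:R * A * t) x t (2 * n%:R * A) (fun=> 0) (fun=> 0).
      by apply: heat_jet_time; apply: is_derive_eq; rewrite /GRing.scale/=; ring.
    have J2 : heat_jet (fun (_ : 'rV[R]_n) (_ : R) => A) x t 0 (fun=> 0) (fun=> 0).
      by apply: heat_jet_time; exact: is_derive_cst.
    have h2 := heat_jet_val (heat_jetD J1 (heat_jetM J2 (heat_jet_enorm_sq x t))).
    have E : 2 * n%:R * A + (0 * enorm_sq x + A * 0)
        - \sum_(i < n) (0 + (0 * enorm_sq x + 2 * (0 * (2 * x ord0 i)) + A * 2)) = 0.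
      rewrite (eq_bigr (fun=> 2 * A)); last by move=> i _; ring.
      by rewrite sumr_const card_ord -mulr_natl; ring.
    rewrite E in h2.
    have h4 : heat_val (fun (_ : 'rV[R]_n) t => eps * L + eps * t) x t (eps - \sum_(i < n) 0).
      apply: heat_jet_val (fun=> 0) _ _; apply: heat_jet_time.
      by apply: is_derive_eq; rewrite /GRing.scale/=; ring.
    have h := heat_valD (heat_valD (heat_valD h1 h2) (heat_valZ eps h3)) h4.
    eexists; last first.
      have -> : z eps = fun y s => u y s + (- m + 2 * n%:R * A * s + A * enorm_sq y) +
          eps * - ln (enorm_sq y + 2 * s) + (eps * L + eps * s).
        by apply/funext => y; apply/funext => s; rewrite /z /f; ring.
      exact: h.
    have := mulr_ge0 (ltW eps0) H30.
    by rewrite big1// subr0; lra.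
  - move=> x t cx /andP[t0 t1] nD e e0.
    have xP := subD _ cx; have Ox := PO _ xP.
    have sub : [set p : 'rV[R]_n * R | [set x | enorm_sq (x - 0) < P] p.1 /\ 0 < p.2 <= 1] `<=`
        [set p | Om p.1 /\ 0 < p.2].
      move=> w /= [+ /andP[w0 _]]; rewrite subr0 => wP; split => //.
      by apply: PO; exact: ltW.
    have [t_gt0|t_le0] := ltP 0 t.
      have xP' : enorm_sq x = P.
        apply/eqP; rewrite eq_le xP leNgt; apply/negP => h; apply: nD.
        by rewrite /= subr0.
      have h : nbhs (x, t) [set w | - e < uncurry_fun f w].
        apply: (cvgr_gt _ (cf x t)); rewrite /uncurry_fun/= /f xP' AP.
        have := nAt _ (ltW t_gt0).
        by lra.
      apply: filterS h => w hw /= [+ w01]; rewrite subr0 => wP.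
      apply: lt_le_trans (z_ge _ _ _ eps0 wP w01).
      case/andP: w01 => w0 _.
      by have := u0 _ _ (PO _ (ltW wP)) w0; move: hw; rewrite /= /uncurry_fun; lra.
    have {t_le0} t_0 : t = 0 by apply/eqP; rewrite eq_le t0 t_le0.
    subst t.
    have [x0|x0] := eqVneq x 0; last first.
      apply: (within_sub sub (ini _ _ xP x0 e0)) => w /= [+ w01] hw; rewrite subr0 => wP.
      apply: lt_le_trans (z_ge _ _ _ eps0 wP w01).
      case/andP: w01 => w0 _.
      by have := f_ge w.1 _ (ltW w0); move: hw; rewrite /uncurry_fun; lra.
    pose r := expR (L - m / eps).
    have h : nbhs (x, (0 : R)) [set w : 'rV[R]_n * R | enorm_sq w.1 + 2 * w.2 < r].
      by apply: (cvgr_lt _ (cq x 0)); rewrite x0 /= enorm_sq0 mulr0 addr0 expR_gt0.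
    apply: filterS h => w /= hw [+ w01]; rewrite subr0 => wP.
    have /andP[w0 w1] := w01.
    have h3 : ln (enorm_sq w.1 + 2 * w.2) < L - m / eps.
      by rewrite -[ltRHS]expRK ltr_ln ?posrE ?expR_gt0// qt.
    have h5 := mulr_ge0 (ltW eps0) (ltW w0).
    have h6 : m <= eps * (L - ln (enorm_sq w.1 + 2 * w.2)).
      by rewrite -ler_pdivrMl// mulrC; lra.
    have h1 := u0 _ _ (PO _ (ltW wP)) w0.
    have := f_ge w.1 _ (ltW w0).
    by rewrite /uncurry_fun /z; lra.
have ulow x t : enorm_sq x < P -> 0 < t <= 1 -> 0 <= u x t + f x t.
  move=> xP t01; apply: (@ge0_of_eps _ _ (L - ln (enorm_sq x + 2 * t) + t)) => eps eps0.
  by have := zpos _ _ _ eps0 xP t01; rewrite /z; lra.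
move=> e e0.
have h1 : nbhs ((0 : 'rV[R]_n), (0 : R)) [set w | uncurry_fun f w < - m + e].
  by apply: (cvgr_lt _ (cf 0 0)); rewrite /uncurry_fun/= /f enorm_sq0; lra.
have h2 : nbhs ((0 : 'rV[R]_n), (0 : R)) [set w : 'rV[R]_n * R | enorm_sq w.1 + 2 * w.2 < Num.min P 1].
  by apply: (cvgr_lt _ (cq 0 0)); rewrite /= enorm_sq0 mulr0 addr0 lt_min P0 ltr01.
apply: filterS (filterI h1 h2) => w /= [hw]; rewrite lt_min => /andP[hw1 hw2] [Ow w0].
have wq := enorm_sq_ge0 w.1.
have wP : enorm_sq w.1 < P by lra.
have w01 : 0 < w.2 <= 1 by apply/andP; split => //; lra.
by have := ulow _ _ wP w01; move: hw; rewrite /uncurry_fun; lra.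
Qed.

End InitialOrigin.

(** * Blow-up of the finite-difference scheme *)

Section PowerInequalities.
Variable R : realType.

(** Young's inequality with exponents p and p/(p-1) is the tangent-line inequality for the convex
    function s^p / p. *)
Lemma powR_tangent (p a b : R) : 1 < p -> 0 <= a -> 0 <= b ->
  a `^ p / p + a `^ (p - 1) * (b - a) <= b `^ p / p.
Proof.
move=> p1 a0 b0.
have p0 : 0 < p by exact: lt_trans p1.
have p10 : 0 < p - 1 by rewrite subr_gt0.
have := @conjugate_powR R b (a `^ (p - 1)) p (p / (p - 1)) b0 (powR_ge0 _ _) p0.
rewrite divr_gt0// => /(_ isT).
have -> : p^-1 + (p / (p - 1))^-1 = 1 by field; rewrite !gt_eqF.
move=> /(_ erefl).
rewrite -powRrM (_ : (p - 1) * (p / (p - 1)) = p); last by field; rewrite gt_eqF.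
have := mulr_powRB1 a0 p0.
set ap := a `^ p; set ap1 := a `^ (p - 1) => e h.
have -> : ap1 * (b - a) = b * ap1 - ap by rewrite -e; ring.
have : ap / (p / (p - 1)) = ap - ap / p by field; rewrite !gt_eqF.
by lra.
Qed.

Lemma powR_lipschitz (p k a b : R) : 2 < p -> 0 <= a -> a <= b -> b <= k ->
  b `^ (p - 1) - a `^ (p - 1) <= (p - 1) * k `^ (p - 2) * (b - a).
Proof.
move=> p2 a0 ab bk.
have b0 : 0 <= b by exact: le_trans ab.
have p1 : 1 < p - 1 by lra.
have := powR_tangent p1 b0 a0.
have -> : p - 1 - 1 = p - 2 by ring.
have bk' : b `^ (p - 2) <= k `^ (p - 2).
  by apply: ge0_ler_powR => //; rewrite ?nnegrE; lra.
set A := a `^ _; set B := b `^ (p - 1); set b2 := b `^ _ => h.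
have : (p - 1) * (B / (p - 1) + b2 * (a - b)) <= (p - 1) * (A / (p - 1)).
  by rewrite ler_pM2l//; lra.
rewrite mulrDr [X in X + _]mulrC divfK ?gt_eqF//; last lra.
rewrite [X in _ <= X]mulrC divfK ?gt_eqF//; last lra.
have : (p - 1) * (b2 * (b - a)) <= (p - 1) * (k `^ (p - 2) * (b - a)).
  by rewrite ler_pM2l ?ler_wpM2r// ?subr_ge0//; lra.
lra.
Qed.

(** Discrete form of d(y^(-s)) = -s y^(-s-1) dy, obtained from ln(1 + v) <= v and 1 + v <=
    exp(v). *)
Lemma powR_opp_diff (s y z : R) : 0 < s -> 0 < y -> y <= z ->
  s * z `^ (- s) * ((z - y) / z) <= y `^ (- s) - z `^ (- s).
Proof.
move=> s0 y0 yz.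
have z0 : 0 < z by exact: lt_le_trans yz.
rewrite /powR !gt_eqF//.
have e : expR (- s * ln y) = expR (- s * ln z) * expR (s * (ln z - ln y)).
  by rewrite -expRD; congr expR; ring.
rewrite e.
have l : (z - y) / z <= ln z - ln y.
  have := @le_ln1Dx R (y / z - 1); rewrite (_ : 1 + (y / z - 1) = y / z); last by ring.
  rewrite ln_div ?posrE// => h.
  have : ln y - ln z <= y / z - 1 by apply: h; have := divr_gt0 y0 z0; lra.
  have -> : (z - y) / z = 1 - y / z by field; rewrite gt_eqF.
  lra.
have h := expR_ge1Dx (s * (ln z - ln y)).
have l' : s * ((z - y) / z) <= s * (ln z - ln y) by rewrite ler_pM2l.
have E0 := expR_gt0 (- s * ln z).
have : expR (- s * ln z) * (s * ((z - y) / z)) <= expR (- s * ln z) * (expR (s * (ln z - ln y)) - 1).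
  by rewrite ler_pM2l//; lra.
lra.
Qed.

(* Superlinear growth forces blow-up in a time that does not depend on the
   threshold [Z]; only the admissible step size does. *)
Lemma discrete_blowup (sig c e : R) : 1 < sig -> 0 < c -> 0 < e ->
  exists2 T, 0 < T & forall Z, exists2 tb, 0 < tb & forall tau, 0 < tau -> tau <= tb ->
    forall y : nat -> R, 0 <= y 0 ->
    (forall j, y j + 4 * tau * e + 2 * tau * c * y j `^ sig <= y j.+1) ->
    exists2 j, j%:R * tau <= T & Z < y j.
Proof.
move=> sig1 c0 e0.
pose s := sig - 1.
have s0 : 0 < s by rewrite subr_gt0.
(* A lower bound for the rate at which y^(-s) decreases; the factor 2^(-sig) pays for a step that
   may double [y]. *)
pose kap := 2 * c * s * 2 `^ (- sig).
have kap0 : 0 < kap by rewrite !mulr_gt0// powR_gt0.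
pose g0 := (4 * e) `^ (- s).
have g00 : 0 < g0 by rewrite powR_gt0// mulr_gt0.
(* Linear growth reaches the level 4e within time 2; then y^(-s) is at most [g0] and falls at rate
   [kap], so it is exhausted within g0/kap + 1. Rounding to whole steps is included, since tau <=
   1. *)
exists (3 + g0 / kap); first by rewrite addr_gt0// divr_gt0.
move=> Z; pose Z1 := Num.max Z 1.
have Z10 : 0 < Z1 by rewrite lt_max ltr01 orbT.
have W0 : 0 < 2 * c * Z1 `^ s by rewrite !mulr_gt0// powR_gt0.
(* Below the level [Z1] the superlinear term of one step then at most doubles [y]. *)
exists (Num.min 1 (2 * c * Z1 `^ s)^-1); first by rewrite lt_min ltr01 invr_gt0.
move=> tau tau0; rewrite le_min => /andP[tau1 tauZ] y y0 step.
have tauZ' : tau * (2 * c * Z1 `^ s) <= 1 by rewrite -ler_pdivlMr// mul1r.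
apply: contrapT => nex.
have yZ j : j%:R * tau <= 3 + g0 / kap -> y j <= Z1.
  move=> jT; rewrite le_max leNgt; apply/orP; left; apply/negP => Zy.
  by apply: nex; exists j.
have ylin j : 4 * e * (j%:R * tau) <= y j.
  elim: j => [|j IH]; first by rewrite mul0r mulr0.
  have := step j; have : 0 <= 2 * tau * c * y j `^ sig.
    by rewrite mulr_ge0 ?powR_ge0// !mulr_ge0// ltW.
  by rewrite -natr1; lra.
have [J1 J1a J1b] : exists2 J, 1 <= J%:R * tau & J%:R * tau <= 2.
  pose J := (Num.truncn (tau^-1)).+1.
  have ti : 0 <= tau^-1 by rewrite invr_ge0 ltW.
  have /andP[t1 t2] := truncn_itv ti.
  exists J.
    by rewrite -ler_pdivrMr// mul1r ltW.
  rewrite /J -natr1 mulrDl mul1r.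
  have : (Num.truncn tau^-1)%:R * tau <= tau^-1 * tau by rewrite ler_pM2r.
  by rewrite mulVf ?gt_eqF//; lra.
have [m m1 m2] : exists2 m, g0 / kap <= m%:R * tau & m%:R * tau <= g0 / kap + 1.
  pose q := g0 / kap / tau.
  have q0 : 0 <= q by rewrite !divr_ge0// ltW.
  have /andP[t1 t2] := truncn_itv q0.
  have qt : q * tau = g0 / kap by rewrite divfK// gt_eqF.
  exists (Num.truncn q).+1.
    by rewrite -qt ler_pM2r// ltW.
  rewrite -natr1 mulrDl mul1r -qt.
  have : (Num.truncn q)%:R * tau <= q * tau by rewrite ler_pM2r.
  lra.
have ypos i : 4 * e <= y (J1 + i)%N.
  apply: le_trans (ylin _); rewrite natrD mulrDl.
  have : 0 <= i%:R * tau by rewrite mulr_ge0// ltW.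
  by move=> h; rewrite -[leLHS]mulr1 ler_pM2l ?mulr_gt0//; lra.
have e40 : 0 < 4 * e by rewrite mulr_gt0.
have dec i : (i <= m)%N -> y (J1 + i)%N `^ (- s) <= g0 - kap * (i%:R * tau).
  elim: i => [|i IH] im.
    rewrite addn0 mul0r mulr0 subr0 /g0 !powRN lef_pV2 ?posrE ?powR_gt0//.
      have := ypos 0%N; rewrite addn0 => h.
      by apply: ge0_ler_powR => //; rewrite ?nnegrE ?(ltW s0) ?(ltW e40)// (le_trans (ltW e40)).
    by have := ypos 0%N; rewrite addn0; exact: lt_le_trans.
  have yi0 : 0 < y (J1 + i)%N := lt_le_trans e40 (ypos i).
  have yiZ : y (J1 + i)%N <= Z1.
    apply: yZ; rewrite natrD mulrDl.
    have : i%:R * tau <= m%:R * tau by rewrite ler_pM2r// ler_nat ltnW.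
    lra.
  have := step (J1 + i)%N; rewrite -addnS; set Y := y (J1 + i)%N in yi0 yiZ IH *.
  set Y' := y (J1 + i.+1)%N => st.
  pose z := Y + 2 * tau * c * Y `^ sig.
  have Ys : Y `^ sig = Y * Y `^ s by rewrite /s mulr_powRB1 ?(ltW yi0)// (lt_trans ltr01).
  have zY : Y <= z by rewrite lerDl mulr_ge0 ?powR_ge0// !mulr_ge0// ltW.
  have z0 : 0 < z by exact: lt_le_trans zY.
  have YsZ : Y `^ s <= Z1 `^ s.
    by apply: ge0_ler_powR => //; rewrite ?nnegrE ltW.
  have z2 : z <= 2 * Y.
    have : tau * (2 * c * Y `^ s) <= 1.
      by apply: le_trans tauZ'; rewrite ler_pM2l// ler_pM2l// mulr_gt0.
    rewrite /z Ys => h; have : Y * (tau * (2 * c * Y `^ s)) <= Y * 1 by rewrite ler_pM2l.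
    lra.
  have zY' : z <= Y' by apply: le_trans st; rewrite /z; have := mulr_gt0 tau0 e0; lra.
  have h1 : Y' `^ (- s) <= z `^ (- s).
    rewrite !powRN lef_pV2 ?posrE ?powR_gt0//; last by exact: lt_le_trans zY'.
    by apply: ge0_ler_powR => //; rewrite ?nnegrE ltW// (lt_le_trans z0).
  have h2 := powR_opp_diff s0 yi0 zY.
  have h3 : kap * tau <= s * z `^ (- s) * ((z - Y) / z).
    have -> : s * z `^ (- s) * ((z - Y) / z) = (2 * tau * c * s) * (Y `^ sig / z `^ sig).
      have -> : z - Y = 2 * tau * c * Y `^ sig by rewrite /z; ring.
      have -> : z `^ sig = z * z `^ s by rewrite /s mulr_powRB1 ?(ltW z0)// (lt_trans ltr01).
      rewrite powRN; field; rewrite !gt_eqF// powR_gt0//.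
    have -> : kap * tau = (2 * tau * c * s) * 2 `^ (- sig) by rewrite /kap; ring.
    rewrite ler_pM2l ?mulr_gt0//.
    rewrite ler_pdivlMr ?powR_gt0// powRN mulrC ler_pdivrMr ?powR_gt0//.
    rewrite -powRM ?(ltW yi0)// (mulrC Y).
    by apply: ge0_ler_powR => //; rewrite ?nnegrE ?mulr_ge0 ?(ltW yi0) ?(ltW z0) ?(ltW (lt_trans ltr01 sig1)).
  have := IH (ltnW im); rewrite -natr1; lra.
(* After [m] further steps the upper bound for y^(-s) is nonpositive, contradicting its
   positivity. *)
have := dec m (leqnn m); apply/negP; rewrite -ltNge.
apply: (@le_lt_trans _ _ 0).
  have : kap * (g0 / kap) <= kap * (m%:R * tau) by rewrite ler_pM2l.
  have -> : kap * (g0 / kap) = g0 by field; rewrite gt_eqF.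
  lra.
by rewrite powR_gt0// (lt_le_trans e40).
Qed.

End PowerInequalities.

(** * Energy and mass of the scheme for a symmetric substochastic kernel *)

Section DiscreteEnergy.
Variables (R : realType) (X : finType) (K : X -> X -> R) (tau p : R).
Hypothesis K_ge0 : forall x y, 0 <= K x y.
Hypothesis K_sym : forall x y, K x y = K y x.
Hypothesis K_sub : forall x, \sum_y K x y <= 1.
Hypothesis tau0 : 0 < tau.
Hypothesis p2 : 2 < p.
Implicit Types (w d : X -> R).

Definition avg w x := \sum_y K x y * w y.

Definition scheme_step w x := avg w x + tau * w x `^ (p - 1).

(** The quadratic part is the Dirichlet form of (1 - K)/tau. For symmetric [K] and nonnegative [w],
    [scheme_step] is [w] minus [tau] times the gradient of this function. *)
Definition scheme_energy w :=
  (2 * tau)^-1 * (\sum_x w x * (w x - avg w x)) - (\sum_x w x `^ p) / p.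

Lemma avg_ge0 w x : (forall x, 0 <= w x) -> 0 <= avg w x.
Proof. by move=> w0; apply: sumr_ge0 => y _; rewrite mulr_ge0. Qed.

Lemma scheme_step_ge0 w : (forall x, 0 <= w x) -> forall x, 0 <= scheme_step w x.
Proof. by move=> w0 x; rewrite addr_ge0 ?avg_ge0// mulr_ge0 ?powR_ge0// ltW. Qed.

Lemma avg_sym w d : \sum_x w x * avg d x = \sum_x d x * avg w x.
Proof.
rewrite /avg; under eq_bigr do rewrite mulr_sumr.
rewrite exchange_big/=; apply: eq_bigr => x _; rewrite mulr_sumr.
by apply: eq_bigr => y _; rewrite K_sym; ring.
Qed.

Lemma avgD w d x : avg (fun x => w x + d x) x = avg w x + avg d x.
Proof. by rewrite /avg -big_split; apply: eq_bigr => y _; rewrite mulrDr. Qed.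

(** Positivity of 1 + K: sum K x y (d x + d y)^2 over all pairs and use that rows, and by symmetry
    columns, sum to at most 1. *)
Lemma avg_quad d : - (\sum_x d x * avg d x) <= \sum_x d x ^+ 2.
Proof.
have h : \sum_x (\sum_y K x y * (d x ^+ 2 + d y ^+ 2)) <= \sum_x d x ^+ 2 + \sum_x d x ^+ 2.
  have -> : \sum_x (\sum_y K x y * (d x ^+ 2 + d y ^+ 2)) =
      \sum_x (\sum_y K x y) * d x ^+ 2 + \sum_x (\sum_y K x y) * d x ^+ 2.
    have -> : \sum_x (\sum_y K x y * (d x ^+ 2 + d y ^+ 2)) =
      \sum_x (\sum_y K x y * d x ^+ 2) + \sum_x (\sum_y K x y * d y ^+ 2).
      rewrite -big_split; apply: eq_bigr => x _; rewrite -big_split; apply: eq_bigr => y _.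
      by rewrite mulrDr.
    rewrite [X in _ + X]exchange_big/=; congr (_ + _); apply: eq_bigr => x _; rewrite mulr_suml//.
    by apply: eq_bigr => y _; rewrite K_sym.
  by apply: lerD; apply: ler_sum => x _; rewrite ler_piMl ?sqr_ge0.
have : - (\sum_x d x * avg d x) * 2 <= \sum_x (\sum_y K x y * (d x ^+ 2 + d y ^+ 2)).
  rewrite -sumrN mulr_suml; apply: ler_sum => x _; rewrite /avg mulr_sumr -sumrN mulr_suml.
  apply: ler_sum => y _.
  have := mulr_ge0 (K_ge0 x y) (sqr_ge0 (d x + d y)).
  by nra.
lra.
Qed.

(* Each explicit Euler step is a descent step because the potential [w^p / p]
   is convex and [1 + K >= 0], whatever the size of [tau]. *)
Lemma scheme_energy_step w : (forall x, 0 <= w x) ->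
  scheme_energy (scheme_step w) <= scheme_energy w.
Proof.
move=> w0; pose d x := scheme_step w x - w x.
have sE x : scheme_step w x = w x + d x by rewrite /d; ring.
have p0 : 0 < p by exact: lt_trans p2.
have p1 : 1 < p by apply: lt_trans p2; lra.
have F : (\sum_x w x `^ p) / p + \sum_x w x `^ (p - 1) * d x <= (\sum_x scheme_step w x `^ p) / p.
  rewrite !mulr_suml -big_split; apply: ler_sum => x _.
  exact: powR_tangent p1 (w0 x) (scheme_step_ge0 w0 x).
pose S0 := \sum_x w x * (w x - avg w x).
have Q : \sum_x scheme_step w x * (scheme_step w x - avg (scheme_step w) x) =
   S0 + 2 * \sum_x d x * (w x - avg w x) + (\sum_x d x ^+ 2 - \sum_x d x * avg d x).
  have e1 : \sum_x scheme_step w x * (scheme_step w x - avg (scheme_step w) x) =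
     S0 + (\sum_x d x * (w x - avg w x)) + (\sum_x w x * d x - \sum_x w x * avg d x)
      + (\sum_x d x ^+ 2 - \sum_x d x * avg d x).
    rewrite /S0 -!sumrB -!big_split; apply: eq_bigr => x _.
    have -> : avg (scheme_step w) x = avg w x + avg d x.
      by rewrite -avgD; apply: eq_bigr => y _; rewrite sE.
    by rewrite sE/=; ring.
  rewrite e1 avg_sym.
  have -> : \sum_x w x * d x - \sum_x d x * avg w x = \sum_x d x * (w x - avg w x).
    by rewrite -sumrB; apply: eq_bigr => x _; ring.
  by ring.
(* As d = tau w^(p-1) - (w - avg w), the first-order terms cancel; what is left is -(2 tau)^-1 times
   the sum of d (d + avg d), nonpositive by [avg_quad]. *)
have D : \sum_x d x * (w x - avg w x) = tau * (\sum_x w x `^ (p - 1) * d x) - \sum_x d x ^+ 2.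
  rewrite mulr_sumr -sumrB; apply: eq_bigr => x _.
  have -> : w x - avg w x = tau * w x `^ (p - 1) - d x by rewrite /d /scheme_step; ring.
  by ring.
have := avg_quad d.
rewrite /scheme_energy -/S0 Q D.
move: F; set A := \sum_x w x `^ (p - 1) * d x; set B := \sum_x d x ^+ 2.
set C := \sum_x d x * avg d x => F h.
have : (2 * tau)^-1 * (S0 + 2 * (tau * A - B) + (B - C)) <= (2 * tau)^-1 * (S0 + 2 * (tau * A)).
  by rewrite ler_pM2l ?invr_gt0 ?mulr_gt0//; lra.
have -> : (2 * tau)^-1 * (S0 + 2 * (tau * A)) = (2 * tau)^-1 * S0 + A by field; rewrite gt_eqF.
by lra.
Qed.

(** Discrete version of the identity d/dt |w|_2^2 = -4 E(w) + 2 (1 - 2/p) |w|_p^p; the inequality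
    comes from dropping the square of the increment. *)
Lemma scheme_mass_step w : (forall x, 0 <= w x) ->
  \sum_x w x ^+ 2 - 4 * tau * scheme_energy w + 2 * tau * (1 - 2 / p) * (\sum_x w x `^ p)
   <= \sum_x scheme_step w x ^+ 2.
Proof.
move=> w0.
have p0 : 0 < p by exact: lt_trans p2.
have : \sum_x w x ^+ 2 + 2 * (\sum_x w x * (scheme_step w x - w x)) <= \sum_x scheme_step w x ^+ 2.
  rewrite mulr_sumr -big_split; apply: ler_sum => x _ /=.
  by have := sqr_ge0 (scheme_step w x - w x); nra.
have -> : \sum_x w x * (scheme_step w x - w x) =
    tau * (\sum_x w x `^ p) - \sum_x w x * (w x - avg w x).
  rewrite mulr_sumr -sumrB; apply: eq_bigr => x _.
  by rewrite -(mulr_powRB1 (w0 x) p0) /scheme_step; ring.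
rewrite /scheme_energy; set A := \sum_x w x * _; set B := \sum_x w x `^ p.
have -> : \sum_x w x ^+ 2 - 4 * tau * ((2 * tau)^-1 * A - B / p) + 2 * tau * (1 - 2 / p) * B
 = \sum_x w x ^+ 2 + 2 * (tau * B - A) by field; rewrite !gt_eqF.
by [].
Qed.

(** Jensen's inequality for s^(p/2), by the tangent at the mean of the squares, whose linear terms
    sum to zero. *)
Lemma power_mean w : (0 < #|X|)%N -> (forall x, 0 <= w x) ->
  #|X|%:R * ((\sum_x w x ^+ 2) / #|X|%:R) `^ (p / 2) <= \sum_x w x `^ p.
Proof.
move=> X0 w0; set y := _ / _.
have N0 : 0 < #|X|%:R :> R by rewrite ltr0n.
have y0 : 0 <= y by apply: divr_ge0; [apply: sumr_ge0 => x _; exact: sqr_ge0|exact: ltW].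
have s1 : 1 < p / 2 by rewrite ltr_pdivlMr// mul1r.
have s0 : 0 < p / 2 by exact: lt_trans s1.
have h : \sum_x (y `^ (p / 2) / (p / 2) + y `^ (p / 2 - 1) * (w x ^+ 2 - y)) <=
    \sum_x w x `^ p / (p / 2).
  apply: ler_sum => x _.
  have := powR_tangent s1 y0 (sqr_ge0 (w x)).
  by rewrite -(powR_mulrn 2 (w0 x)) -powRrM (_ : 2 * (p / 2) = p)//; field.
move: h; rewrite big_split/= sumr_const -mulr_suml.
rewrite -[X in _ + X]mulr_sumr sumrB sumr_const -[y *+ _]mulr_natl.
have -> : #|X|%:R * y = \sum_x w x ^+ 2 by rewrite /y; field; rewrite gt_eqF.
by rewrite subrr mulr0 addr0 -[_ *+ _]mulr_natl mulrA ler_pM2r ?invr_gt0.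
Qed.

End DiscreteEnergy.

(** [discrete_blowup] is applied to the mean square with sig = p/2 and c = 1 - 2/p. Since energy and
    mass are counted per grid point, T depends neither on the grid nor on the kernel. A mean square
    above the square of a nonnegative level forces some value above that level. *)
Lemma scheme_blowup (R : realType) (p e : R) : 2 < p -> 0 < e ->
  exists2 T, 0 < T & forall Z, exists2 tb, 0 < tb & forall (X : finType) (K : X -> X -> R) tau,
    (forall x y, 0 <= K x y) -> (forall x y, K x y = K y x) -> (forall x, \sum_y K x y <= 1) ->
    0 < tau -> tau <= tb -> (0 < #|X|)%N ->
    forall w : X -> R, (forall x, 0 <= w x) -> scheme_energy K tau p w <= - e * #|X|%:R ->
    exists j x, j%:R * tau <= T /\ Z < iter j (scheme_step K tau p) w x.
Proof.
move=> p2 e0.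
have c0 : 0 < 1 - 2 / p.
  by rewrite subr_gt0 ltr_pdivrMr ?mul1r//; exact: lt_trans p2.
have s1 : 1 < p / 2 by rewrite ltr_pdivlMr// mul1r.
have [T T0 H] := discrete_blowup s1 c0 e0.
exists T => // Z; have [tb tb0 {}H] := H (Num.max Z 0 ^+ 2).
exists tb => // X K tau K0 Ks K1 tau0 tautb X0 w w0 Ew.
have N0 : 0 < #|X|%:R :> R by rewrite ltr0n.
pose W j := iter j (scheme_step K tau p) w.
have W0 j x : 0 <= W j x.
  elim: j x => [|j IH] x; first exact: w0.
  exact: scheme_step_ge0.
have EW j : scheme_energy K tau p (W j) <= - e * #|X|%:R.
  by elim: j => [//|j IH]; apply: le_trans IH; exact: scheme_energy_step.
pose y j := (\sum_x W j x ^+ 2) / #|X|%:R.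
have y0 : 0 <= y 0%N by apply: divr_ge0; [apply: sumr_ge0 => x _; exact: sqr_ge0|exact: ltW].
have [|j jT yj] := H tau tau0 tautb y y0.
  move=> j; have := scheme_mass_step K tau0 p2 (W0 j).
  have := power_mean p2 X0 (W0 j); rewrite -/(y j) => h1 h2.
  rewrite /y ler_pdivlMr//; apply: le_trans h2; rewrite -/(y j).
  have -> : \sum_x W j x ^+ 2 = y j * #|X|%:R by rewrite /y; field; rewrite gt_eqF.
  have : 4 * tau * scheme_energy K tau p (W j) <= 4 * tau * (- e * #|X|%:R).
    by rewrite ler_pM2l ?EW// mulr_gt0.
  have : 2 * tau * (1 - 2 / p) * (#|X|%:R * y j `^ (p / 2)) <= 2 * tau * (1 - 2 / p) * (\sum_x W j x `^ p).
    by rewrite ler_pM2l// !mulr_gt0.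
  by lra.
exists j; apply: contrapT => nex.
have hx x : W j x <= Num.max Z 0.
  rewrite le_max leNgt; apply/orP; left; apply/negP => h.
  by apply: nex; exists x.
move: yj; rewrite ltNge => /negP; apply.
rewrite /y ler_pdivrMr//.
apply: (@le_trans _ _ (\sum_(x : X) Num.max Z 0 ^+ 2)).
  by apply: ler_sum => x _; apply: lerXn2r; rewrite ?nnegrE// (le_trans (W0 j x)).
by rewrite sumr_const -[_ *+ _]mulr_natr.
Qed.

(** * Riemann sums *)

Section Riemann.
Variable R : realType.
Notation mu := (@lebesgue_measure R).

(** [-1, 1] is cut into N + 1 cells; the indices a < N give its interior nodes, and [node N N] = 1
    is the wall, where sampled functions vanish. *)
Definition mesh (N : nat) : R := 2 / N.+1%:R.
Definition node (N a : nat) : R := -1 + a.+1%:R * mesh N.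
Definition gridpt {m} (N : nat) (x : 'rV['I_N]_m) : 'rV[R]_m := \row_j node N (x ord0 j).

Lemma mesh_gt0 N : 0 < mesh N. Proof. by rewrite divr_gt0. Qed.

Lemma mesh_mul N : N.+1%:R * mesh N = 2.
Proof. by rewrite /mesh mulrC divfK// pnatr_eq0. Qed.

Lemma node_max N : node N N = 1.
Proof. by rewrite /node mesh_mul; ring. Qed.

(** The numbers [v a] need only be close to [G] near the nodes: in the induction on dimension they
    are Riemann sums of slices, not values of [G]. *)
Lemma riemann_1d (G : R -> R) (N : nat) (v : nat -> R) (kap : R) :
  continuous G -> (forall t, 1 <= `|t| -> G t = 0) -> v N = 0 ->
  (forall a t, (a <= N)%N -> -1 <= t <= 1 -> `|t - node N a| <= mesh N -> `|G t - v a| <= kap) ->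
  `|Rintegral mu setT G - mesh N * \sum_(a < N) v a| <= 2 * kap.
Proof.
move=> cG G0 vN Gv.
(* Starting the antiderivative at -2 keeps -1 and 1 inside the open interval where it is
   differentiable. *)
pose F (x : R) := (\int[mu]_(t in [set` `[-2, x]]) G t)%R.
have iG : mu.-integrable `[-2, 2] (EFin \o G).
  apply: continuous_compact_integrable; first exact: segment_compact.
  exact: continuous_subspaceT.
have dF (x : R) : -2 < x < 2 -> is_derive x 1 F (G x).
  move=> /andP[x1 x2].
  have [d e] := continuous_FTC1_closed x2 iG x1 (cG x).
  by split; [exact: d|rewrite -derive1E; exact: e].
have F1 : Rintegral mu setT G = F 1.
  rewrite /F [RHS]Rintegral_mkcond; apply: eq_Rintegral => t _; rewrite patchE.
  case: ifPn => //; rewrite notin_setE/= in_itv/= => /negP; rewrite negb_and -!ltNge => h.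
  by apply: G0; rewrite ler_normr; case/orP: h => h; apply/orP; [right|left]; lra.
have F0 : F (-1) = 0.
  rewrite /F /Rintegral (eq_integral (cst 0%E)) ?integral0// => t; rewrite inE/= in_itv/= => /andP[_ h].
  by rewrite G0// ler_normr; apply/orP; right; lra.
have e1 : Rintegral mu setT G = F 1 - F (-1) by rewrite F0 subr0.
have e2 : F 1 - F (-1) = \sum_(a < N.+1) (F (-1 + a.+1%:R * mesh N) - F (-1 + a%:R * mesh N)).
  rewrite -(big_mkord xpredT (fun a => F (-1 + a.+1%:R * mesh N) - F (-1 + a%:R * mesh N))).
  rewrite (telescope_sumr (fun a => F (-1 + a%:R * mesh N)))// mesh_mul mul0r addr0.
  by congr (F _ - _); lra.
have -> : mesh N * \sum_(a < N) v a = \sum_(a < N.+1) mesh N * v a.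
  by rewrite big_ord_recr/= vN mulr0 addr0 mulr_sumr.
rewrite e1 e2 -sumrB.
apply: le_trans (ler_norm_sum _ _ _) _.
have -> : 2 * kap = \sum_(a < N.+1) mesh N * kap.
  by rewrite sumr_const card_ord -(mesh_mul N) -mulrA mulr_natl.
apply: ler_sum => a _.
have h0 := mesh_gt0 N.
have a1 : -1 + a.+1%:R * mesh N <= 1.
  have : a.+1%:R * mesh N <= N.+1%:R * mesh N by rewrite ler_pM2r// ler_nat.
  by rewrite mesh_mul; lra.
have a0 : 0 <= a%:R * mesh N by rewrite mulr_ge0// ltW.
have aS : a.+1%:R * mesh N = a%:R * mesh N + mesh N by rewrite -natr1; ring.
have lt_a : -1 + a%:R * mesh N < -1 + a.+1%:R * mesh N by lra.
have [x xa|xi /andP[x1 x2] ->] := @MVT_derive R F G _ _ lt_a.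
  by apply: dF; lra.
have -> : G xi * (-1 + a.+1%:R * mesh N - (-1 + a%:R * mesh N)) - mesh N * v a = mesh N * (G xi - v a).
  by rewrite aS; ring.
rewrite normrM gtr0_norm// ler_pM2l//; apply: Gv; first by rewrite -ltnS.
  by lra.
rewrite /node ler_norml; apply/andP; split; lra.
Qed.

Lemma sum_rV_cons (N m : nat) (f : 'rV['I_N]_m.+1 -> R) :
  \sum_x f x = \sum_(a < N) \sum_(y : 'rV['I_N]_m) f (row_mx (const_mx a : 'rV_1) y).
Proof.
rewrite pair_big/=.
rewrite (reindex (fun ay : 'I_N * 'rV['I_N]_m => row_mx (const_mx ay.1 : 'rV_1) ay.2))//=.
exists (fun x : 'rV['I_N]_(1 + m) => (lsubmx x ord0 ord0, rsubmx x)) => [[a y]|x] _ /=.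
  by rewrite row_mxKl row_mxKr mxE.
rewrite -[RHS]hsubmxK; congr row_mx; apply/rowP => i.
by rewrite !ord1 !mxE.
Qed.

Lemma gridpt_cons (N m : nat) (a : 'I_N) (y : 'rV['I_N]_m) :
  gridpt (row_mx (const_mx a : 'rV_1) y) = row_mx ((node N a)%:M : 'rV[R]_1) (gridpt y) :> 'rV_(1 + m).
Proof.
apply/rowP => j; rewrite !mxE; case: (fintype.split _) => i; rewrite !mxE//.
by rewrite ord1 eqxx.
Qed.

(** Induction over slices. The modulus [om] at the scale of the mesh gives the error; uniform
    continuity at every scale is what makes the partial integrals continuous in the remaining
    variable. The constant solves 2 (c_m + 2^m) = c_(m+1). *)
Lemma riemann_nd m (g : 'rV[R]_m -> R) (N : nat) (om : R) :
  (forall e : R, 0 < e -> exists2 d : R, 0 < d & forall x y : 'rV[R]_m, (forall i, `|x ord0 i - y ord0 i| <= d) -> `|g x - g y| <= e) ->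
  (forall x : 'rV[R]_m, (exists i, 1 <= `|x ord0 i|) -> g x = 0) ->
  0 <= om -> (forall x y : 'rV[R]_m, (forall i, `|x ord0 i - y ord0 i| <= mesh N) -> `|g x - g y| <= om) ->
  `|iter_integral g - mesh N ^+ m * \sum_(x : 'rV['I_N]_m) g (gridpt x)| <= m%:R * 2 ^+ m * om.
Proof.
elim: m g N om => [|m IH] g N om ug g0 om0 gom.
  rewrite /= expr0 mul1r !mul0r (eq_bigr (fun=> g 0)); last first.
    by move=> x _; congr g; apply/rowP => -[].
  by rewrite sumr_const card_mx muln0 expn0 mulr1n subrr normr0.
pose sl (t : R) : 'rV[R]_m -> R := fun y => g (row_mx (t%:M : 'rV[R]_1) y).
have sl_close (t t' : R) (y y' : 'rV[R]_m) (c : R) : `|t - t'| <= c -> (forall i, `|y ord0 i - y' ord0 i| <= c) ->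
    forall i, `|(row_mx (t%:M : 'rV[R]_1) y : 'rV_(1 + m)) ord0 i - (row_mx (t'%:M : 'rV[R]_1) y' : 'rV_(1 + m)) ord0 i| <= c.
  move=> tt yy i; rewrite !mxE; case: (fintype.split _) => j; last exact: yy.
  by rewrite !mxE (ord1 j) !mulr1n.
have usl t (e : R) : 0 < e -> exists2 d : R, 0 < d & forall x y : 'rV[R]_m, (forall i, `|x ord0 i - y ord0 i| <= d) -> `|sl t x - sl t y| <= e.
  move=> e0; have [d d0 h] := ug _ e0; exists d => // x y xy; apply: h.
  by apply: sl_close => //; rewrite subrr normr0 ltW.
have sl0 t (x : 'rV[R]_m) : (exists i, 1 <= `|x ord0 i|) -> sl t x = 0.
  move=> [i xi]; apply: g0; exists (rshift 1 i).
  by rewrite (row_mxEr (t%:M : 'rV[R]_1)).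
have sl1 t x : 1 <= `|t| -> sl t x = 0.
  move=> t1; apply: g0; exists (lshift m (ord0 : 'I_1)).
  by rewrite (row_mxEl (t%:M : 'rV[R]_1)) mxE eqxx mulr1n.
have sum_close M (c : R) (f f' : 'rV['I_M]_m -> R) : 0 <= c -> (forall y, `|f y - f' y| <= c) ->
   `|mesh M ^+ m * \sum_y f y - mesh M ^+ m * \sum_y f' y| <= 2 ^+ m * c.
  move=> c0 ff; rewrite -mulrBr normrM ger0_norm ?exprn_ge0 ?(ltW (mesh_gt0 _))//.
  rewrite -sumrB.
  have h : `|\sum_y (f y - f' y)| <= M%:R ^+ m * c.
    apply: le_trans (ler_norm_sum _ _ _) _.
    apply: (@le_trans _ _ (\sum_(y : 'rV['I_M]_m) c)); first exact: ler_sum.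
    by rewrite sumr_const card_mx card_ord mul1n -[_ *+ _]mulr_natl natrX.
  have hM : mesh M ^+ m * M%:R ^+ m <= 2 ^+ m.
    rewrite -exprMn; apply: lerXn2r; rewrite ?nnegrE ?mulr_ge0 ?(ltW (mesh_gt0 _))//.
    by rewrite -(mesh_mul M) mulrC ler_pM2r ?mesh_gt0// ler_nat.
  apply: (@le_trans _ _ (mesh M ^+ m * (M%:R ^+ m * c))).
    by rewrite ler_wpM2l ?exprn_ge0 ?(ltW (mesh_gt0 _)).
  by rewrite mulrA ler_wpM2r.
pose G t := iter_integral (sl t).
pose RS M t := mesh M ^+ m * \sum_(x : 'rV['I_M]_m) sl t (gridpt x).
have GRS M t (c : R) : 0 <= c -> (forall x y : 'rV[R]_m.+1, (forall i, `|x ord0 i - y ord0 i| <= mesh M) -> `|g x - g y| <= c) ->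
    `|G t - RS M t| <= m%:R * 2 ^+ m * c.
  move=> c0 h; apply: IH => //; first exact: usl.
    exact: sl0.
  move=> x y xy; apply: h; apply: sl_close => //.
  by rewrite subrr normr0 ltW ?mesh_gt0.
have mesh_small (d : R) : 0 < d -> exists M, mesh M <= d.
  move=> d0; exists (Num.truncn (2 / d)).
  have td : 0 <= 2 / d by rewrite divr_ge0// ltW.
  have /andP[_ h] := truncn_itv td.
  by rewrite /mesh ler_pdivrMr// mulrC -ler_pdivrMr// ltW.
(* Both values of [G] are compared, through the induction hypothesis, with Riemann sums on an
   auxiliary mesh [M] chosen from [e]. *)
have cG : continuous G.
  move=> t; apply/cvgrPdist_le => e e0.
  pose c := e / (2 * (m%:R * 2 ^+ m) + 2 ^+ m).
  have den : 0 < 2 * (m%:R * 2 ^+ m) + 2 ^+ m :> R.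
    by rewrite ltr_wpDl ?exprn_gt0// !mulr_ge0// exprn_ge0.
  have c0 : 0 < c by rewrite divr_gt0.
  have [d d0 hd] := ug _ c0.
  have [M Md] := mesh_small _ d0.
  have hM (x y : 'rV[R]_m.+1) : (forall i, `|x ord0 i - y ord0 i| <= mesh M) -> `|g x - g y| <= c.
    by move=> h; apply: hd => i; apply: le_trans (h i) Md.
  have hG t' := GRS M t' c (ltW c0) hM.
  have tt : \forall t' \near t, `|t - t'| <= d.
    by apply/nbhs_ballP; exists d => // t' /ltW.
  near=> t'.
  have td : `|t - t'| <= d by near: t'.
  have h1 := hG t; have h2 := hG t'.
  have h3 : `|RS M t - RS M t'| <= 2 ^+ m * c.
    apply: sum_close; first exact: ltW.
    move=> y; apply: hd; apply: sl_close => // i.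
    by rewrite subrr normr0 ltW.
  have ec : e = (m%:R * 2 ^+ m * c) + 2 ^+ m * c + m%:R * 2 ^+ m * c.
    by rewrite /c; field; rewrite gt_eqF.
  rewrite ec (_ : G t - G t' = (G t - RS M t) + (RS M t - RS M t') + (RS M t' - G t')); last by ring.
  rewrite (le_trans (ler_normD _ _))// lerD//; last by rewrite distrC.
  by rewrite (le_trans (ler_normD _ _))// lerD.
have G0 (t : R) : 1 <= `|t| -> G t = 0.
  move=> t1; have h := @IH (sl t) 0%N 0 (usl t) (sl0 t) (lexx 0) _.
  have : `|iter_integral (sl t) - mesh 0 ^+ m * \sum_(x : 'rV['I_0]_m) sl t (gridpt x)| <= m%:R * 2 ^+ m * 0.
    by apply: h => x y _; rewrite !sl1// subrr normr0.
  rewrite big1; last by move=> x _; rewrite sl1.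
  by rewrite !mulr0 subr0 normr_le0 => /eqP.
pose v a := RS N (node N a).
have vN : v N = 0.
  rewrite /v /RS big1 ?mulr0// => x _; apply: sl1.
  by rewrite node_max normr1.
have kapE : 2 * (m%:R * 2 ^+ m * om + 2 ^+ m * om) = m.+1%:R * 2 ^+ m.+1 * om.
  by rewrite -natr1 exprS; ring.
rewrite -kapE.
have -> : mesh N ^+ m.+1 * \sum_(x : 'rV['I_N]_m.+1) g (gridpt x) = mesh N * \sum_(a < N) v a.
  rewrite (sum_rV_cons (fun x => g (gridpt x))) exprS -mulrA; congr (_ * _); rewrite mulr_sumr.
  apply: eq_bigr => a _; rewrite /v /RS; congr (_ * _); apply: eq_bigr => y _.
  by rewrite /sl gridpt_cons.
apply: riemann_1d => // a t aN t1 tnode.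
rewrite (_ : G t - v a = (G t - RS N t) + (RS N t - v a)); last by ring.
rewrite (le_trans (ler_normD _ _))// lerD//; first exact: GRS.
apply: sum_close => // y; apply: gom; apply: sl_close => // i.
by rewrite subrr normr0 ltW ?mesh_gt0.
Unshelve. all: by end_near. Qed.

End Riemann.

(** * The discrete energy *)

(** Heine-Cantor with only [x] confined to [C]: the second point may leave the compact set. *)
Lemma compact_unif_cont (R : realType) (V : normedModType R) (C : set V) (f : V -> R) :
  compact C -> (forall x, C x -> {for x, continuous f}) ->
  forall e : R, 0 < e -> exists2 d : R, 0 < d &
    forall x y, C x -> `|x - y| <= d -> `|f x - f y| <= e.
Proof.
move=> /compact_near_coveringP cC cf e e0.
have [|d /= d0 hd] := cC R (0^'+) (fun d x => forall y, `|x - y| <= d -> `|f x - f y| <= e) _.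
  move=> x Cx; have /cvgrPdist_le /(_ (e / 2)) := cf x Cx.
  rewrite divr_gt0// => /(_ isT) /nbhs_ballP[r /= r0 hr].
  have r20 : 0 < r / 2 by rewrite divr_gt0.
  have n1 : \forall x' \near x, `|x - x'| < r / 2.
    by apply/nbhs_ballP; exists (r / 2) => // z; rewrite -ball_normE.
  near=> x' d => /= y xy.
  have x1 : `|x - x'| < r / 2 by near: x'.
  have d1 : d < r / 2 by near: d; exact: nbhs_right_lt.
  have h1 : `|f x - f x'| <= e / 2.
    apply: hr; rewrite -ball_normE /=; apply: lt_trans x1 _.
    by rewrite ltr_pdivrMr// ltr_pMr// ltr1n.
  have h2 : `|f x - f y| <= e / 2.
    apply: hr; rewrite -ball_normE/=.
    apply: le_lt_trans (ler_distD x' x y) _.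
    by rewrite [ltRHS]splitr ltrD// (le_lt_trans xy).
  have := ler_distD (f x) (f x') (f y).
  by rewrite (distrC (f x') (f x)); lra.
have d20 : 0 < d / 2 by rewrite divr_gt0.
exists (d / 2) => // x y Cx xy.
apply: (hd (d / 2)) => //=.
  by rewrite sub0r normrN gtr0_norm//; lra.
Unshelve. all: by end_near. Qed.

Lemma uniform_family (R : realType) (I : finType) (P : I -> R -> Prop) :
  (forall i, exists2 d, 0 < d & P i d) -> (forall i d d', d' <= d -> P i d -> P i d') ->
  exists2 d, 0 < d & forall i, P i d.
Proof.
move=> h mono.
have [f fP] := choice (fun i => (let: ex_intro2 d h1 h2 := h i in ex_intro _ d (conj h1 h2))).
exists (\big[Num.min/1]_i f i).
  apply: (big_ind (fun z => 0 < z)) => // [a b a0 b0|i _]; first by rewrite lt_min a0.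
  by have [] := fP i.
move=> i; apply: mono (proj2 (fP i)); exact: bigmin_le_cond.
Qed.

(** * The killed random walk *)

Section GridWalk.
Variables (R : realType) (n N : nat).
Notation X := 'rV['I_N]_n.

Definition succ_rel (i : 'I_n) (x y : X) : bool :=
  [forall j, (y ord0 j : nat) == (x ord0 j + (i == j))%N].

Lemma succ_rel_inj i x y y' : succ_rel i x y -> succ_rel i x y' -> y = y'.
Proof.
move=> /forallP h /forallP h'; apply/rowP => j; apply: val_inj.
by rewrite /= (eqP (h j)) (eqP (h' j)).
Qed.

Lemma succ_rel_inj_l i x x' y : succ_rel i x y -> succ_rel i x' y -> x = x'.
Proof.
move=> /forallP h /forallP h'; apply/rowP => j; apply: val_inj.
by apply: (@addIn (i == j)); rewrite /= -(eqP (h j)) -(eqP (h' j)).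
Qed.

Lemma sum_unique_le (P : pred X) (F : X -> R) (V : R) :
  (forall y y', P y -> P y' -> y = y') -> 0 <= V -> (forall y, P y -> F y <= V) ->
  \sum_y (P y)%:R * F y <= V.
Proof.
move=> P1 V0 FV; have [/existsP[y Py]|/negP nP] := boolP [exists y, P y].
  rewrite (bigD1 y)//= Py mul1r big1 ?addr0 ?FV// => z zy.
  by case: (boolP (P z)) => [Pz|_]; rewrite ?mul0r//; case/eqP: zy; exact: P1.
rewrite big1// => y _; case: (boolP (P y)) => [Py|_]; last by rewrite mul0r.
by case: nP; apply/existsP; exists y.
Qed.

Lemma sum_unique_eq (P : pred X) (F : X -> R) (y : X) :
  (forall y y', P y -> P y' -> y = y') -> P y -> \sum_y (P y)%:R * F y = F y.
Proof.
move=> P1 Py; rewrite (bigD1 y)//= Py mul1r big1 ?addr0// => z zy.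
by case: (boolP (P z)) => [Pz|_]; rewrite ?mul0r//; case/eqP: zy; exact: P1.
Qed.

Lemma sum_none (P : pred X) (F : X -> R) : (forall y, ~~ P y) -> \sum_y (P y)%:R * F y = 0.
Proof. by move=> nP; rewrite big1// => y _; rewrite (negbTE (nP y)) mul0r. Qed.

(* The simple random walk on the grid, killed at the walls. *)
Definition walk (x y : X) : R :=
  (2 * n%:R)^-1 * \sum_i ((succ_rel i x y)%:R + (succ_rel i y x)%:R).

Lemma walk_ge0 x y : 0 <= walk x y.
Proof. by rewrite mulr_ge0 ?invr_ge0 ?mulr_ge0// sumr_ge0// => i _; rewrite addr_ge0. Qed.

Lemma walk_sym x y : walk x y = walk y x.
Proof. by congr (_ * _); apply: eq_bigr => i _; rewrite addrC. Qed.

Lemma walkE (w : X -> R) x : avg walk w x =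
  (2 * n%:R)^-1 * \sum_i ((\sum_y (succ_rel i x y)%:R * w y) + \sum_y (succ_rel i y x)%:R * w y).
Proof.
rewrite /avg /walk; under eq_bigr do rewrite -mulrA.
rewrite -mulr_sumr; congr (_ * _).
under eq_bigr do rewrite mulr_suml.
rewrite exchange_big/=; apply: eq_bigr => i _; rewrite -big_split.
by apply: eq_bigr => y _; rewrite mulrDl.
Qed.

Lemma walk_avg_le (w : X -> R) x (V V' : 'I_n -> R) :
  (forall i, 0 <= V i) -> (forall i, 0 <= V' i) ->
  (forall i y, succ_rel i x y -> w y <= V i) -> (forall i y, succ_rel i y x -> w y <= V' i) ->
  avg walk w x <= (2 * n%:R)^-1 * \sum_i (V i + V' i).
Proof.
move=> V0 V'0 hV hV'; rewrite walkE ler_wpM2l ?invr_ge0 ?mulr_ge0//.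
apply: ler_sum => i _; apply: lerD; apply: sum_unique_le => //.
- by move=> y y'; exact: succ_rel_inj.
- exact: hV.
- by move=> y y'; exact: succ_rel_inj_l.
- exact: hV'.
Qed.

Lemma walk_sub x : \sum_y walk x y <= 1.
Proof.
have -> : \sum_y walk x y = avg walk (fun=> 1) x.
  by apply: eq_bigr => y _; rewrite mulr1.
apply: (le_trans (@walk_avg_le _ x (fun=> 1) (fun=> 1) _ _ _ _)) => //.
rewrite sumr_const card_ord -mulr_natr.
have [->|n0] := eqVneq n 0%N; first by rewrite !mulr0.
rewrite le_eqVlt; apply/orP; left; apply/eqP; field.
by rewrite pnatr_eq0.
Qed.

Lemma gridpt_succ i x y : succ_rel i x y ->
  gridpt R y = gridpt R x + mesh R N *: ebasis R i.
Proof.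
move=> /forallP h; apply/rowP => j; rewrite !mxE /node (eqP (h j)).
by rewrite -addSn natrD; ring.
Qed.

End GridWalk.

(** * The energy of the sampled function *)

Section GridEnergy.
Variables (R : realType) (n : nat) (w0 : 'rV[R]_n -> R) (r p : R).
Hypothesis n0 : (0 < n)%N.
Hypothesis w0_smooth : smooth w0.
Hypothesis w0_ge0 : forall y, 0 <= w0 y.
Hypothesis r1 : r < 1.
Hypothesis w0_supp : forall y, r <= enorm y -> w0 y = 0.
Hypothesis p2 : 2 < p.

Notation h N := (mesh R N).
Notation X N := 'rV['I_N]_n.

Let p_gt0 : 0 < p. Proof. exact: lt_trans p2. Qed.

Lemma w0_coord (y : 'rV[R]_n) i : r <= `|y ord0 i| -> w0 y = 0.
Proof. by move=> ry; apply: w0_supp; apply: le_trans ry _; exact: coord_le_enorm. Qed.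

(** A grid point without successor in direction i sits next to the wall, where [w0] vanishes, so
    killing the walk there loses nothing. *)
Lemma shifted_value N i (x : X N) (F : R -> R) : F 0 = 0 ->
  \sum_y (succ_rel i x y)%:R * F (w0 (gridpt R y)) = F (w0 (gridpt R x + h N *: ebasis R i)).
Proof.
move=> F0; have [/existsP[y xy]|/negP nP] := boolP [exists y, succ_rel i x y].
  rewrite (@sum_unique_eq _ _ _ _ _ y)//; last by move=> ? ?; exact: succ_rel_inj.
  by rewrite (gridpt_succ _ xy).
rewrite sum_none; last by move=> y; apply/negP => xy; apply: nP; apply/existsP; exists y.
suff xi : (x ord0 i).+1 = N.
  rewrite (@w0_coord _ i) ?F0//.
  rewrite !mxE eqxx /node mulr1 xi.
  have e := mesh_mul R N; rewrite -natr1 mulrDl mul1r in e.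
  have -> : -1 + N%:R * h N + h N = 1 by lra.
  by rewrite normr1 ltW.
apply/eqP; rewrite eqn_leq ltn_ord/= leqNgt; apply/negP => xi; apply: nP.
have lt j : (x ord0 j + (i == j) < N)%N.
  by case: eqP => [<-|_]; rewrite ?addn1// addn0 ltn_ord.
apply/existsP; exists (\row_j Ordinal (lt j)); apply/forallP => j.
by rewrite mxE.
Qed.

(** Every grid point is the shift of another one, except in the first layer, where |y_i| = 1 - h >=
    r and [w0] vanishes. *)
Lemma shifted_mass N i : h N <= 1 - r -> (0 < N)%N ->
  \sum_(x : X N) w0 (gridpt R x) ^+ 2 <= \sum_(x : X N) w0 (gridpt R x + h N *: ebasis R i) ^+ 2.
Proof.
move=> hr N0.
have -> : \sum_(x : X N) w0 (gridpt R x + h N *: ebasis R i) ^+ 2 =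
  \sum_(x : X N) \sum_y (succ_rel i x y)%:R * w0 (gridpt R y) ^+ 2.
  by apply: eq_bigr => x _; rewrite (@shifted_value N i x (fun s => s ^+ 2))// expr0n.
rewrite exchange_big/=; apply: ler_sum => y _; rewrite -mulr_suml.
have [yi|yi] := posnP (y ord0 i).
  rewrite (@w0_coord _ i) ?expr0n/= ?mulr0// !mxE /node yi mul1r.
  have h1 : h N <= 1.
    by rewrite /mesh ler_pdivrMr// mul1r ler_nat.
  by rewrite ler0_norm; lra.
have lt j : (y ord0 j - (i == j) < N)%N by apply: leq_ltn_trans (leq_subr _ _) _.
pose x : X N := \row_j Ordinal (lt j).
have xy : succ_rel i x y.
  apply/forallP => j; rewrite mxE/= subnK//.
  by case: eqP => [<-|].
rewrite ler_peMl ?sqr_ge0// (bigD1 x)//= xy lerDl sumr_ge0//.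
Qed.

(** Summation by parts with forward differences. Expanding the squares, both sides involve the same
    correlations [a i], and [shifted_mass] compares the remaining squares. *)
Lemma grid_dirichlet N tau : h N <= 1 - r -> (0 < N)%N ->
  tau = h N ^+ 2 / (2 * n%:R) ->
  (2 * tau)^-1 * (\sum_(x : X N) w0 (gridpt R x) *
      (w0 (gridpt R x) - avg (@walk R n N) (fun x => w0 (gridpt R x)) x))
  <= \sum_(x : X N) 2^-1 * \sum_i ((w0 (gridpt R x + h N *: ebasis R i) - w0 (gridpt R x)) / h N) ^+ 2.
Proof.
move=> hr N0 tauE.
have n0' : n%:R != 0 :> R by rewrite pnatr_eq0 -lt0n.
have hN := mesh_gt0 R N.
pose W (x : X N) := w0 (gridpt R x).
pose D i (x : X N) := w0 (gridpt R x + h N *: ebasis R i).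
have DE i x : \sum_y (succ_rel i x y)%:R * W y = D i x by rewrite (@shifted_value N i x id).
pose a i := \sum_x W x * D i x.
have aE i : \sum_x W x * (\sum_y (succ_rel i y x)%:R * W y) = a i.
  rewrite /a; under eq_bigr do rewrite mulr_sumr.
  rewrite exchange_big/=; apply: eq_bigr => x _; rewrite -DE mulr_sumr.
  by apply: eq_bigr => y _; ring.
have e1 : \sum_x W x * avg (@walk R n N) W x = (2 * n%:R)^-1 * \sum_i (a i + a i).
  under eq_bigr do rewrite walkE mulrCA mulr_sumr.
  rewrite -mulr_sumr exchange_big/=; congr (_ * _); apply: eq_bigr => i _.
  rewrite -[Y in _ = _ + Y]aE /a -big_split; apply: eq_bigr => x _ /=.
  by rewrite DE mulrDr.
have e2 : (2 * tau)^-1 * (\sum_x W x * (W x - avg (@walk R n N) W x)) =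
   (h N ^+ 2)^-1 * \sum_i (\sum_x W x ^+ 2 - a i).
  under eq_bigr do rewrite mulrBr -expr2.
  rewrite sumrB e1 sumrB sumr_const card_ord big_split/= -[_ *+ n]mulr_natl tauE.
  by field; rewrite n0' gt_eqF.
rewrite -/W e2.
have -> : \sum_(x : X N) 2^-1 * \sum_i ((D i x - W x) / h N) ^+ 2 =
    \sum_i 2^-1 * \sum_(x : X N) ((D i x - W x) / h N) ^+ 2.
  by rewrite -!mulr_sumr exchange_big.
rewrite mulr_sumr; apply: ler_sum => i _.
have e3 : \sum_(x : X N) ((D i x - W x) / h N) ^+ 2 =
    (h N ^+ 2)^-1 * (\sum_x D i x ^+ 2 - 2 * a i + \sum_x W x ^+ 2).
  rewrite /a !mulr_sumr -sumrN -!big_split mulr_sumr; apply: eq_bigr => x _ /=.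
  by field; rewrite gt_eqF.
rewrite e3 mulrCA ler_pM2l ?invr_gt0 ?exprn_gt0//.
have : \sum_x W x ^+ 2 <= \sum_x D i x ^+ 2 := shifted_mass i hr N0.
by lra.
Qed.

Lemma supp_unif_cont (f : 'rV[R]_n -> R) : continuous f ->
  (forall (x : 'rV[R]_n) i, 1 <= `|x ord0 i| -> f x = 0) ->
  forall e : R, 0 < e -> exists2 d : R, 0 < d & forall x y : 'rV[R]_n,
    (forall i, `|x ord0 i - y ord0 i| <= d) -> `|f x - f y| <= e.
Proof.
move=> cf f0 e e0.
have [d d0 hd] := compact_unif_cont (@compact_norm_le R n 1) (fun x _ => cf x) e0.
exists d => // x y xy.
have xyd : `|x - y| <= d.
  by rewrite rV_norm_le ?ltW//; apply/forallP => i; rewrite !mxE.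
have out (z : 'rV[R]_n) : 1 < `|z| -> f z = 0.
  rewrite ltNge rV_norm_le// => /forallPn[i]; rewrite -ltNge => /ltW; exact: f0.
have [x1|/out x1] := leP `|x| 1; first exact: hd.
have [y1|/out y1] := leP `|y| 1; first by rewrite distrC; apply: hd => //; rewrite distrC.
by rewrite x1 y1 subrr normr0 ltW.
Qed.

Lemma partial_supp i y : r < enorm y -> partial i w0 y = 0.
Proof.
move=> ry; rewrite /partial (_ : 'D_(ebasis R i) w0 y = 'D_(ebasis R i) (cst 0) y).
  by rewrite derive_cst.
apply: near_eq_derive.
have cq : {for y, continuous (@enorm R n)}.
  apply: (@cvg_comp _ _ _ (@enorm_sq R n) Num.sqrt); first exact: enorm_sq_continuous.
  exact: sqrt_continuous.
have : \forall z \near y, r < enorm z by apply: (cvgr_gt _ cq).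
by apply: filterS => z /ltW rz; exact: w0_supp.
Qed.

(** The integrand without the indicator of the ball, which is continuous and has the same integral
    because [w0] is supported in radius r < 1. *)
Definition energy_density (x : 'rV[R]_n) : R := 2^-1 * grad_sq w0 x - p^-1 * (`|w0 x| `^ p).

Lemma energy_density_supp (x : 'rV[R]_n) i : 1 <= `|x ord0 i| -> energy_density x = 0.
Proof.
move=> xi; have rx : r < enorm x.
  by apply: lt_le_trans r1 (le_trans xi (coord_le_enorm _ _)).
rewrite /energy_density w0_supp ?ltW// normr0 powR0 ?gt_eqF// mulr0 subr0.
rewrite /grad_sq big1 ?mulr0// => j _; rewrite partial_supp// expr0n//.
Qed.

Lemma energy_density_continuous : continuous energy_density.
Proof.
move=> x.
have c1 : grad_sq w0 y @[y --> x] --> grad_sq w0 x by exact: grad_sq_continuous.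
suff c2 : `|w0 y| `^ p @[y --> x] --> `|w0 x| `^ p.
  exact: (cvgB (cvgMl_tmp c1) (cvgMl_tmp c2)).
apply: (@cvg_comp _ _ _ w0 (fun s => `|s| `^ p)); first exact: smooth_continuous.
have p0 : 0 < p by exact: lt_trans p2.
have [e|ne] := eqVneq (w0 x) 0; last first.
  apply: (@cvg_comp _ _ _ (fun s : R => `|s|) (fun s => s `^ p) _ (nbhs `|w0 x|)); first exact: norm_continuous.
  have := @is_derive1_powR R p `|w0 x|; rewrite normr_gt0 => /(_ ne).
  exact: is_derive_continuous.
rewrite e normr0 powR0 ?gt_eqF//; apply/cvgrPdist_le => eps eps0.
apply/nbhs_ballP; exists (eps `^ p^-1) => /=; first by rewrite powR_gt0.
move=> s; rewrite -ball_normE/= !sub0r !normrN => h.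
rewrite ger0_norm ?powR_ge0//.
rewrite -[leRHS](@powRr1 _ eps) ?(ltW eps0)// -(@mulVf _ p) ?gt_eqF// powRrM.
by apply: ge0_ler_powR => //; rewrite ?nnegrE ?powR_ge0// ltW.
Qed.

Lemma energyE : energy p (eball0 1) w0 = iter_integral energy_density.
Proof.
congr iter_integral; apply/funext => x; rewrite -/(energy_density x).
have [x1|x1] := ltP (enorm x) 1.
  by rewrite indicE mem_set// mul1r.
rewrite indicE memNset ?mul0r; last by rewrite /eball0/=; apply/negP; rewrite -leNgt.
have rx : r < enorm x by exact: lt_le_trans r1 x1.
rewrite /energy_density w0_supp ?ltW// normr0 powR0 ?gt_eqF// mulr0 subr0.
by rewrite /grad_sq big1 ?mulr0// => j _; rewrite partial_supp// expr0n.
Qed.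

Lemma mesh_small (d : R) : 0 < d -> exists N0, forall N, (N0 <= N)%N -> h N <= d.
Proof.
move=> d0; exists (Num.truncn (2 / d)) => N N0N.
have td : 0 <= 2 / d by rewrite divr_ge0// ltW.
have /andP[_ hN] := truncn_itv td.
rewrite /mesh ler_pdivrMr// mulrC -ler_pdivrMr//.
by apply: le_trans (ltW hN) _; rewrite ler_nat.
Qed.

Lemma grid_energy : energy p (eball0 1) w0 < 0 -> exists2 e, 0 < e &
  exists N0, forall N, (N0 <= N)%N -> forall tau, tau = h N ^+ 2 / (2 * n%:R) ->
    scheme_energy (@walk R n N) tau p (fun x => w0 (gridpt R x)) <= - e * #|{: X N}|%:R.
Proof.
rewrite energyE; set I := iter_integral _ => I0.
have n0' : 0 < n%:R :> R by rewrite ltr0n.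
(* The Riemann error [om] costs half of |I|. As h^n N^n <= 2^n, the sampled density then sums to at
   most -2e per grid point, and replacing derivatives by difference quotients ([ep]) gives back
   e. *)
pose e := - I / 2 ^+ n.+2.
have p2n (k : nat) : 0 < 2 ^+ k :> R by rewrite exprn_gt0.
have e0 : 0 < e by rewrite divr_gt0// oppr_gt0.
exists e => //.
pose om := - I / (2 * (n%:R * 2 ^+ n)).
have om0 : 0 < om by rewrite divr_gt0 ?oppr_gt0// !mulr_gt0.
have [d d0 hd] := supp_unif_cont energy_density_continuous energy_density_supp om0.
have cg i : continuous (fun x => partial i w0 x ^+ 2).
  move=> x; apply: (@cvg_comp _ _ _ (partial i w0) (fun y => y ^+ 2));
    [exact: smooth_partial_continuous|exact: exprn_continuous].
have sg i (x : 'rV[R]_n) j : 1 <= `|x ord0 j| -> partial i w0 x ^+ 2 = 0.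
  by move=> xi; rewrite partial_supp ?expr0n// (lt_le_trans r1)// (le_trans xi)// coord_le_enorm.
pose ep := 2 * e / n%:R.
have ep0 : 0 < ep by rewrite divr_gt0// mulr_gt0.
have [d' d'0 hd'] : exists2 d', 0 < d' & forall i (x y : 'rV[R]_n),
    (forall j, `|x ord0 j - y ord0 j| <= d') -> `|partial i w0 x ^+ 2 - partial i w0 y ^+ 2| <= ep.
  have := @uniform_family R 'I_n (fun i d' => forall x y : 'rV[R]_n,
    (forall j, `|x ord0 j - y ord0 j| <= d') -> `|partial i w0 x ^+ 2 - partial i w0 y ^+ 2| <= ep).
  apply=> [i|i c c' cc hc x y xy]; first exact: supp_unif_cont (cg i) (@sg i) ep ep0.
  by apply: hc => j; apply: le_trans (xy j) cc.
have r10 : 0 < 1 - r by rewrite subr_gt0.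
have [N1 hN1] := mesh_small d0; have [N2 hN2] := mesh_small d'0.
have [N3 hN3] := mesh_small r10.
exists (maxn (maxn N1 N2) (maxn N3 1)) => N.
rewrite !geq_max => /andP[/andP[NN1 NN2] /andP[NN3 N0]] tau tauE.
have hNd : h N <= d by exact: hN1.
have hNd' : h N <= d' by exact: hN2.
have hNr : h N <= 1 - r by exact: hN3.
have h0 := mesh_gt0 R N.
have D := grid_dirichlet hNr N0 tauE.
rewrite /scheme_energy; apply: le_trans (lerB D (lexx _)) _.
have Q (x : X N) i : ((w0 (gridpt R x + h N *: ebasis R i) - w0 (gridpt R x)) / h N) ^+ 2 <=
    partial i w0 (gridpt R x) ^+ 2 + ep.
  have [z z0|z /andP[z1 z2] ->] := @MVT_partial R n w0 (gridpt R x) (ebasis R i) (h N) h0.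
    by have [_ +] := w0_smooth [::]; apply.
  rewrite mulfK ?gt_eqF// -lerBlDl.
  apply: le_trans (ler_norm _) _; apply: hd' => j.
  rewrite !mxE [Y in `|Y|](_ : _ = z * (i == j)%:R); last by ring.
  rewrite ger0_norm; last by rewrite mulr_ge0// ltW.
  by case: (i == j); rewrite ?mulr1 ?mulr0 ?(le_trans (ltW z2))// ltW.
have S1 : \sum_(x : X N) 2^-1 * \sum_i ((w0 (gridpt R x + h N *: ebasis R i) - w0 (gridpt R x)) / h N) ^+ 2
    - (\sum_(x : X N) w0 (gridpt R x) `^ p) / p <=
   \sum_(x : X N) energy_density (gridpt R x) + e * #|{: X N}|%:R.
  rewrite mulr_suml -sumrB.
  have -> : e * #|{: X N}|%:R = \sum_(x : X N) e by rewrite sumr_const mulr_natr.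
  rewrite -big_split; apply: ler_sum => x _ /=.
  rewrite /energy_density ger0_norm// (mulrC p^-1) addrAC lerD2r.
  have : \sum_i ((w0 (gridpt R x + h N *: ebasis R i) - w0 (gridpt R x)) / h N) ^+ 2 <=
      grad_sq w0 (gridpt R x) + n%:R * ep.
    rewrite /grad_sq.
    have -> : n%:R * ep = \sum_(i < n) ep by rewrite sumr_const card_ord mulr_natl.
    by rewrite -big_split; apply: ler_sum => i _; exact: Q.
  have -> : n%:R * ep = 2 * e by rewrite /ep; field; rewrite gt_eqF.
  by lra.
apply: le_trans S1 _.
have Rm : `|I - h N ^+ n * \sum_(x : X N) energy_density (gridpt R x)| <= n%:R * 2 ^+ n * om.
  apply: riemann_nd.
  - exact: supp_unif_cont energy_density_continuous energy_density_supp.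
  - by move=> x [i]; exact: energy_density_supp.
  - exact: ltW.
  - by move=> x y xy; apply: hd => i; apply: le_trans (xy i) hNd.
have omE : n%:R * 2 ^+ n * om = - I / 2 by rewrite /om; field; rewrite !gt_eqF.
rewrite omE in Rm.
set S := \sum_(x : X N) energy_density (gridpt R x) in Rm *.
have hS : h N ^+ n * S <= I / 2.
  by move: Rm; rewrite ler_norml => /andP[+ _]; lra.
have hn0 : 0 < h N ^+ n by rewrite exprn_gt0.
have cardX : #|{: X N}|%:R = N%:R ^+ n :> R by rewrite card_mx card_ord mul1n natrX.
have hNn : h N ^+ n * N%:R ^+ n <= 2 ^+ n.
  rewrite -exprMn; apply: lerXn2r; rewrite ?nnegrE ?mulr_ge0 ?(ltW h0)//.
  by rewrite -(mesh_mul R N) mulrC ler_pM2r// ler_nat.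
rewrite cardX.
have : S <= - (2 * e) * N%:R ^+ n.
  rewrite -(ler_pM2l hn0); apply: le_trans hS _.
  rewrite mulrCA.
  have : - (2 * e) * 2 ^+ n <= - (2 * e) * (h N ^+ n * N%:R ^+ n).
    by rewrite ler_nM2l// oppr_lt0 mulr_gt0.
  have -> : - (2 * e) * 2 ^+ n = I / 2 by rewrite /e !exprS; field; rewrite gt_eqF.
  by [].
by lra.
Qed.

End GridEnergy.

(** * Comparison with the scheme *)

Section Consistency.
Variables (R : realType) (n : nat).
Implicit Types (x y : 'rV[R]_n) (Om : set 'rV[R]_n).

Lemma norm_pair_le (x y : 'rV[R]_n) (s t d : R) : `|x - y| <= d -> `|s - t| <= d ->
  `|(x, s) - (y, t) : 'rV[R]_n * R| <= d.
Proof. by move=> h1 h2; rewrite prod_normE/= ge_max h1. Qed.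

(** With sig = h^2/(2n), the average over neighbours minus the value is [sig] times the discrete
    Laplacian. Half of [eta] absorbs the oscillation of the time derivative and eta/(2n) that of
    each second derivative; starting at s0 > 0 keeps them on a compact set of continuity. *)
Lemma consistency Om p k (u0 : 'rV[R]_n -> R) u (rad s0 s1 eta : R) :
  (0 < n)%N -> approx_solution Om p k u0 u -> 0 < s0 -> (forall x, `|x| <= rad -> Om x) -> 0 < eta ->
  exists2 d, 0 < d & forall x s h sig, 0 < h -> h <= d -> sig = h ^+ 2 / (2 * n%:R) -> sig <= d ->
    `|x| + h <= rad -> s0 <= s -> s + sig <= s1 ->
    (2 * n%:R)^-1 * \sum_i (u (x + h *: ebasis R i) s + u (x - h *: ebasis R i) s)
      + sig * (trunc_nl p k (u x s) - eta) <= u x (s + sig).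
Proof.
move=> n0 [du [_ [cdt [_ [cdd [eq _]]]]]] s00 radO eta0.
pose C := [set x : 'rV[R]_n | `|x| <= rad] `*` `[s0, s1]%classic.
have cC : compact C by apply: compact_setX; [exact: compact_norm_le|exact: segment_compact].
have CQ z : C z -> z \in [set z : 'rV[R]_n * R | Om z.1 /\ 0 < z.2].
  move=> [z1]; rewrite /= in_itv/= => /andP[z2 _]; apply/mem_set; split; first exact: radO.
  exact: lt_le_trans z2.
have n0' : 0 < n%:R :> R by rewrite ltr0n.
have ep0 : 0 < eta / (2 * n%:R) by rewrite divr_gt0// mulr_gt0.
have eta20 : 0 < eta / 2 by rewrite divr_gt0.
have [d1 d10 h1] := compact_unif_cont cC (fun z Cz => cdt z (CQ z Cz)) eta20.
have [d2 d20 h2] : exists2 d : R, 0 < d & forall i z z', C z -> `|z - z'| <= d ->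
    `|uncurry_fun (dx i (dx i u)) z - uncurry_fun (dx i (dx i u)) z'| <= eta / (2 * n%:R).
  have := @uniform_family R 'I_n (fun i d => forall z z', C z -> `|z - z'| <= d ->
    `|uncurry_fun (dx i (dx i u)) z - uncurry_fun (dx i (dx i u)) z'| <= eta / (2 * n%:R)).
  move=> [i|i d d' dd' hd z z' Cz zz'|d d0 hd]; last by exists d.
    have [d d0 hd] := compact_unif_cont cC (fun z Cz => cdd i i z (CQ z Cz)) ep0.
    by exists d.
  by apply: hd => //; exact: le_trans dd'.
exists (Num.min d1 d2); first by rewrite lt_min d10.
move=> x s h sig h0; rewrite le_min => /andP[hd1 hd2] sigE.
rewrite le_min => /andP[sd1 sd2] xh s0s ss1.
have sig0 : 0 < sig by rewrite sigE divr_gt0 ?exprn_gt0// mulr_gt0.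
have sC : 0 < s by exact: lt_le_trans s0s.
have inC y s' : `|y| <= rad -> s0 <= s' <= s1 -> C (y, s') by move=> *; split; rewrite //= in_itv.
have xrad : `|x| <= rad by lra.
have Ox := radO _ xrad.
have sI : s0 <= s <= s1 by rewrite s0s; lra.
have [s' /andP[s'1 s'2] Et] : exists2 s', s < s' < s + sig & u x (s + sig) - u x s = dt u x s' * sig.
  have ss : s < s + sig by rewrite ltrDl.
  have [s'|s' h' E] := @MVT_derive R (u x) (dt u x) s (s + sig) ss.
    move=> /andP[a b]; apply: derivableP; apply: (proj1 (du _ _ Ox _)).
    exact: lt_le_trans a.
  by exists s' => //; rewrite E; congr (_ * _); ring.
have ht : dt u x s - eta / 2 <= dt u x s'.
  have /= := h1 (x, s) (x, s') (inC _ _ xrad sI).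
  rewrite ler_norml => h'; have /h'/andP[_] : `|(x, s) - (x, s') : 'rV[R]_n * R| <= d1.
    apply: norm_pair_le; first by rewrite subrr normr0 ltW.
    by rewrite ler0_norm; lra.
  by rewrite /uncurry_fun/=; lra.
have hx i : u (x + h *: ebasis R i) s + u (x - h *: ebasis R i) s - 2 * u x s <=
    h ^+ 2 * (dx i (dx i u) x s + eta / (2 * n%:R)).
  have zrad z : `|z| <= h -> `|x + z *: ebasis R i| <= rad.
    move=> zh; apply: le_trans (ler_normD _ _) _; apply: le_trans xh.
    by rewrite lerD2l (le_trans (norm_ebasis_le _ _)).
  have dO z : `|z| <= h -> _ := fun zh => proj2 (du _ _ (radO _ (zrad z zh)) sC) i i.
  have [z zh|z zh|z zh ->] := @second_difference_partial R n (fun y => u y s) x (ebasis R i) h h0.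
    exact: (proj1 (dO z zh)).
    exact: (proj2 (dO z zh)).
  rewrite ler_pM2l ?exprn_gt0//.
  have := h2 i (x, s) (x + z *: ebasis R i, s) (inC _ _ xrad sI).
  rewrite ler_norml => h'.
  have /h'/andP[+ _] : `|(x, s) - (x + z *: ebasis R i, s) : 'rV[R]_n * R| <= d2.
    apply: norm_pair_le; last by rewrite subrr normr0 ltW.
    rewrite opprD addNKr normrN (le_trans (norm_ebasis_le _ _))// (le_trans zh)//.
  rewrite /uncurry_fun/= lerBrDr addrC -lerBrDr opprK => h3.
  apply: (@le_trans _ _ (dx i (dx i u) (x + z *: ebasis R i) s)); first exact: lexx.
  exact: h3.
have sumx : (2 * n%:R)^-1 * \sum_i (u (x + h *: ebasis R i) s + u (x - h *: ebasis R i) s) - u x s <=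
    sig * (lap u x s + eta / 2).
  have -> : (2 * n%:R)^-1 * \sum_i (u (x + h *: ebasis R i) s + u (x - h *: ebasis R i) s) - u x s =
     (2 * n%:R)^-1 * \sum_i (u (x + h *: ebasis R i) s + u (x - h *: ebasis R i) s - 2 * u x s).
    by rewrite sumrB sumr_const card_ord -[_ *+ n]mulr_natl; field; rewrite gt_eqF.
  have -> : sig * (lap u x s + eta / 2) = (2 * n%:R)^-1 * \sum_i h ^+ 2 * (dx i (dx i u) x s + eta / (2 * n%:R)).
    rewrite -mulr_sumr big_split/= sumr_const card_ord -[_ *+ n]mulr_natl -/(lap u x s) sigE.
    by field; rewrite gt_eqF.
  by rewrite ler_pM2l ?invr_gt0 ?mulr_gt0//; apply: ler_sum => i _; exact: hx.
have e := eq _ _ Ox sC.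
have : sig * (dt u x s - eta / 2) <= sig * dt u x s' by rewrite ler_pM2l.
have : sig * (dt u x s - lap u x s) = sig * trunc_nl p k (u x s) by rewrite e.
by lra.
Qed.

End Consistency.

(** * Domination of the rescaled scheme *)

Section Comparison.
Variables (R : realType) (n : nat).
Implicit Types (Om : set 'rV[R]_n).

Lemma gridpt_norm N (x : 'rV['I_N]_n) : `|gridpt R x| <= 1.
Proof.
rewrite rV_norm_le//; apply/forallP => i; rewrite mxE /node.
have h0 := mesh_gt0 R N.
have : (x ord0 i).+1%:R * mesh R N <= N.+1%:R * mesh R N.
  by rewrite ler_pM2r// ler_nat ltnS ltnW.
have : 0 <= (x ord0 i).+1%:R * mesh R N by rewrite mulr_ge0// ltW.
by rewrite mesh_mul ler_norml => h1 h2; apply/andP; split; lra.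
Qed.

(** For w <= a k the truncation is invisible: if w <= a s both arguments of the minimum dominate
    w^(p-1), otherwise a s < w <= a k and the Lipschitz bound on [0, a k] costs [err]. *)
Lemma trunc_scaled (p a lam w s err : R) (k : nat) : 2 < p -> 0 < a -> 0 <= s ->
  a * lam ^+ 2 = a `^ (p - 1) -> 0 <= w -> w <= a * k%:R -> 0 <= err -> w <= a * s + err ->
  w `^ (p - 1) <= a * lam ^+ 2 * trunc_nl p k s + (p - 1) * (a * k%:R) `^ (p - 2) * err.
Proof.
move=> p2 a0 s0 al w0 wk err0 ws.
have L0 : 0 <= (p - 1) * (a * k%:R) `^ (p - 2) by rewrite mulr_ge0 ?powR_ge0//; lra.
have p1 : 0 <= p - 1 by lra.
have mono x y : 0 <= x -> x <= y -> x `^ (p - 1) <= y `^ (p - 1).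
  by move=> x0 xy; apply: ge0_ler_powR => //; rewrite nnegrE// (le_trans x0).
rewrite al /trunc_nl (max_idPl s0).
have min_powR : a `^ (p - 1) * Num.min (s `^ (p - 1)) (k%:R `^ (p - 1)) =
    Num.min ((a * s) `^ (p - 1)) ((a * k%:R) `^ (p - 1)).
  by rewrite !powRM ?(ltW a0)// minr_pMr// powR_ge0.
rewrite min_powR.
have as0 : 0 <= a * s by rewrite mulr_ge0// ltW.
have [was|asw] := leP w (a * s).
  apply: (@le_trans _ _ (Num.min ((a * s) `^ (p - 1)) ((a * k%:R) `^ (p - 1)))).
    by rewrite le_min !mono.
  by rewrite lerDl mulr_ge0.
rewrite (min_idPl _); last by apply: mono => //; apply: le_trans wk; exact: ltW.
have := powR_lipschitz p2 as0 (ltW asw) wk.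
have : (p - 1) * (a * k%:R) `^ (p - 2) * (w - a * s) <= (p - 1) * (a * k%:R) `^ (p - 2) * err.
  by rewrite ler_wpM2l// lerBlDl.
lra.
Qed.

(* The bound holds for all translates by [e] at once: where the scheme exceeds
   the truncation level, the solution is large on a whole ball of radius [r0]
   independent of [k]. *)
Lemma comparison Om p k (u0 : 'rV[R]_n -> R) u (w0 : 'rV[R]_n -> R) (lam a rad s0 r0 T : R) :
  (0 < n)%N -> 2 < p -> approx_solution Om p k u0 u ->
  (forall x t, Om x -> 0 < t -> 0 <= u x t) ->
  0 < lam -> 0 < a -> a * lam ^+ 2 = a `^ (p - 1) -> (0 < k)%N ->
  0 < s0 -> (forall x, `|x| <= rad -> Om x) -> 2 * lam + r0 <= rad -> 0 < T ->
  (forall y, 0 <= w0 y) ->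
  (forall y e, `|y| <= 1 -> `|e| <= r0 -> w0 y <= a * u (lam *: y + e) s0) ->
  exists N1, forall N, (N1 <= N)%N -> forall tau, tau = mesh R N ^+ 2 / (2 * n%:R) ->
    forall j, j%:R * tau <= T ->
    let W i := iter i (scheme_step (@walk R n N) tau p) (fun x => w0 (gridpt R x)) in
    (forall i x, (i < j)%N -> W i x <= a * k%:R) ->
    forall x e, `|e| <= r0 ->
      W j x <= a * u (lam *: gridpt R x + e) (s0 + j%:R * (lam ^+ 2 * tau)) + a * k%:R / 2.
Proof.
move=> n0 p2 asol u_ge0 lam0 a0 al k0 s00 radO rad_ge T0 w00 w0u.
have n0' : 0 < n%:R :> R by rewrite ltr0n.
pose L := (p - 1) * (a * k%:R) `^ (p - 2).
have L0 : 0 <= L by rewrite mulr_ge0 ?powR_ge0//; lra.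
have ak0 : 0 < a * k%:R by rewrite mulr_gt0// ltr0n.
have al0 : 0 < a * lam ^+ 2 by rewrite mulr_gt0// exprn_gt0.
(* A discrete Gronwall budget: the error grows by the factor 1 + tau (L + 1) per step, hence by at
   most exp(T (L + 1)) in total, and must end below a k / 2. *)
pose eta' := a * k%:R / 2 * expR (- (T * (L + 1))).
have eta'0 : 0 < eta' by rewrite mulr_gt0 ?expR_gt0// divr_gt0.
pose eta := eta' / (a * lam ^+ 2).
have eta0 : 0 < eta by rewrite divr_gt0.
have [d d0 hd] := consistency (s0 + lam ^+ 2 * T) n0 asol s00 radO eta0.
have dm0 : 0 < Num.min 1 (Num.min (d / lam) (d / lam ^+ 2)).
  by rewrite !lt_min ltr01 !divr_gt0// exprn_gt0.
have [N1 hN1] := mesh_small dm0.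
exists N1 => N /hN1; rewrite !le_min => /and3P[m1 m2 m3] tau tauE j jT W HW x e er.
have m0 := mesh_gt0 R N.
have tau0 : 0 < tau by rewrite tauE divr_gt0 ?exprn_gt0// mulr_gt0.
have n1 : 1 <= n%:R :> R by rewrite ler1n.
have taum : tau <= mesh R N.
  rewrite tauE ler_pdivrMr ?mulr_gt0// expr2 ler_pM2l//.
  by apply: (le_trans m1); lra.
have lm : lam * mesh R N <= d by rewrite mulrC -ler_pdivlMr.
have l2m : lam ^+ 2 * tau <= d.
  apply: (@le_trans _ _ (lam ^+ 2 * mesh R N)); first by rewrite ler_pM2l// exprn_gt0.
  by rewrite mulrC -ler_pdivlMr// exprn_gt0.
have W0 i y : 0 <= W i y.
  elim: i y => [|i IH] y; first exact: w00.
  by apply: scheme_step_ge0 => //; exact: walk_ge0.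
pose err i := (1 + tau * (L + 1)) ^+ i * eta'.
have q1 : 1 <= 1 + tau * (L + 1) by rewrite lerDl mulr_ge0 ?(ltW tau0)//; lra.
have err_ge i : eta' <= err i by rewrite ler_peMl ?(ltW eta'0)// exprn_ege1.
pose U i (y : 'rV['I_N]_n) := a * u (lam *: gridpt R y + e) (s0 + i%:R * (lam ^+ 2 * tau)).
have ptn (y : 'rV['I_N]_n) : `|lam *: gridpt R y + e| <= lam + r0.
  apply: le_trans (ler_normD _ _) _; apply: lerD => //.
  by rewrite normrZ gtr0_norm// ler_piMr ?(ltW lam0)// gridpt_norm.
have tpos i : 0 < s0 + i%:R * (lam ^+ 2 * tau).
  by rewrite ltr_pwDl// !mulr_ge0 ?exprn_ge0// ltW.
have shiftO (y : 'rV['I_N]_n) i (z : R) : `|z| <= lam -> Om (lam *: gridpt R y + e + z *: ebasis R i).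
  move=> zl; apply: radO; apply: le_trans (ler_normD _ _) _.
  have h := lerD (ptn y) (le_trans (norm_ebasis_le i z) zl).
  by apply: le_trans h _; lra.
have lmn : `|lam * mesh R N| <= lam by rewrite gtr0_norm ?mulr_gt0// ler_piMr// ltW.
have main i : (i <= j)%N -> forall y, W i y <= U i y + err i.
  elim: i => [|i IH] ij y.
    rewrite /U /W/= mul0r addr0; apply: (le_trans (w0u _ _ (gridpt_norm y) er)).
    by rewrite lerDl (le_trans (ltW eta'0)).
  have IHi := IH (ltnW ij).
  pose t := s0 + i%:R * (lam ^+ 2 * tau).
  pose Z := lam *: gridpt R y + e.
  have OZ : Om Z by apply: radO; apply: le_trans (ptn y) _; lra.
  have hstep : (2 * n%:R)^-1 * \sum_c (u (Z + (lam * mesh R N) *: ebasis R c) t + u (Z - (lam * mesh R N) *: ebasis R c) t)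
     + lam ^+ 2 * tau * (trunc_nl p k (u Z t) - eta) <= u Z (t + lam ^+ 2 * tau).
    apply: hd => //.
    - by rewrite mulr_gt0.
    - by rewrite tauE; ring.
    - have lm1 : lam * mesh R N <= lam by rewrite ler_piMr// ltW.
      have h := lerD (ptn y) lm1.
      by apply: le_trans h _; lra.
    - by rewrite /t lerDl !mulr_ge0 ?exprn_ge0// ltW.
    - have -> : t + lam ^+ 2 * tau = s0 + lam ^+ 2 * (i.+1%:R * tau) by rewrite /t -natr1; ring.
      rewrite lerD2l ler_pM2l ?exprn_gt0//; apply: le_trans jT.
      by rewrite ler_pM2r// ler_nat.
  have tE : s0 + i.+1%:R * (lam ^+ 2 * tau) = t + lam ^+ 2 * tau by rewrite /t -natr1; ring.
  have neg (c : 'I_n) : Z - (lam * mesh R N) *: ebasis R c = Z + (- (lam * mesh R N)) *: ebasis R c.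
    by rewrite scaleNr.
  (* Killing at the walls only lowers the average, because [u] is nonnegative at the missing
     neighbours; the error passes through since the rows sum to at most 1. *)
  have avgU : avg (@walk R n N) (W i) y <=
     a * ((2 * n%:R)^-1 * \sum_c (u (Z + (lam * mesh R N) *: ebasis R c) t + u (Z - (lam * mesh R N) *: ebasis R c) t)) + err i.
    have h1 : avg (@walk R n N) (W i) y <= avg (@walk R n N) (U i) y + err i.
      have -> : avg (@walk R n N) (U i) y + err i = avg (@walk R n N) (U i) y + 1 * err i by rewrite mul1r.
      apply: (@le_trans _ _ (avg (@walk R n N) (U i) y + (\sum_z walk R y z) * err i)); last first.
        by rewrite lerD2l ler_wpM2r ?walk_sub// (le_trans (ltW eta'0)).
      rewrite /avg mulr_suml -big_split; apply: ler_sum => z _ /=.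
      by rewrite -mulrDr ler_wpM2l ?walk_ge0.
    apply: le_trans h1 _; rewrite lerD2r.
    pose V c := a * u (Z + (lam * mesh R N) *: ebasis R c) t.
    pose V' c := a * u (Z - (lam * mesh R N) *: ebasis R c) t.
    have -> : a * ((2 * n%:R)^-1 * \sum_c (u (Z + (lam * mesh R N) *: ebasis R c) t + u (Z - (lam * mesh R N) *: ebasis R c) t))
      = (2 * n%:R)^-1 * \sum_c (V c + V' c).
      by rewrite mulrCA mulr_sumr; congr (_ * _); apply: eq_bigr => c _; rewrite mulrDr.
    apply: walk_avg_le.
    - by move=> c; rewrite mulr_ge0 ?(ltW a0)// u_ge0//; [exact: shiftO|exact: tpos].
    - move=> c; rewrite mulr_ge0 ?(ltW a0)// u_ge0//; last exact: tpos.
      by rewrite neg; apply: shiftO; rewrite normrN.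
    - move=> c z yz; rewrite /U /V.
      have -> : lam *: gridpt R z + e = Z + (lam * mesh R N) *: ebasis R c.
        by rewrite (gridpt_succ R yz) scalerDr scalerA /Z addrAC.
      exact: lexx.
    - move=> c z zy; rewrite /U /V'.
      have -> : lam *: gridpt R z + e = Z - (lam * mesh R N) *: ebasis R c.
        by rewrite /Z (gridpt_succ R zy) scalerDr scalerA addrAC addrK.
      exact: lexx.
  have pw := trunc_scaled p2 a0 (u_ge0 _ _ OZ (tpos i)) al (W0 i y) (HW i y ij)
    (le_trans (ltW eta'0) (err_ge i)) (IHi y).
  have errS : err i + tau * L * err i + tau * eta' <= err i.+1.
    have errS0 : tau * eta' <= tau * err i by rewrite ler_pM2l.
    by move: errS0; rewrite /err exprS; clear; lra.
  have Uu : U i.+1 y = a * u Z (t + lam ^+ 2 * tau) by rewrite /U tE.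
  rewrite Uu.
  have h1 : a * ((2 * n%:R)^-1 * \sum_c (u (Z + (lam * mesh R N) *: ebasis R c) t + u (Z - (lam * mesh R N) *: ebasis R c) t)
     + lam ^+ 2 * tau * (trunc_nl p k (u Z t) - eta)) <= a * u Z (t + lam ^+ 2 * tau).
    by rewrite ler_pM2l.
  have h2 : tau * W i y `^ (p - 1) <= tau * (a * lam ^+ 2 * trunc_nl p k (u Z t) + L * err i).
    by rewrite ler_pM2l.
  have h3 : a * lam ^+ 2 * tau * eta = tau * eta' by rewrite /eta; field; rewrite !gt_eqF.
  rewrite /W iterS -/(W i) /scheme_step.
  move: avgU h1 h2 h3 errS; set S := (_)^-1 * _; set TR := trunc_nl _ _ _; set UU := u Z _ => g1 g2 g3 g4 g5.
  by move: g1 g2 g3 g4 g5; clear; lra.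
have := main j (leqnn j) x; rewrite /U => h.
apply: le_trans h _; rewrite lerD2l.
rewrite /err /eta' mulrCA -[leRHS]mulr1 ler_pM2l ?divr_gt0//.
have : (1 + tau * (L + 1)) ^+ j <= expR (T * (L + 1)).
  apply: (@le_trans _ _ (expR (tau * (L + 1)) ^+ j)).
    by apply: lerXn2r; rewrite ?nnegrE ?expR_ge0 ?expR_ge1Dx// (le_trans ler01).
  by rewrite -expRM_natl ler_expR mulrA ler_wpM2r// addr_ge0.
by rewrite expRN ler_pdivrMr ?expR_gt0// mul1r.
Qed.

End Comparison.

(** * From the initial trace to a positive time *)

Section Origin.
Variables (R : realType) (n : nat).
Implicit Types (Om : set 'rV[R]_n).

Lemma near_prod_right (x : 'rV[R]_n) (A : set ('rV[R]_n * R)) : nbhs (x, (0 : R)) A ->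
  \forall x' \near x & t \near 0^'+, 0 < t /\ A (x', t).
Proof.
move=> [[B1 B2] /= [nB1 nB2] BA].
exists (B1, B2 `&` [set t | 0 < t]) => /=.
  split; first exact: nB1.
  apply: filterI; last exact: nbhs_right_gt.
  have h : nbhs (0 : R) [set t | 0 < t -> B2 t] by apply: filterS nB2 => t b2 _; exact: b2.
  exact: h.
by move=> [x' t] [/= b1 [b2 t0]]; split => //; apply: BA; split.
Qed.

(** The comparison must start at a positive time, where [u] is regular. Compactness of the cube
    turns the initial trace into a bound at one time s0, which may depend on k; the gap shrinks from
    c to c/4 on the way. *)
Lemma initial_bound Om p k (u0 : 'rV[R]_n -> R) u (f : 'rV[R]_n -> R) (c rad P tmax : R) :
  (3 <= n)%N -> open Om -> approx_solution Om p k u0 u ->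
  (forall x t, Om x -> 0 < t -> 0 <= u x t) ->
  continuous f -> (forall x, 0 <= f x) -> 0 < c -> (forall x, f x + c <= k%:R) -> 0 < P ->
  (forall x, enorm_sq x <= P -> Om x) -> (forall x, enorm_sq x <= P -> x != 0 -> f x + c <= u0 x) ->
  (forall x : 'rV[R]_n, `|x| <= rad -> enorm_sq x <= P) -> 0 < tmax ->
  exists2 s0, 0 < s0 <= tmax & forall x, `|x| <= rad -> f x + c / 4 <= u x s0.
Proof.
move=> n3 oO asol u_ge0 cf f0 c0 fk P0 PO Pu0 radP tm0.
have ssol := approx_supersolution oO asol.
have [_ [_ [_ [_ [_ [_ [_ [ini _]]]]]]]] := asol.
have lower (x : 'rV[R]_n) : enorm_sq x <= P -> x != 0 -> f x + c <= Num.min (u0 x) k%:R.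
  by move=> qx x0; rewrite le_min fk Pu0.
have near_x (x : 'rV[R]_n) : enorm_sq x <= P -> \forall w \near within [set w | Om w.1 /\ 0 < w.2] (nbhs (x, (0 : R))),
    f x + c / 2 < uncurry_fun u w.
  move=> qx; have [->|x0] := eqVneq x 0; last first.
    by apply: (cvgr_gt _ (ini _ (PO _ qx) x0)); apply: lt_le_trans (lower _ qx x0); lra.
  have : \forall x \near (0 : 'rV[R]_n), f 0 - c / 8 < f x.
    by apply: (cvgr_gt _ (cf 0)); lra.
  have cq : {for (0 : 'rV[R]_n), continuous (@enorm_sq R n)} by exact: enorm_sq_continuous.
  move=> nf.
  have [P1 P10 hP1] : exists2 P1, 0 < P1 & forall x : 'rV[R]_n, enorm_sq x <= P1 -> enorm_sq x <= P /\ f 0 - c / 8 < f x.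
    have /nbhs_ballP[d /= d0 hd] := nf.
    have d20 : 0 < d / 2 by rewrite divr_gt0.
    exists (Num.min P ((d / 2) ^+ 2)); first by rewrite lt_min P0 exprn_gt0.
    move=> y; rewrite le_min => /andP[y1 y2]; split => //; apply: hd.
    rewrite -ball_normE/= sub0r normrN (le_lt_trans (norm_le_enorm _))// enormE.
    apply: (@le_lt_trans _ _ (d / 2)); last by rewrite ltr_pdivrMr// ltr_pMr// ltr1n.
    by rewrite -(ger0_norm (ltW d20)) -sqrtr_sqr ler_wsqrtr.
  have m0 : 0 <= f 0 + 3 / 4 * c by rewrite addr_ge0// mulr_ge0// ltW.
  have e0 : 0 < c / 4 by rewrite divr_gt0.
  have := @initial_origin R n Om u P1 (f 0 + 3 / 4 * c) n3 ssol u_ge0 P10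
    (fun x h => PO x (hP1 x h).1) m0 _ (c / 4) e0.
  rewrite (_ : f 0 + 3 / 4 * c - c / 4 = f 0 + c / 2); last by field.
  apply => z e qz z0 ep0; have [h1 h2] := hP1 _ qz.
  by apply: (cvgr_gt _ (ini _ (PO _ h1) z0)); apply: lt_le_trans (lower _ h1 z0); lra.
have /compact_near_coveringP cC := @compact_norm_le R n rad.
have [|d /= d0 hd] := cC R (0^'+) (fun s x => f x + c / 4 <= u x s) _.
  move=> z /= /radP qz.
  have Oz := PO _ qz.
  have h2 : \forall y \near z, Om y by exact: open_nbhs_nbhs.
  have h3 : \forall y \near z, f y < f z + c / 4 by apply: (cvgr_lt _ (cf z)); lra.
  have h4 : nbhs (z, (0 : R)) [set w | (f w.1 < f z + c / 4 /\ Om w.1) /\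
      (Om w.1 /\ 0 < w.2 -> f z + c / 2 < uncurry_fun u w)].
    apply: filterI; last exact: near_x z qz.
    exact: (@cvg_fst _ _ (nbhs z) (nbhs (0 : R)) _ [set y | f y < f z + c / 4 /\ Om y] (filterI h3 h2)).
  apply: filterS (near_prod_right h4) => -[y s] /= [s0 [[y1 Oy] /(_ (conj Oy s0))]].
  by rewrite /uncurry_fun/=; lra.
have dm0 : 0 < Num.min (d / 2) tmax by rewrite lt_min tm0 divr_gt0.
exists (Num.min (d / 2) tmax); first by rewrite dm0 ge_min lexx orbT.
move=> x xr; apply: (hd (Num.min (d / 2) tmax)) => //=.
rewrite sub0r normrN gtr0_norm// gt_min; apply/orP; left.
by rewrite ltr_pdivrMr// ltr_pMr// ltr1n.
Unshelve. all: by end_near. Qed.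

End Origin.

(** * Blow-up at the origin *)

Section OriginBlowup.
Variables (R : realType) (n : nat).
Implicit Types (Om : set 'rV[R]_n).

Lemma enorm_sq_norm_le (x : 'rV[R]_n) (c : R) : `|x| <= c -> enorm_sq x <= n%:R * c ^+ 2.
Proof.
move=> xc; have c0 : 0 <= c by apply: le_trans xc.
rewrite /enorm_sq; apply: (@le_trans _ _ (\sum_(i < n) c ^+ 2)).
  apply: ler_sum => i _; rewrite -[leLHS]real_normK ?num_real//.
  by apply: lerXn2r; rewrite ?nnegrE// (le_trans (coord_le_norm x i)).
by rewrite sumr_const card_ord mulr_natl.
Qed.

Lemma enorm_sq_triangle (x y : 'rV[R]_n) : enorm_sq x <= 2 * enorm_sq (x - y) + 2 * enorm_sq y.
Proof.
rewrite /enorm_sq !mulr_sumr -big_split; apply: ler_sum => i _ /=.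
rewrite !mxE; have := sqr_ge0 (x ord0 i - 2 * y ord0 i); nra.
Qed.

Lemma enorm_sqN (x : 'rV[R]_n) : enorm_sq (- x) = enorm_sq x.
Proof. by apply: eq_bigr => i _; rewrite mxE sqrrN. Qed.

Lemma enorm_sq_lt_norm (x : 'rV[R]_n) (r0 : R) : 0 < r0 -> enorm_sq x < r0 ^+ 2 -> `|x| <= r0.
Proof.
move=> r00 xr; apply: le_trans (norm_le_enorm _) _.
by rewrite enormE -(ger0_norm (ltW r00)) -sqrtr_sqr ler_wsqrtr// ltW.
Qed.

Lemma enormZ (a : R) (x : 'rV[R]_n) : 0 <= a -> enorm (a *: x) = a * enorm x.
Proof.
move=> a0; rewrite !enormE.
have -> : enorm_sq (a *: x) = a ^+ 2 * enorm_sq x.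
  by rewrite /enorm_sq mulr_sumr; apply: eq_bigr => i _; rewrite mxE exprMn.
by rewrite sqrtrM ?sqr_ge0// sqrtr_sqr ger0_norm.
Qed.

Lemma supremum_bound (w0 : 'rV[R]_n -> R) (al : R) : 0 < al -> continuous w0 ->
  (forall y, 0 <= w0 y) ->
  let M := sup [set enorm y `^ al * w0 y | y in [set y | enorm y <= 1]] in
  0 <= M /\ forall y, enorm y <= 1 -> enorm y `^ al * w0 y <= M.
Proof.
move=> al0 cw w00 M.
have [B B0 hB] := compact_upper_bound (@compact_norm_le R n 1) cw.
have ub y : enorm y <= 1 -> enorm y `^ al * w0 y <= M.
  move=> y1; apply: sup_upper_bound; last by exists y.
  split; first by exists (enorm y `^ al * w0 y); exists y.
  exists B => _ [z z1 <-].
  have zB : w0 z <= B by apply: hB; apply: le_trans (norm_le_enorm z) z1.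
  have : enorm z `^ al <= 1.
    have one : (1 : R) `^ al = 1 by rewrite powR1.
    rewrite -[leRHS]one; apply: ge0_ler_powR; rewrite ?nnegrE ?(ltW al0)//.
    exact: sqrtr_ge0.
  move=> h; apply: le_trans zB; rewrite ler_piMl//.
split => //.
have e0 : enorm (0 : 'rV[R]_n) = 0 by rewrite enormE enorm_sq0 sqrtr0.
have := ub 0; rewrite e0 => /(_ ler01).
by rewrite powR0 ?gt_eqF// mul0r.
Qed.

Lemma origin_blowup Om (p : R) (w0 : 'rV[R]_n -> R) (u0 : 'rV[R]_n -> R)
    (u : nat -> 'rV[R]_n -> R -> R) :
  (3 <= n)%N -> open Om -> Om 0 -> 2 < p ->
  let alpha := 2 / (p - 2) in
  smooth w0 -> (forall y, 0 <= w0 y) ->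
  (exists r : R, r < 1 /\ forall y, r <= enorm y -> w0 y = 0) ->
  energy p (eball0 1) w0 < 0 ->
  let M := sup [set enorm y `^ alpha * w0 y | y in [set y | enorm y <= 1]] in
  (exists c : R, 0 < c /\ exists delta : R, 0 < delta /\
     forall x, Om x -> 0 < enorm x < delta -> c < u0 x - M * enorm x `^ (- alpha)) ->
  (forall k, approx_solution Om p k u0 (u k)) ->
  (forall k x t, Om x -> 0 < t -> 0 <= u k x t) ->
  exists2 rr, 0 < rr & forall t, 0 < t -> forall A, exists k0, forall k, (k0 <= k)%N ->
    forall y, enorm_sq y <= rr -> A <= u k y t.
Proof.
move=> n3 oO O0 p2 al sw w00 [r [r1 w0s]] E0 M [c [c0 [del [del0 hu0]]]] asol u_ge0.
have n0 : (0 < n)%N by exact: leq_trans n3.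
have n0' : 0 < n%:R :> R by rewrite ltr0n.
have al0 : 0 < al by rewrite divr_gt0// subr_gt0.
have cw : continuous w0 by exact: smooth_continuous.
have [M0 hM] := supremum_bound al0 cw w00; rewrite -/M in M0 hM.
have [e e0 [N0 hN0]] := grid_energy n0 sw w00 r1 w0s p2 E0.
have [T T0 hT] := scheme_blowup p2 e0.
have [P P0 hP] : exists2 P, 0 < P & forall x : 'rV[R]_n, enorm_sq x <= P -> Om x /\ enorm x < del.
  have [d d0 hd] := open_ballP oO O0.
  have m0 : 0 < Num.min d del by rewrite lt_min d0.
  have m20 : 0 < Num.min d del / 2 by rewrite divr_gt0.
  exists ((Num.min d del / 2) ^+ 2); first by rewrite exprn_gt0.
  move=> x xP.
  have : enorm x < Num.min d del.
    apply: (@le_lt_trans _ _ (Num.min d del / 2)); last by rewrite ltr_pdivrMr// ltr_pMr// ltr1n.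
    by rewrite enormE -(ger0_norm (ltW m20)) -sqrtr_sqr ler_wsqrtr.
  rewrite lt_min => /andP[x1 x2]; split => //; apply: hd; rewrite subr0.
  by apply: le_lt_trans x1; exact: norm_le_enorm.
exists (P / 64); first by rewrite divr_gt0.
move=> t t0 A.
(* The cube |x| <= 3 lam must lie in |x|^2 <= P, and the rescaled blow-up time lam^2 T must be at
   most t/4. Together with s0 <= t/4 this leaves a delay between t/2 and t for [expansion]. *)
pose lam := Num.min 1 (Num.min (P / (64 * 9 * n%:R)) (t / (4 * T))).
have lam0 : 0 < lam by rewrite !lt_min ltr01 !divr_gt0// !mulr_gt0.
have lam1 : lam <= 1 by rewrite ge_min lexx.
have lamP : 9 * n%:R * lam <= P / 64.
  have : lam <= P / (64 * 9 * n%:R) by rewrite /lam !ge_min lexx orbT.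
  rewrite ler_pdivlMr ?mulr_gt0// => h.
  by rewrite ler_pdivlMr//; lra.
have lamT : lam * T <= t / 4.
  have : lam <= t / (4 * T) by rewrite /lam !ge_min lexx !orbT.
  by rewrite ler_pdivlMr ?mulr_gt0// => h; rewrite ler_pdivlMr//; lra.
have lam2 : lam ^+ 2 <= lam by rewrite expr2 ler_piMl// ltW.
pose a := lam `^ al.
have a0 : 0 < a by exact: powR_gt0.
have alE : a * lam ^+ 2 = a `^ (p - 1).
  rewrite /a -powR_mulrn ?(ltW lam0)// -powRD; last by apply/implyP => _; rewrite gt_eqF.
  rewrite -powRrM; congr (_ `^ _); rewrite /al; field.
  by rewrite subr_eq0 gt_eqF.
pose f x := a^-1 * w0 (lam^-1 *: x).
have f0 x : 0 <= f x by apply: mulr_ge0; [rewrite invr_ge0 ltW|exact: w00].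
have cf : continuous f.
  move=> x; have h : w0 (lam^-1 *: y) @[y --> x] --> w0 (lam^-1 *: x).
    apply: (@cvg_comp _ _ _ (fun x : 'rV[R]_n => lam^-1 *: x) w0 _ (nbhs (lam^-1 *: x))); last exact: cw.
    exact: scaler_continuous.
  exact: (cvgMl_tmp h).
have fM x : x != 0 -> f x <= M * enorm x `^ (- al).
  move=> x0; have ex0 : 0 < enorm x.
    rewrite lt0r sqrtr_ge0 andbT; apply: contra x0 => /eqP ex.
    have := norm_le_enorm x; rewrite ex normr_le0//.
  have exa : 0 < enorm x `^ al by exact: powR_gt0.
  have [x1|x1] := leP (enorm (lam^-1 *: x)) 1; last first.
    by rewrite /f w0s ?mulr0 ?mulr_ge0 ?powR_ge0// ltW// (lt_trans r1).
  have := hM _ x1; rewrite enormZ ?invr_ge0 ?(ltW lam0)// powRM ?invr_ge0 ?(ltW lam0) ?(ltW ex0)//.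
  have -> : lam^-1 `^ al = a^-1.
    rewrite -(powR_inv1 (ltW lam0)) -powRrM mulN1r powRN.
    exact: erefl.
  by rewrite powRN ler_pdivlMr// /f => h; lra.
have [B B0 hB] := compact_upper_bound (@compact_norm_le R n 1) cw.
have wB y : w0 y <= B.
  have [y1|y1] := leP `|y| 1; first exact: hB.
  rewrite w0s ?(ltW B0)// ltW// (lt_trans r1)// (lt_le_trans y1)// norm_le_enorm//.
have [d d0 hd] : exists2 d : R, 0 < d & forall x y : 'rV[R]_n,
    (forall i, `|x ord0 i - y ord0 i| <= d) -> `|w0 x - w0 y| <= a * c / 4.
  apply: supp_unif_cont => //.
    by move=> x i xi; apply: w0s; apply: le_trans (ltW r1) (le_trans xi (coord_le_enorm _ _)).
  by rewrite divr_gt0// mulr_gt0.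
(* A translation by at most lam d changes w0(x/lam) by at most a c / 4, exactly what the gap in the
   initial bound covers; k does not enter. *)
pose r0 := Num.min lam (lam * d).
have r00 : 0 < r0 by rewrite lt_min lam0 mulr_gt0.
have r0l : r0 <= lam by rewrite ge_min lexx.
have q3 (x : 'rV[R]_n) : `|x| <= 3 * lam -> enorm_sq x <= P.
  move=> /enorm_sq_norm_le h; apply: le_trans h _; rewrite exprMn.
  have h1 : n%:R * lam ^+ 2 <= n%:R * lam by rewrite ler_pM2l.
  by move: h1 lamP P0; clear; lra.
have n1' : 1 <= n%:R :> R by rewrite ler1n.
have QP : r0 ^+ 2 < P / 4.
  have h1 : r0 ^+ 2 <= lam ^+ 2 by apply: lerXn2r; rewrite ?nnegrE ?(ltW lam0) ?(ltW r00).
  have h2 : lam <= n%:R * lam by rewrite ler_peMl// ltW.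
  by move: h1 h2 lam2 lamP P0; clear; lra.
have Q0 : 0 < r0 ^+ 2 by rewrite exprn_gt0.
have t20 : 0 < t / 2 by rewrite divr_gt0.
have [c1 c10 hexp] := @expansion R n (r0 ^+ 2) (P / 4) (t / 2) t Q0 QP t20.
(* The first bound keeps the truncation of the datum at k above f + c; the second makes c1 k / 2 at
   least |A|, with [c1] already fixed. *)
exists (maxn (Num.truncn (a^-1 * B + c)).+1 (Num.truncn (2 * `|A| / c1)).+1) => k.
rewrite geq_max => /andP[k1 k2] y yP.
have kge (x : R) : 0 <= x -> ((Num.truncn x).+1 <= k)%N -> x <= k%:R.
  move=> x0 xk; have /andP[_ h] := truncn_itv x0.
  by apply: le_trans (ltW h) _; rewrite ler_nat.
have kB : a^-1 * B + c <= k%:R.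
  by apply: kge => //; rewrite addr_ge0 ?mulr_ge0 ?invr_ge0 ?(ltW a0) ?(ltW B0) ?(ltW c0).
have kA : 2 * `|A| / c1 <= k%:R by apply: kge => //; rewrite divr_ge0 ?mulr_ge0// ltW.
have k0 : (0 < k)%N by exact: leq_ltn_trans k1.
have fk x : f x + c <= k%:R.
  by apply: le_trans kB; rewrite lerD2r ler_pM2l ?invr_gt0.
have Pu0 (x : 'rV[R]_n) : enorm_sq x <= P -> x != 0 -> f x + c <= u0 x.
  move=> qx x0; have [Ox xd] := hP _ qx.
  have ex0 : 0 < enorm x.
    rewrite lt0r sqrtr_ge0 andbT; apply: contra x0 => /eqP ex.
    have := norm_le_enorm x; rewrite ex normr_le0//.
  move: (hu0 _ Ox) (fM _ x0); rewrite ex0 xd => /(_ isT).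
  by clear; lra.
have t40 : 0 < t / 4 by rewrite divr_gt0.
have [s0 /andP[s00 s0t] hs0] := initial_bound n3 oO (asol k) (u_ge0 k) cf f0 c0 fk P0
  (fun x h => (hP x h).1) Pu0 q3 t40.
have w0u z ee : `|z| <= 1 -> `|ee| <= r0 -> w0 z <= a * u k (lam *: z + ee) s0.
  move=> z1 ee0.
  have n3l : `|lam *: z + ee| <= 3 * lam.
    have h1 : `|lam *: z| <= lam by rewrite normrZ gtr0_norm// ler_piMr// ltW.
    by have := ler_normD (lam *: z) ee; move: h1 ee0 r0l; lra.
  have h1 := hs0 _ n3l.
  have h2 : `|w0 z - w0 (lam^-1 *: (lam *: z + ee))| <= a * c / 4.
    apply: hd => i; rewrite !mxE mulrDr mulKf ?gt_eqF// opprD addNKr normrN normrM.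
    rewrite gtr0_norm ?invr_gt0// ler_pdivrMl//.
    have r0d : r0 <= lam * d by rewrite ge_min lexx orbT.
    exact: le_trans (coord_le_norm ee i) (le_trans ee0 r0d).
  have h3 : a * (f (lam *: z + ee) + c / 4) <= a * u k (lam *: z + ee) s0 by rewrite ler_pM2l.
  have h4 : a * f (lam *: z + ee) = w0 (lam^-1 *: (lam *: z + ee)) by rewrite /f mulVKf ?gt_eqF.
  rewrite mulrDr h4 in h3; move: h2; rewrite ler_norml => /andP[_ h2].
  lra.
have rad_ge : 2 * lam + r0 <= 3 * lam by move: r0l; clear; lra.
have [N1 hN1] := comparison n0 p2 (asol k) (u_ge0 k) lam0 a0 alE k0 s00
  (fun x h => (hP x (q3 x h)).1) rad_ge T0 w00 w0u.
have [tb tb0 htb] := hT (a * k%:R).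
have mb0 : 0 < Num.min 1 tb by rewrite lt_min ltr01.
have [N2 hN2] := mesh_small mb0.
pose N := (maxn (maxn N0 N1) (maxn N2 1)).
have [NN0 NN1 NN2 NN3] : [/\ (N0 <= N)%N, (N1 <= N)%N, (N2 <= N)%N & (0 < N)%N].
  by rewrite /N; split; rewrite !leq_max leqnn ?orbT.
have := hN2 _ NN2; rewrite le_min => /andP[m1 m2].
have mg0 := mesh_gt0 R N.
pose tau : R := mesh R N ^+ 2 / (2 * n%:R).
have tau0 : 0 < tau by rewrite divr_gt0 ?exprn_gt0// mulr_gt0.
have taub : tau <= tb.
  apply: le_trans m2; rewrite ler_pdivrMr ?mulr_gt0// expr2 ler_pM2l//.
  by apply: le_trans m1 _; move: n1'; clear; lra.
have X0 : (0 < #|{: 'rV['I_N]_n}|)%N by rewrite card_mx card_ord expn_gt0 NN3.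
have [j [x [jT jx]]] := htb _ (@walk R n N) tau (@walk_ge0 R n N) (@walk_sym R n N) (@walk_sub R n N)
  tau0 taub X0 (fun x => w0 (gridpt R x)) (fun x => w00 _) (hN0 _ NN0 _ erefl).
pose W i := iter i (scheme_step (@walk R n N) tau p) (fun x => w0 (gridpt R x)).
(* At the first index where the scheme exceeds a k, all earlier values are at most a k, as
   [comparison] requires. *)
have exj : exists j, [exists x, a * k%:R < W j x] by exists j; apply/existsP; exists x.
case: (ex_minnP exj) => j' /existsP[x' jx'] jmin.
have j'j : (j' <= j)%N by apply: jmin; apply/existsP; exists x.
have j'T : j'%:R * tau <= T by apply: le_trans jT; rewrite ler_pM2r// ler_nat.
have before i z : (i < j')%N -> W i z <= a * k%:R.
  move=> ij; rewrite leNgt; apply/negP => h.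
  have bad : (j' <= i)%N by apply: jmin; apply/existsP; exists z.
  by rewrite leqNgt ij in bad.
have cmp := hN1 _ NN1 tau erefl j' j'T before x'.
pose Xc := lam *: gridpt R x'; pose s := s0 + j'%:R * (lam ^+ 2 * tau).
have ul ee : `|ee| <= r0 -> k%:R / 2 <= u k (Xc + ee) s.
  (* From a k < W <= a u + a k / 2, for every translate at once. *)
  by move=> /cmp h; rewrite -(ler_pM2l a0); move: jx' h; rewrite -/(W j') -/Xc -/s; clear; lra.
have qXc : enorm_sq Xc <= P / 64.
  have h : `|Xc| <= lam by rewrite normrZ gtr0_norm// ler_piMr ?(ltW lam0)// gridpt_norm.
  apply: le_trans (enorm_sq_norm_le h) _.
  have h1 : n%:R * lam ^+ 2 <= n%:R * lam by rewrite ler_pM2l.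
  have h2 : 0 <= n%:R * lam by rewrite mulr_ge0// ltW.
  by move: h1 h2 lamP; clear; lra.
have ssol := approx_supersolution oO (asol k).
have s_gt0 : 0 < s by rewrite ltr_pwDl// !mulr_ge0 ?exprn_ge0// ltW.
have st : s <= t / 2.
  have : j'%:R * (lam ^+ 2 * tau) <= lam * T.
    rewrite mulrCA; apply: ler_pM; rewrite ?exprn_ge0 ?mulr_ge0 ?(ltW lam0) ?(ltW tau0)//.
  by rewrite /s; move: lamT s0t; clear; lra.
have fin : c1 * (k%:R / 2) <= u k y t -> A <= u k y t.
  apply: le_trans; apply: le_trans (ler_norm A) _.
  by move: kA; rewrite ler_pdivrMr//; clear; lra.
apply/fin/(hexp Om (u k) Xc s t (k%:R / 2) ssol (u_ge0 k)) => //.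
- by move=> z zP; apply: (hP _ _).1; move: (enorm_sq_triangle z Xc) zP qXc P0; clear; lra.
- by apply/andP; split; move: st s_gt0; clear; lra.
- by move=> z /(enorm_sq_lt_norm r00) /ul; rewrite addrC subrK.
- move: (enorm_sq_triangle (y - Xc) (- Xc)); rewrite opprK subrK enorm_sqN.
  by move: yP qXc; clear; lra.
Qed.

End OriginBlowup.

(** * Spreading to the whole domain *)

Section Spread.
Variables (R : realType) (n : nat).
Implicit Types (Om : set 'rV[R]_n).

Lemma open_contains_eball Om (x : 'rV[R]_n) : open Om -> Om x ->
  exists2 P, 0 < P & forall z, enorm_sq (z - x) <= P -> Om z.
Proof.
move=> oO Ox; have [d d0 hd] := open_ballP oO Ox.
have d20 : 0 < d / 2 by rewrite divr_gt0.
exists ((d / 2) ^+ 2); first by rewrite exprn_gt0.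
move=> z zq; apply: hd; apply: (@le_lt_trans _ _ (d / 2)).
  apply: le_trans (norm_le_enorm _) _.
  by rewrite enormE -(ger0_norm (ltW d20)) -sqrtr_sqr ler_wsqrtr.
by rewrite ltr_pdivrMr// ltr_pMr// ltr1n.
Qed.

(** The radius [d] may depend on [t] but is chosen before [A] and k: [expansion] needs a ball of
    fixed size to yield a constant independent of k. *)
Definition blowup_at (u : nat -> 'rV[R]_n -> R -> R) (x : 'rV[R]_n) :=
  forall t : R, 0 < t -> exists2 d : R, 0 < d & forall A : R, exists k0, forall k, (k0 <= k)%N ->
    forall y, `|y - x| < d -> A <= u k y t.

Lemma blowup_spread Om (u : nat -> 'rV[R]_n -> R -> R) (x x0 : 'rV[R]_n) P :
  (forall k, supersolution Om (u k)) -> (forall k x t, Om x -> 0 < t -> 0 <= u k x t) ->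
  0 < P -> (forall z, enorm_sq (z - x0) <= P -> Om z) ->
  blowup_at u x0 -> enorm_sq (x - x0) < P / 4 -> blowup_at u x.
Proof.
move=> su u0 P0 PO bx0 xP t t0.
have t20 : 0 < t / 2 by rewrite divr_gt0.
have [d d0 hd] := bx0 _ t20.
have d20 : 0 < d / 2 by rewrite divr_gt0.
pose Q := Num.min ((d / 2) ^+ 2) (P / 2).
have Q0 : 0 < Q by rewrite lt_min exprn_gt0//= divr_gt0.
have QP : Q < P by rewrite gt_min; apply/orP; right; lra.
have [c c0 hc] := @expansion R n Q P (t / 2) (t / 2) Q0 QP t20.
have [r r0 hr] := open_ballP (open_eball (P := P / 4)) xP.
exists r => // A.
have [k0 hk0] := hd (`|A| / c).
exists k0 => k kk0 y yx; apply: le_trans (ler_norm A) _.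
have -> : `|A| = c * (`|A| / c) by field; rewrite gt_eqF.
apply: (hc Om (u k) x0 (t / 2) t _ (su k) (u0 k)) => //.
- by apply/andP; split; lra.
- by rewrite divr_ge0// ltW.
- move=> z zQ; apply: hk0 => //.
  have : enorm_sq (z - x0) < (d / 2) ^+ 2 by apply: lt_le_trans zQ _; rewrite ge_min lexx.
  by move=> /(enorm_sq_lt_norm d20); lra.
- by apply: ltW; apply: hr.
Qed.

(** Connectedness replaces a chain of balls: the set of points with locally uniform blow-up is
    nonempty, open and relatively closed. *)
Lemma blowup_everywhere Om (u : nat -> 'rV[R]_n -> R -> R) (x0 : 'rV[R]_n) :
  open Om -> connected Om -> Om x0 ->
  (forall k, supersolution Om (u k)) -> (forall k x t, Om x -> 0 < t -> 0 <= u k x t) ->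
  blowup_at u x0 -> forall x, Om x -> blowup_at u x.
Proof.
move=> oO cO O0 su u0 b0.
pose G := [set x | Om x /\ blowup_at u x].
suff -> : Om = G by move=> x [].
apply/esym/cO; first by exists x0; split.
  exists G; last by apply/seteqP; split => x [h1 h2] //; split => //; case: h2.
  rewrite openE => x [Ox bx]; rewrite /interior/=.
  have [P P0 hP] := open_contains_eball oO Ox.
  have P4 : 0 < P / 4 by rewrite divr_gt0.
  have xx : [set z | enorm_sq (z - x) < P / 4] x by rewrite /= subrr enorm_sq0.
  apply: filterS (open_nbhs_nbhs (conj (@open_eball R n x (P / 4)) xx)) => z /= zq; split.
    by apply: hP; lra.
  exact: blowup_spread su u0 P0 hP bx zq.
exists (closure G); first exact: closed_closure.
apply/seteqP; split => [x Gx|x [Ox cx]]; first by split; [case: Gx|exact: subset_closure].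
split => //.
have [P P0 hP] := open_contains_eball oO Ox.
(* A blow-up point y with |y - x|^2 < P/16 has its ball of squared radius P/4 inside that of squared
   radius P around x, and x lies within a quarter of P/4, the range of [blowup_spread]. *)
have P16 : 0 < P / 16 by rewrite divr_gt0.
have xx : [set z | enorm_sq (z - x) < P / 16] x by rewrite /= subrr enorm_sq0.
have [y [[Oy by_] /= yq]] := cx _ (open_nbhs_nbhs (conj (@open_eball R n x (P / 16)) xx)).
have P40 : 0 < P / 4 by rewrite divr_gt0.
apply: (blowup_spread su u0 P40 _ by_); last first.
  by rewrite -enorm_sqN opprB; lra.
move=> z zq; apply: hP; have := enorm_sq_triangle (z - x) (y - x).
by rewrite opprB addrA subrK; lra.
Qed.

End Spread.

Unset Implicit Arguments.

Theorem theorem4p1 (R : realType) (n : nat) (Om : set 'rV[R]_n) (p : R)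
    (w0 : 'rV[R]_n -> R) (u0 : 'rV[R]_n -> R)
    (u : nat -> 'rV[R]_n -> R -> R) :
  (3 <= n)%N ->
  smooth_bounded_domain Om -> Om 0 ->
  2 * n%:R / (n%:R - 2) < p ->
  let alpha := 2 / (p - 2) in
  (* 0 <= w0 in C_c^oo(B_1(0)) with E_{B_1(0)}(w0) < 0 *)
  smooth w0 -> (forall y, 0 <= w0 y) ->
  (exists r : R, r < 1 /\ forall y, r <= enorm y -> w0 y = 0) ->
  energy p (eball0 1) w0 < 0 ->
  let M := sup [set enorm y `^ alpha * w0 y | y in [set y | enorm y <= 1]] in
  (* 0 <= u0 in C^0(Om \ {0}) *)
  (forall x, Om x -> x != 0 -> 0 <= u0 x) ->
  {in Om `\ 0, continuous u0} ->
  (* liminf_{x -> 0} (u0(x) - M |x|^(-alpha)) > 0 *)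
  (exists c : R, 0 < c /\ exists delta : R, 0 < delta /\
     forall x, Om x -> 0 < enorm x < delta ->
       c < u0 x - M * enorm x `^ (- alpha)) ->
  (* u k is the solution of the k-truncated problem, for every k *)
  (forall k, approx_solution Om p k u0 (u k)) ->
  (* the minimal solution lim_k u k is identically +oo *)
  forall x t, Om x -> 0 < t -> (fun k => u k x t) @ \oo --> +oo.
Proof.
move=> n3 sO O0 pn alpha sw w00 w0s E0 M u00 _ liminf asol x t Ox t0.
have p2 : 2 < p.
  apply: lt_trans pn.
  have n3' : 3 <= n%:R :> R by rewrite ler_nat.
  by rewrite ltr_pdivlMr; lra.
have [oO [cO _]] := sO.
have u_ge0 k := approx_ge0 n3 sO u00 (asol k).
have su k : supersolution Om (u k) := approx_supersolution oO (asol k).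
have [rr rr0 hrr] := origin_blowup n3 oO O0 p2 sw w00 w0s E0 liminf asol u_ge0.
have b0 : blowup_at u 0.
  move=> s s0.
  have z0 : [set z | enorm_sq (z - 0) < rr] (0 : 'rV[R]_n) by rewrite /= subrr enorm_sq0.
  have [d d0 hd] := open_ballP (@open_eball R n 0 rr) z0.
  exists d => // A; have [k0 hk0] := hrr _ s0 A.
  by exists k0 => k kk y /hd; rewrite /= subr0 => yr; apply: hk0 => //; exact: ltW.
have [d d0 hd] := blowup_everywhere oO cO O0 su u_ge0 b0 Ox t0.
apply/cvgryPge => A; have [k0 hk0] := hd A.
near=> k; apply: hk0; last by rewrite subrr normr0.
by near: k; exact: nbhs_infty_ge.
Unshelve. all: by end_near. Qed.
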